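(* Let $M$ be a closed connected surface not homeomorphic to $\mathbb{S}^2$, and let $\Delta$ be a flag triangulation of $M$ with the minimum number of vertices among all flag triangulations of $M$. Then $f_0(\Delta)\geq 11$.
   Context: A simplicial complex is flag if all its minimal non-faces have cardinality 2. $f_0(\Delta)$ denotes the number of vertices of $\Delta$. *)

(* Defs.v *)
From mathcomp Require Import all_boot all_order all_algebra.
From mathcomp Require Import all_classical all_reals all_analysis.
Import Order.TTheory GRing.Theory Num.Theory.
Import numFieldNormedType.Exports.

Set Implicit Arguments.
Unset Strict Implicit.
Unset Printing Implicit Defensive.

Local Open Scope classical_set_scope.
Local Open Scope ring_scope.

Definition homeomorphic (X Y : topologicalType) : Prop :=
  exists (f : X -> Y) (g : Y -> X),
    [/\ cancel f g, cancel g f, continuous f & continuous g].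

(* Sets coerce to types through [set_type], which carries the subspace
   topology. *)
Definition locally_euclidean (R : realType) (n : nat) (M : topologicalType) :
    Prop :=
  forall p : M, exists (U : set M) (W : set 'rV[R]_n),
    [/\ open U, U p, open W & homeomorphic U W].

(* [connected setT] holds for the empty space, hence the nonemptiness clause;
   "closed" means compact, [locally_euclidean] already excluding a boundary. *)
Definition closed_connected_surface (R : realType) (M : topologicalType) :
    Prop :=
  [/\ hausdorff_space M, @second_countable M & locally_euclidean R 2 M] /\
  [/\ compact [set: M], connected [set: M] & [set: M] !=set0].

Definition sphere2 (R : realType) : set 'rV[R]_3 :=
  [set x | \sum_i x 0 i ^+ 2 = 1].
Arguments sphere2 R _ : clear implicits.

(* Elements of [V] need not all be vertices. *)
Record simplicial_complex (V : finType) := SimplicialComplex {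
  faces : {set {set V}};
  faces0 : finset.set0 \in faces;
  faces_sub : forall s t : {set V}, s \in faces -> t \subset s -> t \in faces
}.

Definition vertices (V : finType) (D : simplicial_complex V) : {set V} :=
  [set v | [set v]%SET \in faces D]%SET.

Definition f0 (V : finType) (D : simplicial_complex V) : nat := #|vertices D|.

Definition minimal_nonface (V : finType) (D : simplicial_complex V)
    (s : {set V}) : Prop :=
  [/\ s \subset vertices D, s \notin faces D
    & forall t : {set V}, t \proper s -> t \in faces D].

Definition flag (V : finType) (D : simplicial_complex V) : Prop :=
  forall s : {set V}, minimal_nonface D s -> #|s| = 2%N.

(* Barycentric coordinates, topologised as a subspace of the product R^V. *)
Definition realization (V : finType) (D : simplicial_complex V) (R : realType) :
    set {ptws V -> R} :=
  [set x : {ptws V -> R} |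
     [/\ forall v, 0 <= x v, \sum_v x v = 1
       & [set v | x v != 0]%SET \in faces D]].
Arguments realization {V} D R _.

Definition triangulates (V : finType) (D : simplicial_complex V)
    (R : realType) (M : topologicalType) : Prop :=
  homeomorphic (realization D R) M.

Definition minimal_flag_triangulation (R : realType) (M : topologicalType)
    (V : finType) (D : simplicial_complex V) : Prop :=
  [/\ flag D, triangulates D R M
    & forall (W : finType) (E : simplicial_complex W),
        flag E -> triangulates E R M -> (f0 D <= f0 E)%N].

(* Main.v *)
Require Import Defs.
From mathcomp Require Import all_boot all_order all_algebra.
From mathcomp Require Import all_classical all_reals all_analysis.
From mathcomp Require Import ring lra zify.
Import Order.TTheory GRing.Theory Num.Theory.
Import numFieldNormedType.Exports.

Set Implicit Arguments.
Unset Strict Implicit.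
Unset Printing Implicit Defensive.

Local Open Scope classical_set_scope.
Local Open Scope ring_scope.

(* Minimality forbids contractible edges: contracting an edge [wc] that lies in no
   induced 4-cycle gives a smaller flag triangulation of the same surface, because
   the contraction is a composite of bistellar flips.  So it is enough to show that
   a flag triangulation with at most 10 vertices, all of whose edges lie in induced
   4-cycles, is the octahedron, hence a sphere.

   Topology enters only through local facts about the graph: it has no K4, every
   edge lies in exactly two triangles, and links and the graph itself are
   connected.  The upper bounds hold because three half-planes glued along a line
   contain a K5, which is not planar (a mod 2 crossing count for polygons in general
   position, after sampling and perturbing the curves); the lower bound and the
   connectedness of links hold because a point of a surface neither has a half-plane
   neighbourhood nor is a local cut point.

   For the combinatorial part let [v] have maximal degree and let [W] be the set of
   vertices at distance at least 2 from [v].  Two adjacent neighbours of [v] have a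
   second common neighbour, which lies in [W], and a neighbour [u] of [v] has
   exactly [deg u - 3] neighbours in [W], no one of them isolated among several.
   If [W] has one vertex, an induced 4-cycle through an edge of the link of [v] is
   the whole link, and the triangulation is the octahedron.  If [W] is larger, then
   either [W] has at most three vertices or the maximal degree is at most 5, and an
   induced 4-cycle through a suitable edge of [W] leads to a contradiction. *)

(** * Nonplanarity of the complete graph on five vertices *)

(** The nonplanarity of K5 is reduced to finite combinatorics: for points in general position,
    crossings depend only on the orientations of triples, and the parities needed follow from sign
    axioms on five points by enumeration. It excludes three half-planes along a line directly. It
    excludes boundary points because K5 minus an edge fits into the chart, while the missing edge
    may pass through the half-plane that the image of the chart avoids. Local cut points need only
    segments and the intermediate value theorem.

    The complexes between two successive flips need not be flag, so flips act on bare sets of facets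
    and flagness is recovered only for the final contraction.

    The bound 10 enters through a count: [v], its neighbours and [W] exhaust the vertices, so the
    degree of [v] and the size of [W] add up to at most 9. With at least four vertices in [W] the
    degree is at most 5, and a neighbour of [v] has at most two neighbours in [W], or at most one if
    the degree is at most 4. The extreme case is degree 5 with exactly four vertices in [W]. *)

Section PlaneOrientation.
Context (R : realFieldType) (I : eqType) (X Y : I -> R).

Definition det3 (a b c : I) : R :=
  (X b - X a) * (Y c - Y a) - (X c - X a) * (Y b - Y a).

Definition general_position : Prop :=
  forall a b c, uniq [:: a; b; c] -> det3 a b c != 0.

Definition orient (a b c : I) : bool := 0 < det3 a b c.

Definition crossing (a b c d : I) : bool :=
  (orient a b c != orient a b d) && (orient c d a != orient c d b).

Definition in_triangle (x y z a : I) : bool :=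
  (orient x y a == orient y z a) && (orient y z a == orient z x a).

Lemma det3_rot a b c : det3 b c a = det3 a b c.
Proof. by rewrite /det3; ring. Qed.

Lemma det3_swap a b c : det3 b a c = - det3 a b c.
Proof. by rewrite /det3; ring. Qed.

Lemma det3_sum x y z a :
  det3 x y z = det3 y z a + det3 x y a - det3 x z a.
Proof. by rewrite /det3; ring. Qed.

Lemma det3_plucker a b c d e :
  det3 a b c * det3 a d e - det3 a b d * det3 a c e + det3 a b e * det3 a c d = 0.
Proof. by rewrite /det3; ring. Qed.

Lemma orient_rot a b c : orient b c a = orient a b c.
Proof. by rewrite /orient det3_rot. Qed.

Lemma orient_swap (gp : general_position) a b c :
  uniq [:: a; b; c] -> orient b a c = ~~ orient a b c.
Proof.
by move=> /gp; rewrite /orient (det3_swap a b) oppr_gt0 -leNgt le_eqVlt => /negPf ->.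
Qed.

Definition orient_rules (a b c : I) : Type :=
  ((orient b c a = orient a b c) * (orient c a b = orient a b c) *
   (orient b a c = ~~ orient a b c) * (orient a c b = ~~ orient a b c) *
   (orient c b a = ~~ orient a b c))%type.

Lemma orient_perm (gp : general_position) a b c :
  uniq [:: a; b; c] -> orient_rules a b c.
Proof.
move=> u; have s := orient_swap gp u.
by rewrite /orient_rules (orient_rot b c a) (orient_rot a c b) (orient_rot b a c) (orient_rot a b c) s.
Qed.

(* The two boolean conditions are the acyclicity and three-term
   Grassmann-Pluecker axioms of chirotopes. *)
Definition acyclic4 (xyz yza xya xza : bool) : bool :=
  ~~ [&& xyz == xza, xya == ~~ xza & yza == ~~ xza].

Definition plucker5 (abc ade abd ace abe acd : bool) : bool :=
  ~~ (((abc == ade) == (abd != ace)) && ((abc == ade) == (abe == acd))).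

(** In [det3_sum] the forbidden pattern would give the left side one sign and all three signed terms
    on the right the opposite sign. *)
Lemma acyclic4P (gp : general_position) x y z a : uniq [:: x; y; z; a] ->
  acyclic4 (orient x y z) (orient y z a) (orient x y a) (orient x z a).
Proof.
move=> u; have := det3_sum x y z a; rewrite /orient.
move: u; rewrite /= !inE !negb_or -!andbA => /and5P[xy xz xa yz /and3P[ya za _]].
have := gp x y z; have := gp y z a; have := gp x y a; have := gp x z a.
rewrite /= !inE !negb_or xy xz xa yz ya za /=.
move=> /(_ isT) + /(_ isT) + /(_ isT) + /(_ isT); rewrite /acyclic4.
case: (ltrgt0P (det3 x y z)) => //; case: (ltrgt0P (det3 x y a)) => //;
  case: (ltrgt0P (det3 y z a)) => //; case: (ltrgt0P (det3 x z a)) => //= *; lra.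
Qed.

Lemma pos_eqb (p q : R) : p != 0 -> q != 0 -> ((0 < p) == (0 < q)) = (0 < p * q).
Proof.
case: (ltrgt0P p) => //; case: (ltrgt0P q) => // hq hp _ _; apply/esym.
- by rewrite mulr_gt0.
- by rewrite pmulr_rgt0 // lt_gtF.
- by rewrite pmulr_lgt0 // lt_gtF.
- by rewrite nmulr_rgt0.
Qed.

(** The forbidden pattern would give the three signed products of [det3_plucker] a common sign, and
    they could not sum to zero. *)
Lemma plucker5P (gp : general_position) a b c d e : uniq [:: a; b; c; d; e] ->
  plucker5 (orient a b c) (orient a d e) (orient a b d) (orient a c e)
           (orient a b e) (orient a c d).
Proof.
move=> u; have := det3_plucker a b c d e; rewrite /orient.
have := gp a b c; have := gp a d e; have := gp a b d; have := gp a c e.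
have := gp a b e; have := gp a c d.
move: u; rewrite /= !inE !negb_or -!andbA.
move=> /and5P[-> -> -> -> /and5P[-> -> -> -> /and3P[-> -> _]]] /=.
move=> /(_ isT) n1 /(_ isT) n2 /(_ isT) n3 /(_ isT) n4 /(_ isT) n5 /(_ isT) n6.
rewrite /plucker5 (pos_eqb n6 n5) (pos_eqb n4 n3) (pos_eqb n2 n1).
have := mulf_neq0 n6 n5; have := mulf_neq0 n4 n3; have := mulf_neq0 n2 n1.
move: n1 n2 n3 n4 n5 n6 => _ _ _ _ _ _.
set p := det3 a b c * _; set q := det3 a b d * _; set r := det3 a b e * _.
clearbody p q r.
by case: (ltrgt0P p) => //; case: (ltrgt0P q) => //; case: (ltrgt0P r) => //= *; lra.
Qed.

(** Acyclicity for the five sorted quadruples and one Grassmann-Pluecker relation for each of the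
    five base points, written in the ten sorted triples; a negation marks an odd permutation. *)
Definition chirotope5 (abc abd abe acd ace ade bcd bce bde cde : bool) : bool :=
  [&& acyclic4 abc bcd abd acd, acyclic4 abc bce abe ace,
      acyclic4 abd bde abe ade, acyclic4 acd cde ace ade,
      acyclic4 bcd cde bce bde,
      plucker5 abc ade abd ace abe acd,
      plucker5 (~~ abc) bde (~~ abd) bce (~~ abe) bcd,
      plucker5 abc cde (~~ acd) (~~ bce) (~~ ace) (~~ bcd),
      plucker5 abd (~~ cde) acd (~~ bde) (~~ ade) bcd
    & plucker5 abe cde ace bde ade bce].

Section FivePoints.
Context (gp : general_position) (a b c d e : I) (u : uniq [:: a; b; c; d; e]).

Lemma orient_sort5 :
  (orient_rules a b c * orient_rules a b d * orient_rules a b e *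
   orient_rules a c d * orient_rules a c e * orient_rules a d e *
   orient_rules b c d * orient_rules b c e * orient_rules b d e *
   orient_rules c d e)%type.
Proof.
have r m x y z : [:: x; y; z] = mask m [:: a; b; c; d; e] -> orient_rules x y z.
  by move=> xE; apply: (orient_perm gp); rewrite xE mask_uniq.
split; last exact: (r [:: false; false; true; true; true]).
split; last exact: (r [:: false; true; false; true; true]).
split; last exact: (r [:: false; true; true; false; true]).
split; last exact: (r [:: false; true; true; true]).
split; last exact: (r [:: true; false; false; true; true]).
split; last exact: (r [:: true; false; true; false; true]).
split; last exact: (r [:: true; false; true; true]).
split; last exact: (r [:: true; true; false; false; true]).
split; last exact: (r [:: true; true; false; true]).
exact: (r [:: true; true; true]).
Qed.

Lemma orient_chirotope5 :
  chirotope5 (orient a b c) (orient a b d) (orient a b e) (orient a c d)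
    (orient a c e) (orient a d e) (orient b c d) (orient b c e) (orient b d e)
    (orient c d e).
Proof.
have sub4 m x y z t : [:: x; y; z; t] = mask m [:: a; b; c; d; e] ->
    acyclic4 (orient x y z) (orient y z t) (orient x y t) (orient x z t).
  by move=> xE; apply: (acyclic4P gp); rewrite xE mask_uniq.
have pl x y z t v : perm_eq [:: x; y; z; t; v] [:: a; b; c; d; e] ->
    plucker5 (orient x y z) (orient x t v) (orient x y t) (orient x z v)
             (orient x y v) (orient x z t).
  by move=> /perm_uniq; rewrite u => /(plucker5P gp).
have pa := pl a b c d e (perm_refl _).
have pb : _ := pl b a c d e ltac:(apply/permP => q /=; lia).
have pc : _ := pl c a b d e ltac:(apply/permP => q /=; lia).
have pd : _ := pl d a b c e ltac:(apply/permP => q /=; lia).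
have pe : _ := pl e a b c d ltac:(apply/permP => q /=; lia).
move: pa pb pc pd pe; rewrite /chirotope5 !orient_sort5 => -> -> -> -> ->.
by rewrite (sub4 [:: true; true; true; true]) // (sub4 [:: true; true; true; false; true]) //
  (sub4 [:: true; true; false; true; true]) // (sub4 [:: true; false; true; true; true]) //
  (sub4 [:: false; true; true; true; true]).
Qed.
End FivePoints.

(** The mod 2 Jordan property of a triangle. Both sides depend only on the ten orientations, and the
    identity is checked on all 1024 sign patterns, those violating [chirotope5] being vacuous. *)
Lemma crossing_triangle (gp : general_position) a b x y z :
  uniq [:: a; b; x; y; z] ->
  crossing a b x y (+) crossing a b y z (+) crossing a b z x =
  in_triangle x y z a (+) in_triangle x y z b.
Proof.
move=> u; have := orient_chirotope5 gp u; rewrite /crossing /in_triangle.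
rewrite !(orient_sort5 gp u).
move: (orient a b x) (orient a b y) (orient a b z) (orient a x y).
move: (orient a x z) (orient a y z) (orient b x y) (orient b x z).
move: (orient b y z) (orient x y z).
by do 10! case.
Qed.

(** The terms are the fifteen pairs of disjoint segments among five points; their odd parity is the
    straight-line case of nonplanarity, again checked on every sign pattern that [chirotope5]
    allows. *)
Lemma crossing_K5 (gp : general_position) (a b c d e : I) :
  uniq [:: a; b; c; d; e] ->
  crossing a b c d (+) crossing a b c e (+) crossing a b d e (+)
  (crossing a c b d (+) crossing a c b e (+) crossing a c d e) (+)
  (crossing a d b c (+) crossing a d b e (+) crossing a d c e) (+)
  (crossing a e b c (+) crossing a e b d (+) crossing a e c d) (+)
  (crossing b c d e (+) crossing b d c e (+) crossing b e c d).
Proof.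
move=> u; have := orient_chirotope5 gp u; rewrite /crossing.
rewrite !(orient_sort5 gp u).
move: (orient a b c) (orient a b d) (orient a b e) (orient a c d).
move: (orient a c e) (orient a d e) (orient b c d) (orient b c e).
move: (orient b d e) (orient c d e).
by do 10! case.
Qed.
End PlaneOrientation.

(** * Crossing parity of polygons *)

Definition segments (T : Type) (x : T) (s : seq T) : seq (T * T) := zip (x :: s) s.

Lemma segments_rcons (T : Type) (x y : T) s :
  segments x (rcons s y) = rcons (segments x s) (last x s, y).
Proof. by rewrite /segments; elim: s x => //= z s IH x; rewrite -IH. Qed.

Lemma mem_segments (T : eqType) (x : T) s p :
  p \in segments x s -> (p.1 \in x :: s) && (p.2 \in s).
Proof.
rewrite /segments; elim: s x => //= y s IH x; rewrite inE => /orP[/eqP->/=|/IH].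
  by rewrite !inE !eqxx.
by move=> /andP[h1 h2]; rewrite h1 orbT /= in_cons h2 orbT.
Qed.

Lemma addb_telescope (T : Type) (F : T -> bool) x s :
  \big[addb/false]_(p <- segments x s) (F p.1 (+) F p.2) = F x (+) F (last x s).
Proof.
rewrite /segments; elim: s x => [|y s IH] x /=; first by rewrite big_nil addbb.
by rewrite big_cons IH /= addbA addbK.
Qed.

Section PolygonCrossing.
Context (R : realFieldType) (I : eqType) (X Y : I -> R) (gp : general_position X Y).
Local Notation cr := (crossing X Y).

Definition polygon_crossing (x : I) (s : seq I) (y : I) (t : seq I) : bool :=
  \big[addb/false]_(p <- segments x s) \big[addb/false]_(q <- segments y t)
    cr p.1 p.2 q.1 q.2.
Local Notation pcr := polygon_crossing.

Lemma crossing_sym a b c d : cr a b c d = cr c d a b.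
Proof. by rewrite /crossing andbC. Qed.

Lemma crossing_swap a b c d : uniq [:: a; b; c; d] -> cr b a c d = cr a b c d.
Proof.
move=> u; have ru m x y z : [:: x; y; z] = mask m [:: a; b; c; d] ->
    orient X Y y x z = ~~ orient X Y x y z.
  by move=> xE; apply: (orient_swap gp); rewrite xE mask_uniq.
rewrite /crossing (ru [:: true; true; true] a b c) //.
rewrite (ru [:: true; true; false; true] a b d) //.
by rewrite eqb_negLR negbK eq_sym [in X in _ && X]eq_sym.
Qed.

Lemma pcr_sym x s y t : pcr x s y t = pcr y t x s.
Proof.
rewrite /pcr exchange_big /=; apply: eq_bigr => q _; apply: eq_bigr => p _.
exact: crossing_sym.
Qed.

Lemma pcr_rcons x s z y t :
  pcr x (rcons s z) y t = pcr x s y t (+) pcr (last x s) [:: z] y t.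
Proof. by rewrite /pcr segments_rcons big_rcons /= big_seq1 addbC. Qed.

Definition noncollapsed (x : I) s := all (fun q => q.1 != q.2) (segments x s).

Lemma pcr_swap a b y t : a != b -> noncollapsed y t ->
  {in y :: t, forall z, z \notin [:: a; b]} -> pcr b [:: a] y t = pcr a [:: b] y t.
Proof.
move=> ab /allP nt dis; rewrite /pcr !big_seq1 /=; apply: eq_big_seq => -[q r] qP /=.
have /= /andP[qI rI] := mem_segments qP; have /= qr := nt _ qP.
have {}rI : r \in y :: t by rewrite inE rI orbT.
apply: crossing_swap; move: (dis _ qI) (dis _ rI).
rewrite /= !inE !negb_or => /andP[qa qb] /andP[ra rb].
by rewrite ab qr (eq_sym a q) qa (eq_sym a r) ra (eq_sym b q) qb (eq_sym b r) rb.
Qed.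

(** The second polygon is coned off from the auxiliary point [o]; [F a] is the parity of the number
    of cone triangles containing [a]. A segment of the first polygon changes [F] by its crossings
    with the boundaries of these triangles. The sides through [o] cancel because the second polygon
    is closed, and the changes of [F] telescope to zero because the first one is. *)
Lemma pcr_closed o x s y t : last x s = x -> last y t = y ->
  noncollapsed x s -> noncollapsed y t ->
  {in x :: s, forall z, z \notin o :: y :: t} -> o \notin y :: t ->
  pcr x s y t = false.
Proof.
move=> xs yt /allP nx /allP ny dis oy.
pose F a := \big[addb/false]_(q <- segments y t) in_triangle X Y o q.1 q.2 a.
rewrite /pcr (eq_big_seq (fun p => F p.1 (+) F p.2)).
  by rewrite addb_telescope xs addbb.
move=> [a b] pP /=; rewrite /F -big_split /=.
have /= /andP[aI bI] := mem_segments pP; have /= ab := nx _ pP.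
have {}bI : b \in x :: s by rewrite inE bI orbT.
transitivity (\big[addb/false]_(q <- segments y t) (cr a b o q.1 (+) cr a b o q.2)
    (+) \big[addb/false]_(q <- segments y t) cr a b q.1 q.2).
  by rewrite (addb_telescope (cr a b o)) yt addbb.
rewrite -big_split /=; apply: eq_big_seq => -[q r] qP /=.
have /= /andP[qI rI] := mem_segments qP; have /= qr := ny _ qP.
have {}rI : r \in y :: t by rewrite inE rI orbT.
have nin z w : z \in x :: s -> w \in o :: y :: t -> z != w.
  by move=> zI wI; apply: contraTneq wI => <-; exact: dis.
have u : uniq [:: a; b; o; q; r].
  have oI : o \in o :: y :: t by rewrite mem_head.
  have qI' : q \in o :: y :: t by rewrite inE qI orbT.
  have rI' : r \in o :: y :: t by rewrite inE rI orbT.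
  have oq : o != q by apply: contraNneq oy => ->.
  have or : o != r by apply: contraNneq oy => ->.
  by rewrite /= !inE !negb_or ab qr oq or !nin.
rewrite -(crossing_triangle gp u).
rewrite (crossing_sym a b r o) (@crossing_swap o r a b); last first.
  rewrite (uniq_catC [:: o; r] [:: a; b]).
  exact: (mask_uniq u [:: true; true; true; false; true]).
rewrite (crossing_sym o r a b).
by move: (cr a b o q) (cr a b o r) (cr a b q r) => [] [] [].
Qed.

(** Closing the chain by its chord gives a closed polygon, which crosses the other one evenly; chain
    and chord therefore contribute the same parity. *)
Lemma pcr_closure o x s y t : last y t = y -> noncollapsed x s ->
  x != last x s -> noncollapsed y t ->
  {in x :: s, forall z, z \notin o :: y :: t} -> o \notin y :: t ->
  pcr x s y t = pcr x [:: last x s] y t.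
Proof.
move=> yt nx xl ny dis oy.
have dis' z w : z \in x :: s -> w \in o :: y :: t -> z != w.
  by move=> zI wI; apply: contraTneq wI => <-; exact: dis.
have : pcr x (rcons s x) y t = false.
  apply: (@pcr_closed o) => //; first by rewrite last_rcons.
    by rewrite /noncollapsed segments_rcons all_rcons /= eq_sym xl.
  by move=> z; rewrite -rcons_cons mem_rcons inE => /orP[/eqP->|/dis//]; rewrite dis ?mem_head.
rewrite pcr_rcons (@pcr_swap x) //; last first.
  move=> z zI; rewrite !inE !negb_or; apply/andP; split; rewrite eq_sym;
    by rewrite dis' ?mem_last ?mem_head // inE zI orbT.
by move: (pcr x s y t) (pcr x [:: last x s] y t) => [] [].
Qed.

Definition K5_edges : seq (nat * nat) :=
  [:: (0, 1); (0, 2); (0, 3); (0, 4); (1, 2); (1, 3); (1, 4); (2, 3); (2, 4); (3, 4)]%N.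

Lemma K5_edge_lt e : e \in K5_edges -> (e.1 < e.2 < 5)%N.
Proof. exact: (allP (isT : all (fun e => (e.1 < e.2 < 5)%N) K5_edges) e). Qed.

Definition disjoint_edges (e f : nat * nat) : bool := uniq [:: e.1; e.2; f.1; f.2].

(** Disjoint edges have distinct first ends, so comparing these selects each of the fifteen
    unordered pairs once. *)
Definition K5_disjoint_pairs :=
  [seq ef <- [seq (e, f) | e <- K5_edges, f <- K5_edges] |
    disjoint_edges ef.1 ef.2 && (ef.1.1 < ef.2.1)%N].

Section PolygonK5.
Context (o : I) (p : nat -> I) (s : nat -> nat -> seq I).
Context (up : uniq (o :: [seq p i | i <- iota 0 5])).
Context (edgeP : {in K5_edges, forall e, [/\ last (p e.1) (s e.1 e.2) = p e.2,
     noncollapsed (p e.1) (s e.1 e.2) & o \notin s e.1 e.2]}).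
Context (disP : {in K5_edges &, forall e f, disjoint_edges e f ->
    {in p e.1 :: s e.1 e.2, forall z, z \notin p f.1 :: s f.1 f.2}}).

(* Parities of crossings between two polygonal edges ([P]), between an edge and a
   chord ([M]) and between two chords ([L]). Closed polygons cross evenly, so [P]
   equals [L] up to terms that cancel over the triangles disjoint from an edge. *)
Let P (e f : nat * nat) := pcr (p e.1) (s e.1 e.2) (p f.1) (s f.1 f.2).
Let M (e f : nat * nat) := pcr (p e.1) (s e.1 e.2) (p f.1) [:: p f.2].
Let L (e f : nat * nat) := pcr (p e.1) [:: p e.2] (p f.1) [:: p f.2].

Let p_inj i j : (i < 5)%N -> (j < 5)%N -> (p i == p j) = (i == j).
Proof.
move: up; rewrite cons_uniq => /andP[_ u] i5 j5; have := nth_uniq o (i := i) (j := j) _ _ u.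
by rewrite !size_map !size_iota => /(_ i5 j5); rewrite !(nth_map 0%N) ?size_iota // !nth_iota.
Qed.

Let op i : (i < 5)%N -> o != p i.
Proof.
by case: i => [|[|[|[|[|[]]]]]] // _; move: up => /= /andP[]; rewrite !inE !negb_or => /and5P[].
Qed.

Let edge_endpoints e : e \in K5_edges ->
  (p e.1 \in p e.1 :: s e.1 e.2) && (p e.2 \in p e.1 :: s e.1 e.2).
Proof. by move=> /edgeP[<- _ _]; rewrite mem_head mem_last. Qed.

Let edge_chord_neq e : e \in K5_edges -> p e.1 != last (p e.1) (s e.1 e.2).
Proof.
move=> eE; have [-> _ _] := edgeP eE; have /andP[lt12 lt2] := K5_edge_lt eE.
by rewrite p_inj ?(ltn_trans lt12 lt2) // ltn_eqF.
Qed.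

(** The three chords on [k], [l], [m] form a closed polygon, which by [pcr_closure] an edge and its
    chord cross with the same parity. *)
Let edge_triangle i j k l m : (i, j) \in K5_edges -> (k, l) \in K5_edges ->
  (k, m) \in K5_edges -> (l, m) \in K5_edges -> uniq [:: i; j; k; l; m] ->
  M (i, j) (k, l) (+) (M (i, j) (k, m) (+) M (i, j) (l, m)) =
  L (i, j) (k, l) (+) (L (i, j) (k, m) (+) L (i, j) (l, m)).
Proof.
move=> ij kl km lm; rewrite /= !inE !negb_or -!andbA.
move=> /and5P[nij nik nil nim /and5P[njk njl njm nkl /and3P[nkm nlm _]]].
have /= /andP[_ l5] := K5_edge_lt kl; have /= /andP[ltlm m5] := K5_edge_lt lm.
have /= /andP[ltkl _] := K5_edge_lt kl; have k5 := ltn_trans ltkl l5.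
have [/= lij nc os] := edgeP ij; have /= /andP[ltij j5] := K5_edge_lt ij.
have i5 := ltn_trans ltij j5.
have dkl : disjoint_edges (i, j) (k, l).
  by rewrite /disjoint_edges /= !inE !negb_or nij nik nil njk njl nkl.
have dkm : disjoint_edges (i, j) (k, m).
  by rewrite /disjoint_edges /= !inE !negb_or nij nik nim njk njm nkm.
have d_kl z : z \in p i :: s i j -> (z != p k) && (z != p l).
  move=> /(disP ij kl dkl) zkl; have /= /andP[kI lI] := edge_endpoints kl.
  by apply/andP; split; apply: contraNneq zkl => ->.
have d_m z : z \in p i :: s i j -> z != p m.
  move=> /(disP ij km dkm) zkm; have /= /andP[kI mI] := edge_endpoints km.
  by apply: contraNneq zkm => ->.
have split_tri y t : noncollapsed y t -> {in y :: t, forall z, z \notin [:: p k; p m]} ->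
    pcr y t (p k) [:: p l; p m; p k] = pcr y t (p k) [:: p l] (+)
      (pcr y t (p k) [:: p m] (+) pcr y t (p l) [:: p m]).
  move=> nyt dyt; rewrite pcr_sym (pcr_rcons _ [:: p l; p m]) (pcr_rcons _ [:: p l]) /=.
  rewrite (@pcr_swap (p k) (p m)) // ?p_inj //.
  by rewrite -addbA ![pcr y t _ _]pcr_sym [X in _ (+) X]addbC.
rewrite /M /L -!split_tri //=.
- rewrite -[in RHS]lij; apply: (@pcr_closure o) => //.
  + exact: edge_chord_neq ij.
  + by rewrite /noncollapsed /= !p_inj // nkl nlm eq_sym nkm.
  + move=> z zI; have /andP[zk zl] := d_kl z zI; rewrite !inE !negb_or zk zl d_m // !andbT.
    move: zI; rewrite inE => /orP[/eqP->|zs]; last by apply: contraNneq os => <-.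
    by rewrite eq_sym op.
  + by rewrite !inE !negb_or !op.
- by rewrite /noncollapsed /= andbT p_inj // ltn_eqF.
- move=> z; rewrite inE [in X in _ || X]inE => /orP[/eqP->|/eqP->].
    by have /andP[zk _] := d_kl (p i) (mem_head _ _); rewrite !inE negb_or zk d_m ?mem_head.
  by have := mem_last (p i) (s i j); rewrite lij => jI; have /andP[zk _] := d_kl _ jI;
    rewrite !inE negb_or zk d_m.
- by move=> z zI; have /andP[zk _] := d_kl _ zI; rewrite !inE negb_or zk d_m.
Qed.

(** Each edge is closed up by its chord. The two closed polygons cross evenly, and expanding this
    parity over edges and chords gives the four terms. *)
Let edge_pair e f : e \in K5_edges -> f \in K5_edges -> disjoint_edges e f ->
  P e f = L e f (+) (M e f (+) L e f) (+) (M f e (+) L f e).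
Proof.
move=> eE fE d; have de := disP eE fE d; have [le ne oe] := edgeP eE; have [lf nf of_] := edgeP fE.
have cl y t : noncollapsed y t -> {in y :: t, forall z, z \in p e.1 :: s e.1 e.2} ->
  pcr y t (p f.1) (rcons (s f.1 f.2) (p f.1)) =
  pcr y t (p f.1) (s f.1 f.2) (+) pcr y t (p f.1) [:: p f.2].
  move=> nyt yt; rewrite pcr_sym pcr_rcons lf ![pcr y t _ _]pcr_sym; congr (_ (+) _).
  apply: pcr_swap => //; first by rewrite -lf edge_chord_neq.
  move=> z /yt /de zf; have /andP[h1 h2] := edge_endpoints fE.
  by rewrite !inE negb_or; apply/andP; split; apply: contraNneq zf => ->.
have := @pcr_closure o (p e.1) (s e.1 e.2) (p f.1) (rcons (s f.1 f.2) (p f.1)).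
rewrite le !cl //; first last.
- by move=> z; rewrite !inE => /orP[/eqP->|/eqP->]; have /andP[] := edge_endpoints eE; rewrite inE.
- by rewrite /noncollapsed /= -le edge_chord_neq.
rewrite -/(P e f) -/(M e f) -/(L e f) [pcr _ [:: p e.2] _ (s _ _)]pcr_sym -/(M f e).
have -> : L f e = L e f by exact: pcr_sym.
have H (a b c d' : bool) : a (+) b = c (+) d' -> a = d' (+) (b (+) d') (+) (c (+) d').
  by move: a b c d' => [] [] [] [].
move=> h; apply: H; apply: h => //.
- by rewrite last_rcons.
- by rewrite -le edge_chord_neq.
- by rewrite /noncollapsed segments_rcons all_rcons /= eq_sym edge_chord_neq.
- move=> z zI; rewrite inE negb_or -rcons_cons mem_rcons inE negb_or.
  have zf := de _ zI; rewrite zf andbT; apply/andP; split; last first.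
    by have /andP[h1 _] := edge_endpoints fE; apply: contraNneq zf => ->.
  move: zI; rewrite inE => /orP[/eqP->|zs]; last by apply: contraNneq oe => <-.
  by rewrite eq_sym op //; have /andP[h1 h2] := K5_edge_lt eE; exact: ltn_trans h1 h2.
- rewrite inE mem_rcons inE !negb_or of_ andbT andbb op //.
  by have /andP[h1 h2] := K5_edge_lt fE; exact: ltn_trans h1 h2.
Qed.

Let L_K5 : \big[addb/false]_(ef <- K5_disjoint_pairs) L ef.1 ef.2.
Proof.
have -> : \big[addb/false]_(ef <- K5_disjoint_pairs) L ef.1 ef.2 =
    \big[addb/false]_(ef <- K5_disjoint_pairs)
      cr (p ef.1.1) (p ef.1.2) (p ef.2.1) (p ef.2.2).
  by apply: eq_bigr => ef _; rewrite /L /pcr !big_seq1.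
rewrite unlock /= addbF.
have := crossing_K5 gp (a := p 0) (b := p 1) (c := p 2) (d := p 3) (e := p 4).
rewrite !addbA; move: up; rewrite cons_uniq => /andP[_ u] /(_ u).
by [].
Qed.

Lemma polygon_K5 : \big[addb/false]_(ef <- K5_disjoint_pairs) P ef.1 ef.2.
Proof.
pose A e f := M e f (+) L e f.
have -> : \big[addb/false]_(ef <- K5_disjoint_pairs) P ef.1 ef.2 =
    \big[addb/false]_(ef <- K5_disjoint_pairs) L ef.1 ef.2 (+)
    \big[addb/false]_(ef <- K5_disjoint_pairs) (A ef.1 ef.2 (+) A ef.2 ef.1).
  rewrite -big_split /=; apply: eq_big_seq => -[e f].
  rewrite mem_filter => /andP[/andP[d _] /allpairsP[[e' f'] /= [eE fE [ee ff]]]].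
  by subst e' f'; rewrite (edge_pair eE fE d) -addbA.
rewrite L_K5 big_split /= -(big_map (fun ef => (ef.2, ef.1)) xpredT (fun ef => A ef.1 ef.2)).
rewrite -big_cat (perm_big [seq ef <- [seq (e, f) | e <- K5_edges, f <- K5_edges] |
   disjoint_edges ef.1 ef.2]) //.
(* The corrections now run over all ordered pairs of disjoint edges. The three edges disjoint from a
   fixed [e] form a triangle, so their corrections cancel by [edge_triangle]. *)
rewrite big_filter big_mkcond big_allpairs big1_seq // => e /= eE.
have T i j k l m : e = (i, j) -> (k, l) \in K5_edges -> (k, m) \in K5_edges ->
    (l, m) \in K5_edges -> uniq [:: i; j; k; l; m] ->
    A e (k, l) (+) (A e (k, m) (+) A e (l, m)) = false.
  move=> ee kl km lm u; have := @edge_triangle i j k l m; rewrite -ee => /(_ eE kl km lm u).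
  rewrite /A; move: (M e (k, l)) (M e (k, m)) (M e (l, m)).
  by move: (L e (k, l)) (L e (k, m)) (L e (l, m)) => [] [] [] [] [] [].
rewrite unlock /=.
move: eE; rewrite !inE.
repeat (case/orP; first by move=> /eqP ee; rewrite [e in disjoint_edges e]ee /= addbF; apply: (T _ _ _ _ _ ee)).
by move=> /eqP ee; rewrite [e in disjoint_edges e]ee /= addbF; apply: (T _ _ _ _ _ ee).
Qed.
End PolygonK5.
End PolygonCrossing.

(** * From polygons to continuous curves *)

Lemma crossing_point (R : realFieldType) (I : eqType) (X Y : I -> R)
    (a b c d : I) :
  general_position X Y -> uniq [:: a; b; c; d] -> crossing X Y a b c d ->
  exists u v, [/\ 0 <= u <= 1, 0 <= v <= 1,
    X a + u * (X b - X a) = X c + v * (X d - X c) &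
    Y a + u * (Y b - Y a) = Y c + v * (Y d - Y c)].
Proof.
move=> gp uabcd; rewrite /crossing /orient.
have g m x y z : [:: x; y; z] = mask m [:: a; b; c; d] -> det3 X Y x y z != 0.
  by move=> xE; apply: gp; rewrite xE mask_uniq.
have gabc := g [:: true; true; true] a b c erefl.
have gabd := g [:: true; true; false; true] a b d erefl.
have := g [:: true; false; true; true] a c d erefl; rewrite -det3_rot => gcda.
have := g [:: false; true; true; true] b c d erefl; rewrite -det3_rot => gcdb.
have e1 : det3 X Y a b c - det3 X Y a b d = det3 X Y c d b - det3 X Y c d a.
  by rewrite /det3; ring.
set D := det3 X Y c d a - det3 X Y c d b.
have sgn (p q : R) : p != 0 -> q != 0 -> (0 < p) != (0 < q) ->
    p - q != 0 /\ 0 <= p / (p - q) <= 1.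
  case: (ltrgt0P p) => // hp _; case: (ltrgt0P q) => // hq _ // _.
    have pq : 0 < p - q by lra.
    by rewrite gt_eqF // divr_ge0 ?(ltW hp) ?(ltW pq) //= ler_pdivrMr // mul1r; split=> //; lra.
  have pq : 0 < q - p by lra.
  rewrite -opprB oppr_eq0 gt_eqF // invrN mulrN -mulNr; split => //.
  by rewrite divr_ge0 ?(ltW pq) //= ?ler_pdivrMr // ?mul1r; lra.
case/andP=> /(sgn _ _ gabc gabd)[n1 h1] /(sgn _ _ gcda gcdb)[n2 h2].
(* Cramer's rule. In each quotient the denominator is a difference of two determinants of opposite
   sign, hence nonzero, and the quotient lies between 0 and 1. *)
exists (det3 X Y c d a / D), (det3 X Y a b c / (det3 X Y a b c - det3 X Y a b d)).
have lem (xa xc u w p q : R) :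
    p * u + q * w = D * (xc - xa) -> xa + p / D * u = xc + q / (- D) * w.
  move=> h; have -> : xc = xa + (p * u + q * w) / D by rewrite h; field.
  by field.
rewrite e1 -opprB -/D in h1 *; split => //; apply: lem; rewrite /D /det3; ring.
Qed.

(** The points are displaced along the moment curve, by [d * u i] and [d * u i ^+ 2]. Each
    orientation determinant becomes a quadratic polynomial in [d] whose leading coefficient is a
    Vandermonde determinant, hence nonzero. The product of all of them has finitely many roots,
    which the values [e / B / n.+1%:R] cannot all be. *)
Lemma perturb_general_position (R : realFieldType) (I : finType) (x y : I -> R) (e : R) :
  0 < e -> exists X Y : I -> R, [/\ general_position X Y,
    forall i, `|X i - x i| < e & forall i, `|Y i - y i| < e].
Proof.
move=> e0.
pose u (i : I) : R := (enum_rank i)%:R; pose v (i : I) : R := u i ^+ 2.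
pose c i j k := (u j - u i) * (v k - v i) - (u k - u i) * (v j - v i).
pose b i j k := (u j - u i) * (y k - y i) + (x j - x i) * (v k - v i) -
  (u k - u i) * (y j - y i) - (x k - x i) * (v j - v i).
pose P i j k : {poly R} := (det3 x y i j k)%:P + (b i j k)%:P * 'X + (c i j k)%:P * 'X^2.
pose Q := \prod_(t : I * I * I | uniq [:: t.1.1; t.1.2; t.2]) P t.1.1 t.1.2 t.2.
have PE i j k d : (P i j k).[d] = det3 (fun i => x i + d * u i) (fun i => y i + d * v i) i j k.
  by rewrite /P !(hornerD, hornerM, hornerC, hornerX, hornerXn) /det3 /b /c; ring.
have uinj i j : i != j -> u j - u i != 0.
  by move=> ij; rewrite subr_eq0 eqr_nat; apply: contraNneq ij => /ord_inj/enum_rank_inj->.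
have P0 i j k : uniq [:: i; j; k] -> P i j k != 0.
  rewrite /= !inE negb_or => /and3P[/andP[ij ik] jk _].
  apply/eqP => /(congr1 (fun p : {poly R} => p`_2)).
  rewrite /P !coefE /= !mulr0 !add0r mulr1 => /eqP; apply/negP.
  have -> : c i j k = (u j - u i) * (u k - u i) * (u k - u j) by rewrite /c /v; ring.
  by rewrite !mulf_neq0 ?uinj.
have Q0 : Q != 0 by apply/prodf_neq0 => -[[i j] k] /= /P0.
pose B : R := 1 + \sum_i (`|u i| + `|v i|).
have B0 : 0 < B by rewrite ltr_pwDl // sumr_ge0 // => i _; rewrite addr_ge0.
have uB i : `|u i| < B /\ `|v i| < B.
  rewrite /B (bigD1 i) //=; have : 0 <= \sum_(j | j != i) (`|u j| + `|v j|).
    by apply: sumr_ge0 => j _; rewrite addr_ge0.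
  by have := normr_ge0 (u i); have := normr_ge0 (v i); split; lra.
pose d n : R := e / B / n.+1%:R.
have [n Qn] : exists n, ~~ root Q (d n).
  apply: contrapT => /forallNP rt.
  have := max_poly_roots Q0 (rs := [seq d n | n <- iota 0 (size Q)]).
  rewrite size_map size_iota ltnn => F; apply: notF; apply: F.
    by apply/allP => _ /mapP[n _ ->]; apply/negPn/negP/rt.
  rewrite map_inj_uniq ?iota_uniq // => m n /(mulfI _)-/(_ _)/invr_inj/eqP.
  by rewrite eqr_nat eqSS => h; apply/eqP/h; rewrite mulf_neq0 ?invr_eq0 ?gt_eqF.
have dn0 : 0 < d n by rewrite /d !divr_gt0.
have dnB z : `|z| < B -> `|d n * z| < e.
  move=> zB; rewrite normrM (gtr0_norm dn0); apply: (@lt_le_trans _ _ (d n * B)).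
    by rewrite ltr_pM2l.
  rewrite /d mulrAC divfK ?gt_eqF // ler_pdivrMr // ler_peMr ?(ltW e0) //.
  by rewrite ler1n.
exists (fun i => x i + d n * u i), (fun i => y i + d n * v i); split.
- move=> i j k ijk; rewrite -PE; apply: contraNneq Qn => r.
  by rewrite /Q rootE horner_prod; apply/prodf_eq0; exists (i, j, k); rewrite //= r.
- by move=> i; rewrite addrC addKr dnB //; have [] := uB i.
- by move=> i; rewrite addrC addKr dnB //; have [] := uB i.
Qed.

Lemma uniform_continuity01 (R : realType) (f : R -> R) (e : R) : continuous f -> 0 < e ->
  \forall n \near \oo, forall s t, s \in `[0, 1] -> `|s - t| <= n.+1%:R^-1 -> `|f s - f t| < e.
Proof.
move=> cf e0.
have /compact_near_coveringP := @segment_compact R 0 1.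
move=> /(_ nat \oo (fun n s => forall t, `|s - t| <= n.+1%:R^-1 -> `|f s - f t| < e) _) h.
have : \forall n \near \oo, `[0, 1] `<=` (fun s => forall t, `|s - t| <= n.+1%:R^-1 -> `|f s - f t| < e).
  apply: h => x _.
  have e2 : 0 < e / 2 by lra.
  have /cvgrPdistC_lt/(_ _ e2)/nbhs_ballP[r /= r0 hr] := cf x.
  have r2 : 0 < r / 2 by lra.
  near=> s n => t st; have sx : `|x - s| < r / 2.
    by near: s; apply: nbhsx_ballx.
  have nr : n.+1%:R^-1 < r / 2 by near: n; exact: (near_infty_natSinv_lt (PosNum r2)).
  have xt : `|x - t| < r.
    apply: le_lt_trans (ler_distD s x t) _; rewrite (splitr r) ltrD //; exact: le_lt_trans st nr.
  have hs : `|f s - f x| < e / 2 by apply: hr; apply: lt_trans sx _; rewrite ltr_pdivrMr // ltr_pMr // ltr1n.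
  have ht : `|f x - f t| < e / 2 by rewrite distrC; apply: hr.
  by apply: le_lt_trans (ler_distD (f x) (f s) (f t)) _; rewrite (splitr e) ltrD.
by apply: filterS => n hn s t s01; exact: hn s s01 t.
Unshelve. all: by end_near.
Qed.

(** The sum of the coordinate distances is continuous on the compact square of parameters; its
    minimum is attained, and is positive because the curves do not meet. *)
Lemma separation01 (R : realType) (f g f' g' : R -> R) :
  continuous f -> continuous g -> continuous f' -> continuous g' ->
  (forall s t, s \in `[0, 1] -> t \in `[0, 1] -> f s = f' t -> g s = g' t -> False) ->
  exists2 d, 0 < d & forall s t, s \in `[0, 1] -> t \in `[0, 1] ->
    d <= `|f s - f' t| + `|g s - g' t|.
Proof.
move=> cf cg cf' cg' sep.
pose h (p : R * R) := `|f p.1 - f' p.2| + `|g p.1 - g' p.2|.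
have ch : continuous h.
  have c1 (k : R -> R) : continuous k -> continuous (k \o @fst R R).
    by move=> ck p; apply: continuous_comp; [exact: cvg_fst|exact: ck].
  have c2 (k : R -> R) : continuous k -> continuous (k \o @snd R R).
    by move=> ck p; apply: continuous_comp; [exact: cvg_snd|exact: ck].
  move=> p; apply: cvgD; apply: cvg_norm; apply: cvgB.
  - exact: (c1 _ cf).
  - exact: (c2 _ cf').
  - exact: (c1 _ cg).
  - exact: (c2 _ cg').
have cK : compact (`[0, 1]%classic `*` `[0, 1]%classic : set (R * R)).
  by apply: compact_setX; exact: segment_compact.
have K0 : (`[0, 1]%classic `*` `[0, 1]%classic : set (R * R)) !=set0.
  by exists (0, 0); split => /=; rewrite in_itv /= lexx ler01.
have [p] := compact_EVT_min K0 cK (continuous_subspaceT ch).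
rewrite inE => -[/= p1 p2] hp; exists (h p).
  rewrite lt_neqAle addr_ge0 // andbT eq_sym paddr_eq0 // !normr_eq0 !subr_eq0.
  by apply/negP => /andP[/eqP e1 /eqP e2]; exact: sep p1 p2 e1 e2.
by move=> s t s01 t01; apply: (hp (s, t)); rewrite inE.
Qed.

Lemma noncollapsed_uniq (I : eqType) (x : I) s : uniq (x :: s) -> noncollapsed x s.
Proof.
rewrite /noncollapsed; elim: s x => //= y s IH x /and3P[xys ys us].
rewrite IH /= ?ys ?us // andbT; apply: contraNneq xys => ->; exact: mem_head.
Qed.

Lemma segments_map (T : Type) (g : nat -> T) m n :
  segments (g m) [seq g k | k <- iota m.+1 n] = [seq (g k, g k.+1) | k <- iota m n].
Proof. by rewrite /segments; elim: n m => //= n IH m; rewrite -IH. Qed.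

Section K5.
Context (R : realType) (qx qy : nat -> R) (fx fy : nat -> nat -> R -> R).

(* Nodes [((i, j), k)] with [i < j] index the [k]-th sample of the edge [i j];
   [((i, i), 0)] is the vertex [i], and [((5, 5), 0)] an auxiliary point. *)
Local Notation node N := ('I_6 * 'I_6 * 'I_N.+1)%type.

Definition vertex_node (N i : nat) : node N := (inord i, inord i, ord0).

(** The extreme samples are identified with the vertex nodes, so that edges with a common end become
    polygons with a common vertex. *)
Definition edge_node (N i j k : nat) : node N :=
  if k == 0 then vertex_node N i else if k == N then vertex_node N j
  else (inord i, inord j, inord k).

Definition sample (q : nat -> R) (f : nat -> nat -> R -> R) N (z : node N) : R :=
  if z.1.1 == z.1.2 then q z.1.1 else f z.1.1 z.1.2 (z.2%:R / N%:R).

Context (f_at0 : {in K5_edges, forall e, fx e.1 e.2 0 = qx e.1 /\ fy e.1 e.2 0 = qy e.1})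
  (f_at1 : {in K5_edges, forall e, fx e.1 e.2 1 = qx e.2 /\ fy e.1 e.2 1 = qy e.2})
  (cf : {in K5_edges, forall e, continuous (fx e.1 e.2) /\ continuous (fy e.1 e.2)}).

Lemma sample_edge N e k : e \in K5_edges -> (0 < N)%N -> (k <= N)%N ->
  sample qx fx (edge_node N e.1 e.2 k) = fx e.1 e.2 (k%:R / N%:R) /\
  sample qy fy (edge_node N e.1 e.2 k) = fy e.1 e.2 (k%:R / N%:R).
Proof.
move=> eE N0 kN; have /andP[lt12 lt2] := K5_edge_lt eE.
have v6 i : (i < 5)%N -> (inord i : 'I_6) = i :> nat by move=> i5; rewrite inordK // ltnW.
rewrite /edge_node; case: eqP => [->|/eqP k0].
  by rewrite mul0r !(proj1 (f_at0 eE), proj2 (f_at0 eE)) /sample /= eqxx v6 // (ltn_trans lt12).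
case: eqP => [->|/eqP k1].
  rewrite divff ?pnatr_eq0 -?lt0n //.
  by rewrite !(proj1 (f_at1 eE), proj2 (f_at1 eE)) /sample /= eqxx v6.
rewrite /sample /= -val_eqE /= !v6 ?(ltn_trans lt12) // (ltn_eqF lt12).
by rewrite inordK.
Qed.

Definition node_code N (z : node N) : nat * nat * nat := (val z.1.1, val z.1.2, val z.2).

Lemma edge_node_code N e k : e \in K5_edges -> (k <= N)%N ->
  node_code (edge_node N e.1 e.2 k) =
  if k == 0 then (e.1, e.1, 0%N) else if k == N then (e.2, e.2, 0%N) else (e.1, e.2, k).
Proof.
move=> eE kN; have /andP[lt12 lt2] := K5_edge_lt eE; have lt1 := ltn_trans lt12 lt2.
have l1 : (e.1 < 6)%N by exact: leqW. have l2 : (e.2 < 6)%N by exact: leqW.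
by rewrite /edge_node /node_code /vertex_node; do ?case: ifP => _ //=; rewrite !inordK.
Qed.

Lemma edge_node_inj N e k l : e \in K5_edges -> (k <= N)%N -> (l <= N)%N -> (0 < N)%N ->
  edge_node N e.1 e.2 k = edge_node N e.1 e.2 l -> k = l.
Proof.
move=> eE kN lN N0 /(congr1 (@node_code N)); rewrite !edge_node_code //.
have /andP[lt12 lt2] := K5_edge_lt eE.
case: e {eE} lt12 lt2 => i j /= lt12 lt2.
by case: (k =P 0%N); case: (l =P 0%N); case: (k =P N); case: (l =P N) => ? ? ? ?; (try lia); case; lia.
Qed.

Lemma edge_node_disjoint N e f k l : e \in K5_edges -> f \in K5_edges ->
  disjoint_edges e f -> (k <= N)%N -> (l <= N)%N ->
  edge_node N e.1 e.2 k != edge_node N f.1 f.2 l.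
Proof.
move=> eE fE; have /andP[e12 e2] := K5_edge_lt eE; have /andP[f12 f2] := K5_edge_lt fE.
rewrite /disjoint_edges /= !inE !negb_or -!andbA.
move=> /and5P[_ /eqP h1 /eqP h2 /eqP h3 /and3P[/eqP h4 _ _]] kN lN.
apply/eqP => /(congr1 (@node_code N)); rewrite !edge_node_code //.
by case: (k =P 0%N); case: (l =P 0%N); case: (k =P N); case: (l =P N) => ? ? ? ?; (try lia); case; lia.
Qed.

Definition edge_tail N i j : seq (node N) := [seq edge_node N i j k | k <- iota 1 N].

Lemma edge_chain N i j : vertex_node N i :: edge_tail N i j =
  [seq edge_node N i j k | k <- iota 0 N.+1].
Proof. by []. Qed.

Lemma segments_edge N i j : segments (vertex_node N i) (edge_tail N i j) =
  [seq (edge_node N i j k, edge_node N i j k.+1) | k <- iota 0 N].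
Proof.
exact: (segments_map (edge_node N i j) 0 N).
Qed.

(** If disjoint edges never met, they would stay a distance [d] apart; polygons through fine,
    slightly perturbed samples would then not cross either, against the odd parity of
    [polygon_K5]. *)
Theorem K5_nonplanar : exists e f s t, [/\ e \in K5_edges, f \in K5_edges,
  disjoint_edges e f, (s \in `[0, 1]) && (t \in `[0, 1]) &
  fx e.1 e.2 s = fx f.1 f.2 t /\ fy e.1 e.2 s = fy f.1 f.2 t].
Proof.
apply: contrapT => nex.
have [d d0 hd] : exists2 d, 0 < d & forall ef, ef \in K5_disjoint_pairs ->
  forall s t, s \in `[0, 1] -> t \in `[0, 1] ->
    d <= `|fx ef.1.1 ef.1.2 s - fx ef.2.1 ef.2.2 t| + `|fy ef.1.1 ef.1.2 s - fy ef.2.1 ef.2.2 t|.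
  have sep ef : exists d, 0 < d /\ (ef \in K5_disjoint_pairs ->
      forall s t, s \in `[0, 1] -> t \in `[0, 1] ->
      d <= `|fx ef.1.1 ef.1.2 s - fx ef.2.1 ef.2.2 t| +
           `|fy ef.1.1 ef.1.2 s - fy ef.2.1 ef.2.2 t|).
    have [efP|_] := boolP (ef \in K5_disjoint_pairs); last by exists 1.
    move: efP; rewrite mem_filter => /andP[/andP[dis _] /allpairsP[[e f] /= [eE fE efE]]].
    subst ef; rewrite /= in dis *.
    have [d d0 hd] := separation01 (proj1 (cf eE)) (proj2 (cf eE)) (proj1 (cf fE))
      (proj2 (cf fE)) (fun s t s01 t01 h1 h2 => nex (ex_intro _ e (ex_intro _ f
      (ex_intro _ s (ex_intro _ t (And5 eE fE dis (introT andP (conj s01 t01)) (conj h1 h2))))))).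
    by exists d.
  have [D hD] := boolp.choice sep.
  exists (\big[Num.min/1]_(ef <- K5_disjoint_pairs) D ef).
    by apply: (big_ind (fun x : R => 0 < x)) => // [x y x0 y0|ef _]; [rewrite lt_min x0|have [] := hD ef].
  move=> ef efP s t s01 t01; have [_ /(_ efP _ _ s01 t01)] := hD ef.
  by apply: le_trans; exact: ge_bigmin_seq.
(* Sampling and perturbation each cost less than [d / 16] per coordinate, so a point of a polygon
   segment is within [d / 16 + 3 * (d / 16) = d / 4] of the curve at the initial sample. A crossing
   would bring two curves within [d / 2] in each coordinate, hence within less than [d] in the
   sum. *)
have e0 : 0 < d / 16 by lra.
have [N hN] : exists N, forall e, e \in K5_edges -> forall s t, s \in `[0, 1] ->
    `|s - t| <= N.+1%:R^-1 -> `|fx e.1 e.2 s - fx e.1 e.2 t| < d / 16 /\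
     `|fy e.1 e.2 s - fy e.1 e.2 t| < d / 16.
  have u e : e \in K5_edges -> \forall n \near \oo, forall s t, s \in `[0, 1] ->
      `|s - t| <= n.+1%:R^-1 -> `|fx e.1 e.2 s - fx e.1 e.2 t| < d / 16 /\
      `|fy e.1 e.2 s - fy e.1 e.2 t| < d / 16.
    move=> eE; have := uniform_continuity01 (proj1 (cf eE)) e0.
    have := uniform_continuity01 (proj2 (cf eE)) e0.
    by apply: filterS2 => n h1 h2 s t s01 st; split; [exact: h2|exact: h1].
  have : \forall n \near \oo, forall e, e \in K5_edges -> forall s t, s \in `[0, 1] ->
    `|s - t| <= n.+1%:R^-1 -> `|fx e.1 e.2 s - fx e.1 e.2 t| < d / 16 /\
     `|fy e.1 e.2 s - fy e.1 e.2 t| < d / 16.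
    elim: K5_edges u => [_|e E IH u]; first by apply: nearW.
    have := IH (fun e' e'E => u e' (mem_behead (s := e :: E) e'E)).
    have := u e (mem_head _ _); apply: filterS2 => n h1 h2 e'.
    by rewrite inE => /orP[/eqP->|/h2].
  by move=> /filter_ex.
have [X [Y [gp hX hY]]] := perturb_general_position
  (sample (N := N.+1) qx fx) (sample (N := N.+1) qy fy) e0.
have par k : (k <= N.+1)%N -> (k%:R / N.+1%:R : R) \in `[0, 1].
  by move=> kN; rewrite in_itv /= divr_ge0 //= ler_pdivrMr ?ltr0n // mul1r ler_nat.
have near_sample e k u : e \in K5_edges -> (k < N.+1)%N -> 0 <= u <= 1 ->
    let a := edge_node N.+1 e.1 e.2 k in let b := edge_node N.+1 e.1 e.2 k.+1 in
    `|X a + u * (X b - X a) - fx e.1 e.2 (k%:R / N.+1%:R)| < d / 4 /\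
    `|Y a + u * (Y b - Y a) - fy e.1 e.2 (k%:R / N.+1%:R)| < d / 4.
  move=> eE kN u01 a b.
  have est (A B p q : R) : `|A - p| < d / 16 -> `|B - q| < d / 16 -> `|p - q| < d / 16 ->
      `|A + u * (B - A) - p| < d / 4.
    rewrite !ltr_norml => /andP[h1 h2] /andP[h3 h4] /andP[h5 h6].
    have : `|u * (B - A)| <= `|B - A|.
      by rewrite normrM ler_piMl // ger0_norm; case/andP: u01.
    have : `|B - A| < 3 * (d / 16) by rewrite ltr_norml; apply/andP; split; lra.
    move=> h7 h8; have := le_lt_trans h8 h7; rewrite ltr_norml => /andP[? ?].
    by apply/andP; split; lra.
  have kk : `|k%:R / N.+1%:R - k.+1%:R / N.+1%:R| <= N.+1%:R^-1 :> R.
    by rewrite -mulrBl normrM normfV -[k.+1]addn1 natrD opprD addNKr normrN normr1 mul1r normr_nat.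
  have [sx sy] := sample_edge eE (ltn0Sn N) (ltnW kN).
  have [sx' sy'] := sample_edge eE (ltn0Sn N) kN.
  have [ux uy] := hN e eE _ _ (par k (ltnW kN)) kk.
  split; first by apply: (est _ _ _ (fx e.1 e.2 (k.+1%:R / N.+1%:R))) => //; rewrite -?sx -?sx'.
  by apply: (est _ _ _ (fy e.1 e.2 (k.+1%:R / N.+1%:R))) => //; rewrite -?sy -?sy'.
have := polygon_K5 gp (o := vertex_node N.+1 5) (p := vertex_node N.+1)
  (s := edge_tail N.+1).
rewrite big1_seq; last first.
  move=> ef /andP[_ efP]; have := hd ef efP; move: efP.
  rewrite mem_filter => /andP[/andP[dis _] /allpairsP[[e f] /= [eE fE efE]]] {}hd.
  subst ef; rewrite /= in dis *.
  rewrite /polygon_crossing !segments_edge big1_seq // => _ /andP[_ /mapP[k + ->]].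
  rewrite mem_iota => kN; rewrite big1_seq // => _ /andP[_ /mapP[l + ->]].
  rewrite mem_iota => lN; apply/negbTE/negP => /= cr.
  have unq : uniq [:: edge_node N.+1 e.1 e.2 k; edge_node N.+1 e.1 e.2 k.+1;
      edge_node N.+1 f.1 f.2 l; edge_node N.+1 f.1 f.2 l.+1].
    rewrite /= !inE !negb_or !(edge_node_disjoint eE fE dis) ?(ltnW kN) ?(ltnW lN) //= !andbT.
    by apply/andP; split; apply/eqP => /edge_node_inj; rewrite ?(ltnW kN) ?(ltnW lN) //;
      move=> /(_ _ _ _ _)/n_Sn; apply.
  have [u [v [u01 v01 hx hy]]] := crossing_point gp unq cr.
  have [ax ay] := near_sample e k u eE kN u01; have [bx by_] := near_sample f l v fE lN v01.
  have := hd _ _ (par k (ltnW kN)) (par l (ltnW lN)); apply/negP; rewrite -ltNge.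
  rewrite /= hx in ax; rewrite /= hy in ay.
  have tri (z p q : R) : `|z - p| < d / 4 -> `|z - q| < d / 4 -> `|p - q| < d / 2.
    by rewrite !ltr_norml => /andP[? ?] /andP[? ?]; apply/andP; split; lra.
  by have := tri _ _ _ ax bx; have := tri _ _ _ ay by_ => ? ?; lra.
move=> F; suff : false by []; apply: F.
- rewrite (map_inj_in_uniq (f := vertex_node N.+1) (s := [:: 5; 0; 1; 2; 3; 4]%N)) //.
  have lt6 i : i \in [:: 5; 0; 1; 2; 3; 4]%N -> (i < 6)%N.
    exact: (allP (isT : all (fun i => i < 6)%N [:: 5; 0; 1; 2; 3; 4]%N) i).
  move=> i j /lt6 iI /lt6 jI /(congr1 (fun z : node N.+1 => val z.1.1)).
  by rewrite /= !inordK.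
- move=> e eE; have g_le k : k \in iota 0 N.+2 -> (k <= N.+1)%N by rewrite mem_iota.
  split.
  + have iota_last n : last 0%N (iota 1 n.+1) = n.+1.
      by rewrite -[n.+1 in LHS]addn1 iotaD cats1 last_rcons add1n.
    by rewrite (last_map (edge_node N.+1 e.1 e.2) _ 0%N) iota_last /edge_node eqxx.
  + apply: noncollapsed_uniq; rewrite edge_chain map_inj_in_uniq ?iota_uniq //.
    by move=> k l /g_le kN /g_le lN; exact: edge_node_inj.
  + apply/negP => /mapP[k]; rewrite mem_iota add1n ltnS => /andP[_ kN].
    move=> /(congr1 (@node_code _)); rewrite edge_node_code //.
    rewrite /node_code /vertex_node /= !inordK //; have /andP[e12 e2] := K5_edge_lt eE.
    case: e {eE} e12 e2 => i j /= e12 e2.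
    by case: (k =P 0%N); case: (k =P N.+1) => ? ?; case; lia.
- move=> e f eE fE dis z; rewrite !edge_chain => /mapP[k + ->]; rewrite mem_iota => kN.
  apply/negP => /mapP[l]; rewrite mem_iota => lN.
  by apply/eqP; exact: edge_node_disjoint.
Qed.
End K5.

(** * Charts *)

Lemma continuous_ptws (Z : topologicalType) (I : Type) (T : topologicalType)
    (k : Z -> {ptws I -> T}) :
  (forall i, continuous (fun z => k z i)) -> continuous k.
Proof.
move=> ck z; apply/cvg_sup => i.
exact: (@continuous_comp_initial _ _ _ (fun f : I -> T => f i) k (ck i) z).
Qed.

Lemma continuous_eval (I : choiceType) (T : topologicalType) (i : I) :
  continuous (fun f : {ptws I -> T} => f i).
Proof. exact: (@proj_continuous I (fun _ => T) i). Qed.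

Lemma continuous_matrix (Z : topologicalType) (T : topologicalType) m n
    (k : Z -> 'M[T]_(m, n)) :
  (forall i j, continuous (fun z => k z i j)) -> continuous k.
Proof.
move=> ck z B [C nC CB]; have h i j : \forall z' \near z, C i j (k z' i j) by exact: ck.
have : \forall z' \near z, forall i j, C i j (k z' i j).
  apply: filter_forall => i; apply: filter_forall => j; exact: h.
by apply: filterS => z' hz'; exact: CB.
Qed.

Section SetTypes.
Context (Z T : topologicalType) (A : set T).

Definition set_lift (k : Z -> T) (h : forall z, A (k z)) (z : Z) : A :=
  exist _ (k z) (mem_set (h z)).

Lemma continuous_set_lift (k : Z -> T) (h : forall z, A (k z)) :
  continuous k -> continuous (set_lift h).
Proof. by move=> ck; apply: continuous_comp_initial. Qed.

Lemma continuous_set_val (k : Z -> A) : continuous k -> continuous (set_val \o k).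
Proof.
by move=> ck z; apply: continuous_comp; [exact: ck|exact: initial_continuous].
Qed.
End SetTypes.

Lemma set_type_eq (T : Type) (A : set T) (x y : A) : set_val x = set_val y -> x = y.
Proof. by move=> h; apply: val_inj. Qed.

Lemma homeomorphic_sets (T U : topologicalType) (A : set T) (B : set U)
    (F : T -> U) (G : U -> T) :
  (forall x, A x -> B (F x)) -> (forall y, B y -> A (G y)) ->
  (forall x, A x -> G (F x) = x) -> (forall y, B y -> F (G y) = y) ->
  {within A, continuous F} -> {within B, continuous G} ->
  homeomorphic A B.
Proof.
move=> AB BA GF FG cF cG.
have FA (x : A) : B (F (set_val x)) by apply: AB; exact: set_valP.
have GB (y : B) : A (G (set_val y)) by apply: BA; exact: set_valP.
exists (set_lift (k := F \o set_val) FA), (set_lift (k := G \o set_val) GB); split.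
- by move=> x; apply: set_type_eq; exact: (GF _ (set_valP x)).
- by move=> x; apply: set_type_eq; exact: (FG _ (set_valP x)).
- by apply: continuous_set_lift; move/subspace_sigL_continuousP: cF.
- by apply: continuous_set_lift; move/subspace_sigL_continuousP: cG.
Qed.

Lemma homeomorphic_sym (X Y : topologicalType) : homeomorphic X Y -> homeomorphic Y X.
Proof. by move=> [f [g [fg gf cf cg]]]; exists g, f. Qed.

Lemma homeomorphic_trans (X Y Z : topologicalType) :
  homeomorphic X Y -> homeomorphic Y Z -> homeomorphic X Z.
Proof.
move=> [f [g [fg gf cf cg]]] [f' [g' [fg' gf' cf' cg']]].
exists (f' \o f), (g \o g'); split; try exact: can_comp.
- by move=> x; apply: continuous_comp; [exact: cf|exact: cf'].
- by move=> x; apply: continuous_comp; [exact: cg'|exact: cg].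
Qed.

(** Both maps are total on the ambient spaces, with arbitrary values off [A] and [chart_dom],
    respectively off [chart_cod]. Continuity of [chart_map] makes sense only relative to [A], so it
    is stated for composites with maps into [A]; [chart_cod] is open, so [chart_inv] can be
    continuous at points. *)
Record chart (R : realType) (T : topologicalType) (A : set T) (p : T) := Chart {
  chart_dom : set T;
  chart_cod : set 'rV[R]_2;
  chart_map : T -> 'rV[R]_2;
  chart_inv : 'rV[R]_2 -> T;
  chart_dom_open : open chart_dom;
  chart_dom_base : chart_dom p;
  chart_cod_open : open chart_cod;
  chart_mapP : forall x, A x -> chart_dom x -> chart_cod (chart_map x);
  chart_mapK : forall x, A x -> chart_dom x -> chart_inv (chart_map x) = x;
  chart_invP : forall q, chart_cod q -> A (chart_inv q) /\ chart_dom (chart_inv q);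
  chart_invK : forall q, chart_cod q -> chart_map (chart_inv q) = q;
  chart_map_continuous : forall (Z : topologicalType) (k : Z -> T), continuous k ->
    (forall z, A (k z) /\ chart_dom (k z)) -> continuous (chart_map \o k);
  chart_inv_continuous : forall q, chart_cod q -> {for q, continuous chart_inv}
}.

Lemma chart_exists (R : realType) (T M : topologicalType) (A : set T) (p : T) :
  homeomorphic A M -> locally_euclidean R 2 M -> A p -> inhabited (chart R A p).
Proof.
move=> [f [g [fg gf cf cg]]] le Ap.
pose pA : A := exist _ p (mem_set Ap).
have [U [W [oU Ufp oW [phi [psi [phiK psiK cphi cpsi]]]]]] := le (f pA).
have [/= D oO Oeq] : open (f @^-1` U) by move/continuousP: cf; exact.
pose gam (x : T) : 'rV[R]_2 :=
  if pselect (A x) is left Ax then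
    let a : A := exist _ x (mem_set Ax) in
    if pselect (U (f a)) is left Ua then set_val (phi (exist _ (f a) (mem_set Ua))) else 0
  else 0.
pose bet (q : 'rV[R]_2) : T :=
  if pselect (W q) is left Wq then set_val (g (set_val (psi (exist _ q (mem_set Wq))))) else p.
have OU (a : A) : D (set_val a) <-> U (f a).
  by rewrite -[D _]/((set_val @^-1` D) a) Oeq.
have gamE (a : A) (Ua : U (f a)) : gam (set_val a) = set_val (phi (exist _ (f a) (mem_set Ua))).
  rewrite /gam; case: pselect => [Ax|]; last by have := set_valP a.
  have e : exist _ (set_val a) (mem_set Ax) = a by apply: set_type_eq.
  case: pselect => [Ua'|]; last by rewrite e.
  by congr (set_val (phi _)); apply: set_type_eq; exact: (congr1 f e).
have betE (w : W) : bet (set_val w) = set_val (g (set_val (psi w))).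
  rewrite /bet; case: pselect => [Wq|]; last by have := set_valP w.
  by do 4 congr (_ _); apply: set_type_eq.
have pack x : A x -> D x -> exists2 a : A, set_val a = x & U (f a).
  by move=> Ax Ox; exists (exist _ x (mem_set Ax)) => //; apply/OU.
have packW q : W q -> exists w : W, set_val w = q.
  by move=> Wq; exists (exist _ q (mem_set Wq)).
split; apply: (@Chart R T A p D W gam bet) => //.
- by apply/(OU pA).
- by move=> x Ax Ox; have [a <- Ua] := pack x Ax Ox; rewrite gamE; exact: set_valP.
- by move=> x Ax Ox; have [a <- Ua] := pack x Ax Ox; rewrite gamE betE phiK fg.
- move=> q /packW[w <-]; rewrite betE; split; first exact: set_valP.
  by apply/OU; rewrite gf; exact: set_valP.
- move=> q /packW[w <-]; rewrite betE.
  have Ug : U (f (g (set_val (psi w)))) by rewrite gf; exact: set_valP.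
  rewrite gamE; have -> : exist _ (f (g (set_val (psi w)))) (mem_set Ug) = psi w.
    by apply: set_type_eq; exact: (gf (set_val (psi w))).
  by rewrite psiK.
- move=> Z k ck kAO.
  have kA z : A (k z) by have [] := kAO z.
  pose kk := set_lift kA; have ckk : continuous kk by exact: continuous_set_lift.
  have kU z : U (f (kk z)) by apply/OU; have [] := kAO z.
  have cU : continuous (set_lift (k := f \o kk) kU).
    by apply: continuous_set_lift => z; apply: continuous_comp; [exact: ckk|exact: cf].
  rewrite (_ : gam \o k = set_val \o (phi \o set_lift (k := f \o kk) kU)).
    by apply: continuous_set_val => z; apply: continuous_comp; [exact: cU|exact: cphi].
  by apply/funext => z /=; rewrite (gamE (kk z) (kU z)).
- move=> q Wq.
  have : {within W, continuous bet}.
    apply/subspace_sigL_continuousP.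
    rewrite (_ : sigL W bet = set_val \o (g \o (set_val \o psi))).
      apply: continuous_set_val => z; apply: continuous_comp; last exact: cg.
      exact: (continuous_set_val cpsi).
    by apply/funext => w /=; rewrite /sigL /= betE.
  by rewrite continuous_open_subspace // => /(_ q); apply; rewrite inE.
Qed.

(** * Local structure of a triangulated surface *)

Section Clamp.
Context (R : realType).

(** [K5_nonplanar] asks for curves continuous on the whole line; composing with this retraction
    extends curves given on the unit interval. *)
Definition clamp01 (t : R) : R := Num.max 0 (Num.min 1 t).

Lemma clamp01_ge0 t : 0 <= clamp01 t.
Proof. by rewrite /clamp01 le_max lexx. Qed.

Lemma clamp01_le1 t : clamp01 t <= 1.
Proof. by rewrite /clamp01 ge_max ler01 ge_min lexx. Qed.

Lemma clamp01_id t : t \in `[0, 1] -> clamp01 t = t.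
Proof. by rewrite in_itv /= /clamp01 => /andP[t0 t1]; rewrite min_r // max_r. Qed.

Lemma clamp01_continuous : continuous clamp01.
Proof.
move=> t; exact: (@continuous_max R R (fun=> 0) (fun t => Num.min 1 t) t (cvg_cst _)
  (@continuous_min R R (fun=> 1) id t (cvg_cst _) cvg_id)).
Qed.

Lemma clamp01_0 : clamp01 0 = 0.
Proof. by rewrite clamp01_id // in_itv /= lexx ler01. Qed.

Lemma clamp01_1 : clamp01 1 = 1.
Proof. by rewrite clamp01_id // in_itv /= lexx ler01. Qed.

Lemma clamp01_in t : 0 <= clamp01 t <= 1.
Proof. by rewrite clamp01_ge0 clamp01_le1. Qed.

Lemma clamped_segment_continuous (a b : R) :
  continuous (fun t => (1 - clamp01 t) * a + clamp01 t * b).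
Proof.
move=> t; apply: cvgD; (apply: cvgM; last exact: cvg_cst); last exact: clamp01_continuous.
by apply: cvgB; [exact: cvg_cst|exact: clamp01_continuous].
Qed.

Lemma convex_norm_le (a b r t : R) : `|a| <= r -> `|b| <= r -> 0 <= t <= 1 ->
  `|(1 - t) * a + t * b| <= r.
Proof.
move=> ar br /andP[t0 t1]; apply: le_trans (ler_normD _ _) _; rewrite !normrM (ger0_norm t0) (@ger0_norm _ (1 - t)) ?subr_ge0 //.
have -> : r = (1 - t) * r + t * r by ring.
by rewrite lerD // ler_wpM2l ?subr_ge0.
Qed.
End Clamp.

(** For edges of K5 laid out along a line: the part of an edge on that line is enclosed between two
    of its ends at distance at most 1, and such pieces of disjoint edges do not meet. *)
Lemma integer_intervals_disjoint (e f : nat * nat) (a b a' b' : nat) :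
  disjoint_edges e f -> a \in [:: e.1; e.2] -> b \in [:: e.1; e.2] ->
  a' \in [:: f.1; f.2] -> b' \in [:: f.1; f.2] -> (b <= a.+1)%N -> (b' <= a'.+1)%N ->
  ~~ ((a <= b') && (a' <= b))%N.
Proof.
case: e f => [i j] [k l]; rewrite /disjoint_edges /= !inE !negb_or -!andbA.
move=> /and5P[_ /eqP ? /eqP ? /eqP ? /and3P[/eqP ? _ _]].
by do 4 (move=> /orP[] /eqP ?); lia.
Qed.

(** * Three half-planes glued along a line *)

Section Book.
Context (R : realType) (T : topologicalType) (A : set T) (p : T) (c : chart R A p).
Context (B : nat -> R -> R -> T).
Context (cB : forall k, continuous (fun z : R * R => B k z.1 z.2)).
Context (Bp : B 0 0 0 = p) (B0 : forall k s, B k s 0 = B 0 s 0).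
Context (BA : forall k s h, (k < 3)%N -> `|s| <= 1 -> 0 <= h <= 2^-1 -> A (B k s h)).
Context (B_inj : forall k l s h s' h', (k < 3)%N -> (l < 3)%N ->
  `|s| <= 1 -> 0 <= h <= 2^-1 -> `|s'| <= 1 -> 0 <= h' <= 2^-1 ->
  B k s h = B l s' h' -> [/\ s = s', h = h' & k = l \/ h = 0]).

(* The edges of K5 whose ends are not consecutive on the spine are spread over
   the pages so that any two edges on the same page share a vertex. *)
Definition page (e : nat * nat) : nat :=
  if e.1 == 0 then 0 else if e.1 == 1 then 1 else 2.

Definition bend (e : nat * nat) : R := if e.2 == e.1.+1 then 0 else 1.

Lemma book_not_planar : False.
Proof.
have dom_nbhs : forall k, \forall z \near ((0, 0) : R * R), chart_dom c (B k z.1 z.2).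
  move=> k; apply: (cB (k := k) (x := (0, 0))).
  by rewrite /= B0 Bp; apply: open_nbhs_nbhs; split; [exact: chart_dom_open|exact: chart_dom_base].
have [eps e0 he] : exists2 eps : R, 0 < eps <= 1 &
    forall k s h, (k < 3)%N -> `|s| <= eps -> `|h| <= eps -> chart_dom c (B k s h).
  have : \forall z \near ((0, 0) : R * R), [/\ chart_dom c (B 0 z.1 z.2),
      chart_dom c (B 1 z.1 z.2) & chart_dom c (B 2 z.1 z.2)].
    by near=> z; split; near: z; exact: dom_nbhs.
  move=> /nbhs_ballP[r /= r0 hr]; exists (Num.min 1 (r / 2)).
    by rewrite lt_min ltr01 divr_gt0 //= ge_min lexx.
  move=> k s h k3 sr hr'; have rr : Num.min 1 (r / 2) < r.
    by rewrite gt_min; apply/orP; right; rewrite ltr_pdivrMr // ltr_pMr // ltr1n.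
  have /hr : ball ((0, 0) : R * R) r (s, h).
    by split; rewrite /ball /= sub0r normrN; [exact: le_lt_trans sr rr|exact: le_lt_trans hr' rr].
  by case: k k3 => [|[|[]]] // _ [].
have [eps0 eps1] := andP e0.
(* Vertex [i] of K5 sits on the spine at [i / 5], and a non-consecutive edge is the arc of height
   [t * (1 - t)], within the permitted heights. The factor [eps] shrinks the drawing into the
   chart. *)
pose pos (e : nat * nat) (t : R) := ((1 - t) * e.1%:R + t * e.2%:R) / 5.
pose hgt (e : nat * nat) (t : R) := bend e * (t * (1 - t)).
pose path i j (t : R) := B (page (i, j)) (eps * pos (i, j) (clamp01 t))
  (eps * hgt (i, j) (clamp01 t)).
pose G i j t := chart_map c (path i j t).
have page3 e : (page e < 3)%N by rewrite /page; do ?case: ifP.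
have pos01 e t : e \in K5_edges -> 0 <= t <= 1 -> 0 <= pos e t <= 1.
  move=> /K5_edge_lt/andP[e12 e2] /andP[t0 t1].
  have h2 : (e.2%:R : R) <= 5 by rewrite ler_nat ltnW.
  have h1 : (e.1%:R : R) <= 5 by rewrite ler_nat ltnW // (ltn_trans e12).
  have h10 : 0 <= (e.1%:R : R) by []. have h20 : 0 <= (e.2%:R : R) by [].
  rewrite /pos divr_ge0 ?addr_ge0 ?mulr_ge0 ?subr_ge0 //= ler_pdivrMr // mul1r.
  have : (1 - t) * e.1%:R <= (1 - t) * 5 by rewrite ler_wpM2l ?subr_ge0.
  have : t * e.2%:R <= t * 5 by rewrite ler_wpM2l.
  by move=> ? ?; lra.
have hgt01 e t : 0 <= t <= 1 -> 0 <= hgt e t <= 2^-1.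
  move=> /andP[t0 t1]; rewrite /hgt /bend; case: ifP => _; first by rewrite mul0r; lra.
  by rewrite mul1r; nra.
have eps_pos e t : e \in K5_edges -> 0 <= t <= 1 -> `|eps * pos e t| <= eps.
  move=> eE /(pos01 e t eE)/andP[p0 p1].
  have e_ge0 := ltW eps0; rewrite ger0_norm; last exact: mulr_ge0.
  by rewrite ler_piMr.
have eps_hgt e t : 0 <= t <= 1 -> (0 <= eps * hgt e t <= 2^-1) && (`|eps * hgt e t| <= eps).
  move=> /(hgt01 e)/andP[h0 h1]; rewrite mulr_ge0 ?(ltW eps0) //=; apply/andP; split.
    by apply: le_trans h1; rewrite ler_piMl.
  have e_ge0 := ltW eps0; rewrite ger0_norm; last exact: mulr_ge0.
  by rewrite ler_piMr //; lra.
have pathA e t : e \in K5_edges -> A (path e.1 e.2 t) /\ chart_dom c (path e.1 e.2 t).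
  move=> eE; have /andP[h1 h2] := eps_hgt e _ (clamp01_in t); split.
    by apply: BA => //; apply: le_trans eps1; case: e eE {h1 h2} => i j eE; exact: (eps_pos (i, j) _ eE (clamp01_in t)).
  by apply: he => //; case: e eE {h1 h2} => i j eE; exact: (eps_pos (i, j) _ eE (clamp01_in t)).
have cpath i j : continuous (path i j).
  pose w t := (eps * pos (i, j) (clamp01 t), eps * hgt (i, j) (clamp01 t)) : R * R.
  have cw : continuous w.
    have c1 : continuous (fun t => eps * pos (i, j) (clamp01 t)).
      move=> t; apply: cvgM; first exact: cvg_cst.
      by apply: cvgM; [exact: clamped_segment_continuous|exact: cvg_cst].
    have c2 : continuous (fun t => eps * hgt (i, j) (clamp01 t)).
      move=> t; apply: cvgM; first exact: cvg_cst.
      apply: cvgM; first exact: cvg_cst.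
      apply: cvgM; first exact: clamp01_continuous.
      by apply: cvgB; [exact: cvg_cst|exact: clamp01_continuous].
    by move=> t; exact: (cvg_pair (c1 t) (c2 t)).
  move=> t; exact: (@continuous_comp _ _ _ w (fun z => B (page (i, j)) z.1 z.2) t (cw t)
    (@cB (page (i, j)) (w t))).
have cG e i : e \in K5_edges -> continuous (fun t => G e.1 e.2 t 0 i).
  move=> eE; have h : continuous (chart_map c \o path e.1 e.2).
    by apply: chart_map_continuous => // t; exact: pathA.
  move=> t; exact: (@continuous_comp _ _ _ _ (fun q : 'rV[R]_2 => q 0 i) t (h t)
    (@coord_continuous R 1 2 0 i _)).
have path0 i j : path i j 0 = B 0 (eps * (i%:R / 5)) 0.
  by rewrite /path clamp01_0 /hgt /pos !mul0r !mulr0 B0 subr0 mul1r addr0.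
have path1 i j : path i j 1 = B 0 (eps * (j%:R / 5)) 0.
  by rewrite /path clamp01_1 /hgt /pos subrr !mulr0 B0 !mul0r mul1r add0r.
pose q i k := chart_map c (B 0 (eps * (i%:R / 5)) 0) 0 k.
have [e [f [s [t [eE fE dis /andP[s01 t01] [h0 h1]]]]]] :=
  @K5_nonplanar R (fun i => q i 0) (fun i => q i 1) (fun i j t => G i j t 0 0)
    (fun i j t => G i j t 0 1)
    (fun e _ => conj (congr1 (fun x => chart_map c x 0 0) (path0 e.1 e.2))
       (congr1 (fun x => chart_map c x 0 1) (path0 e.1 e.2)))
    (fun e _ => conj (congr1 (fun x => chart_map c x 0 0) (path1 e.1 e.2))
       (congr1 (fun x => chart_map c x 0 1) (path1 e.1 e.2)))
    (fun e eE => conj (cG e 0 eE) (cG e 1 eE)).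
have {h0 h1} : path e.1 e.2 s = path f.1 f.2 t.
  have [Ae De] := pathA e s eE; have [Af Df] := pathA f t fE.
  rewrite -(chart_mapK Ae De) -(chart_mapK Af Df); congr (chart_inv c _).
  by apply/rowP => i; case: i => [[|[|[]]] //= i2]; [move: h0|move: h1]; rewrite /G;
    congr (_ = _); congr (_ _ _); apply: val_inj.
rewrite /path !clamp01_id //.
have s01' : 0 <= s <= 1 by move: s01; rewrite in_itv.
have t01' : 0 <= t <= 1 by move: t01; rewrite in_itv.
have /andP[he1 _] := eps_hgt e s s01'; have /andP[hf1 _] := eps_hgt f t t01'.
case: e f eE fE dis he1 hf1 => [i j] [k l] eE fE dis he1 hf1 /B_inj[] //.
- by apply: le_trans eps1; exact: eps_pos.
- by apply: le_trans eps1; exact: eps_pos.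
have epsN0 : eps != 0 by rewrite gt_eqF.
move=> /(mulfI epsN0) pq /(mulfI epsN0) hq pg.
(* At height zero a point lies on an edge between consecutive vertices or is an end of an arc; in
   both cases it is enclosed by ends at distance at most 1. *)
have spine e r : 0 <= r <= 1 -> hgt e r = 0 -> exists a b : nat,
    [/\ a \in [:: e.1; e.2], b \in [:: e.1; e.2], (b <= a.+1)%N & a%:R / 5 <= pos e r <= b%:R / 5].
  move=> /andP[r0 r1] /eqP; rewrite /hgt /bend /pos; case: (e.2 =P e.1.+1) => [e12 _|_].
    exists e.1, e.2; rewrite !inE !eqxx orbT e12; split=> //.
    by rewrite !ler_pM2r ?invr_gt0 // -natr1; apply/andP; split; nra.
  rewrite mul1r mulf_eq0 subr_eq0 => /orP[/eqP->|/eqP<-].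
    by exists e.1, e.1; rewrite !inE eqxx subr0 mul1r mul0r addr0 lexx leqnSn; split.
  by exists e.2, e.2; rewrite !inE eqxx orbT subrr mul1r mul0r add0r lexx leqnSn; split.
have [h0|hn0] := eqVneq (hgt (i, j) s) 0.
  have [a [b [ai bi ba /andP[pa pb]]]] := spine _ _ s01' h0.
  have [a' [b' [ak bk ba' /andP[pa' pb']]]] := spine _ _ t01' (etrans (esym hq) h0).
  rewrite pq in pa pb; have ab' : (a <= b')%N.
    by have := le_trans pa pb'; rewrite ler_pM2r ?invr_gt0 // ler_nat.
  have a'b : (a' <= b)%N.
    by have := le_trans pa' pb; rewrite ler_pM2r ?invr_gt0 // ler_nat.
  by have := integer_intervals_disjoint dis ai bi ak bk ba ba'; rewrite ab' a'b.
(* Off the spine, equal points lie on the same page; a finite check shows that two arcs on one page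
   share an end. *)
have /allP/(_ _ eE)/allP/(_ _ fE) : all (fun e => all (fun f =>
  ~~ [&& disjoint_edges e f, page e == page f, e.2 != e.1.+1 & f.2 != f.1.+1]) K5_edges) K5_edges by [].
have b1 : j != i.+1 by apply: contraNneq hn0 => e; rewrite /hgt /bend /= e eqxx mul0r.
have b2 : l != k.+1 by apply: contraNneq hn0 => e; rewrite hq /hgt /bend /= e eqxx mul0r.
case: pg => [->|/eqP]; last by rewrite mulf_eq0 (negbTE epsN0) (negbTE hn0).
by rewrite dis eqxx b1 b2.
Unshelve. all: by end_near.
Qed.
End Book.

Section BookComplex.
Context (R : realType) (V : finType) (D : simplicial_complex V).

Definition point_mass (v : V) : V -> R := fun x => (x == v)%:R.

Definition midpoint (u v : V) : {ptws V -> R} :=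
  fun x => (point_mass u x + point_mass v x) / 2.

Lemma sum_point_mass v : \sum_x point_mass v x = 1.
Proof. by rewrite (bigD1 v) //= /point_mass eqxx big1 ?addr0 // => i /negbTE ->. Qed.

(** Page [k] lies in the join of the edge [u v] with the point [f k]: [s] moves along the edge, with
    [0] at the midpoint, and [h] is the weight of [f k]. *)
Definition book (u v : V) (f : nat -> V -> R) (k : nat) (s h : R) : {ptws V -> R} :=
  fun x => (1 - h) * ((1 + s) / 2 * point_mass u x + (1 - s) / 2 * point_mass v x) + h * f k x.

(** The coordinates at [u] and [v], where every [f k] vanishes, recover [h] and [s], and for
    [h != 0] the remaining coordinates recover [f k]. The apexes are arbitrary points rather than
    vertices, so that a tetrahedron also contains a book. *)
Lemma no_book (u v : V) (f : nat -> V -> R) : u != v ->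
  (forall k x, (k < 3)%N -> 0 <= f k x) -> (forall k, (k < 3)%N -> \sum_x f k x = 1) ->
  (forall k, (k < 3)%N -> f k u = 0 /\ f k v = 0) ->
  (forall k l, (k < 3)%N -> (l < 3)%N -> f k = f l -> k = l) ->
  (forall k (s : {set V}), (k < 3)%N -> (forall x, x \in s -> [|| x == u, x == v | f k x != 0]) ->
    s \in faces D) ->
  chart R (realization D R) (midpoint u v) -> False.
Proof.
move=> uv fge0 fsum fuv finj ff c; have vu : (v == u) = false by rewrite eq_sym (negbTE uv).
apply: (book_not_planar c (B := book u v f)).
- move=> k; apply: continuous_ptws => x z.
  apply: cvgD; apply: cvgM.
  + by apply: cvgB; [exact: cvg_cst|exact: cvg_snd].
  + apply: cvgD; (apply: cvgM; last exact: cvg_cst); (apply: cvgM; last exact: cvg_cst).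
      by apply: cvgD; [exact: cvg_cst|exact: cvg_fst].
    by apply: cvgB; [exact: cvg_cst|exact: cvg_fst].
  + exact: cvg_snd.
  + exact: cvg_cst.
- by apply/funext => x; rewrite /book /midpoint; lra.
- by move=> k s; apply/funext => x; rewrite /book !mul0r.
- move=> k s h k3; rewrite ler_norml => /andP[s1 s2] /andP[h0 h2]; split.
  + move=> x; rewrite /book /point_mass.
    have := fge0 k x k3 => fx.
    have p1 : 0 <= (1 + s) / 2 by lra.
    have p2 : 0 <= (1 - s) / 2 by lra.
    have p3 : 0 <= 1 - h by lra.
    by apply: addr_ge0; apply: mulr_ge0 => //; apply: addr_ge0; apply: mulr_ge0.
  + rewrite /book big_split /= -!mulr_sumr fsum // big_split /= -!mulr_sumr !sum_point_mass; lra.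
  + apply: (ff k) => // x; rewrite inE /book /point_mass.
    by apply: contra_neqT; rewrite !negb_or negbK => /and3P[/negbTE-> /negbTE-> /eqP->]; rewrite /= !(mulr0, addr0).
- move=> k l s h s' h' k3 l3 _ /andP[h0 h2] _ /andP[h0' h2'] e.
  have eu := congr1 (fun g : V -> R => g u) e; have ev := congr1 (fun g : V -> R => g v) e.
  have [fu fv] := fuv k k3; have [fu' fv'] := fuv l l3.
  move: eu ev; rewrite /book /point_mass !eqxx vu (negbTE uv) fu fv fu' fv'.
  rewrite /= !(mulr0, mulr1, addr0, add0r) => eu ev.
  have hh : h = h' by lra.
  subst h'; have ss : s = s'.
    have : (1 - h) * (s - s') = 0 by lra.
    by move=> /eqP; rewrite mulf_eq0 => /orP[]/eqP; lra.
  subst s'; split => //; have [->|hn0] := eqVneq h 0; [by right|left].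
  apply: finj => //; apply/funext => x; apply: (mulfI hn0).
  by have := congr1 (fun g : V -> R => g x) e; rewrite /book; lra.
Qed.
End BookComplex.

(** * Cut points and boundary points in a chart *)

Section LocalPlane.
Context (R : realType) (T : topologicalType) (A : set T) (p : T) (c : chart R A p).
Context (Ap : A p).

Definition plane_param (z : R * R) : 'rV[R]_2 :=
  chart_map c p + \row_k (if k == 0 then z.1 else z.2).

Definition local_param (z : R * R) : T := chart_inv c (plane_param z).

Lemma plane_param_continuous : continuous plane_param.
Proof.
apply: continuous_matrix => i j z.
rewrite (_ : (fun z : R * R => plane_param z i j) =
    (fun z => chart_map c p i j + (if j == 0 then z.1 else z.2))); last first.
  by apply/funext => z'; rewrite /plane_param !mxE.
by apply: cvgD; [exact: cvg_cst|case: ifP => _; [exact: cvg_fst|exact: cvg_snd]].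
Qed.

Lemma plane_param0 : plane_param (0, 0) = chart_map c p.
Proof. by apply/rowP => i; rewrite /plane_param !mxE; case: ifP; rewrite addr0. Qed.

Lemma plane_param_inj : injective plane_param.
Proof.
move=> [x y] [x' y'] /addrI/rowP e; have := e 0; have := e 1; rewrite !mxE /=.
by move=> -> ->.
Qed.

Lemma local_param0 : local_param (0, 0) = p.
Proof. by rewrite /local_param plane_param0 chart_mapK //; exact: chart_dom_base. Qed.

Lemma local_box (N : set T) : open N -> N p -> exists2 r : R, 0 < r &
  forall z : R * R, `|z.1| < r -> `|z.2| < r ->
    [/\ chart_cod c (plane_param z), A (local_param z), N (local_param z) &
        {for z, continuous local_param}].
Proof.
move=> oN Np.
have Wq : chart_cod c (chart_map c p).
  by apply: chart_mapP => //; exact: chart_dom_base.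
have h1 : \forall z \near ((0, 0) : R * R), chart_cod c (plane_param z).
  apply: (plane_param_continuous (x := (0, 0))); rewrite plane_param0.
  by apply: open_nbhs_nbhs; split => //; exact: chart_cod_open.
have h2 : \forall z \near ((0, 0) : R * R), N (local_param z).
  have : {for (0, 0), continuous local_param}.
    apply: continuous_comp; first exact: plane_param_continuous.
    by apply: chart_inv_continuous; rewrite plane_param0.
  by apply; rewrite local_param0; exact: open_nbhs_nbhs.
have : \forall z \near ((0, 0) : R * R), chart_cod c (plane_param z) /\ N (local_param z).
  by near=> z; split; near: z.
move=> /nbhs_ballP[r /= r0 hr]; exists r => // z z1 z2.
have [Wz Nz] : chart_cod c (plane_param z) /\ N (local_param z).
  by apply: hr; split; rewrite /ball /= sub0r normrN.
split => //; first by have [] := chart_invP Wz.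
apply: continuous_comp; first exact: plane_param_continuous.
exact: chart_inv_continuous.
Unshelve. all: by end_near.
Qed.

Lemma local_param_inj z z' : chart_cod c (plane_param z) -> chart_cod c (plane_param z') ->
  local_param z = local_param z' -> z = z'.
Proof.
move=> cz cz' /(congr1 (chart_map c)); rewrite /local_param !chart_invK //.
exact: plane_param_inj.
Qed.

Lemma local_param_onto (r : R) : 0 < r -> exists2 Q : set T, open Q /\ Q p &
  forall x, A x -> Q x -> exists z : R * R, [/\ `|z.1| < r, `|z.2| < r & local_param z = x].
Proof.
move=> r0.
pose S := A `&` chart_dom c.
have Sp : S p by split => //; exact: chart_dom_base.
pose pS : S := exist _ p (mem_set Sp).
have cm : continuous (chart_map c \o (set_val : S -> T)).
  apply: chart_map_continuous; first exact: initial_continuous.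
  by move=> z; exact: (set_valP z).
have cxy i : continuous (fun x : S => chart_map c (set_val x) 0 i - chart_map c p 0 i).
  move=> x; apply: (@continuousB _ _ _ (fun x : S => chart_map c (set_val x) 0 i)
    (fun=> chart_map c p 0 i)); last exact: cst_continuous.
  exact: (@continuous_comp _ _ _ _ (fun q : 'rV[R]_2 => q 0 i) x (cm x)
    (@coord_continuous R 1 2 0 i _)).
have nr i : \forall x \near pS, `|chart_map c (set_val x) 0 i - chart_map c p 0 i| < r.
  have /cvgrPdist_lt/(_ _ r0) := cxy i pS.
  by apply: filterS => x /=; rewrite subrr sub0r normrN.
have [/= _ [[Q oO <-] Op] hO] : \forall x \near pS,
    `|chart_map c (set_val x) 0 0 - chart_map c p 0 0| < r /\
    `|chart_map c (set_val x) 0 1 - chart_map c p 0 1| < r.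
  by near=> x; split; near: x; exact: nr.
exists (Q `&` chart_dom c).
  split; first by apply: openI => //; exact: chart_dom_open.
  by split => //; exact: chart_dom_base.
move=> x Ax [Ox dx]; have Sx : S x by [].
have [/= h0 h1] := hO (exist _ x (mem_set Sx)) Ox.
exists (chart_map c x 0 0 - chart_map c p 0 0, chart_map c x 0 1 - chart_map c p 0 1).
split => //; rewrite /local_param -[RHS](chart_mapK (c := c) Ax dx); congr (chart_inv c _).
apply/rowP => i; rewrite /plane_param !mxE /= addrC.
case: (i =P 0) => [->|i0]; first by rewrite subrK.
have -> : i = 1 by apply: val_inj; case: i i0 => [[|[|[]]]] //= i2 []; apply: val_inj.
by rewrite subrK.
Unshelve. all: by end_near.
Qed.

(** In the chart, two linearly independent vectors are joined by a segment that misses the origin.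
    There [g] has no zero, so by the intermediate value theorem its sign is the same at both
    ends. *)
Lemma no_cut_point (g : T -> R) (N : set T) : continuous g -> open N -> N p -> g p = 0 ->
  (forall x, A x -> N x -> x <> p -> g x != 0) ->
  (forall Q : set T, open Q -> Q p -> exists x y, [/\ A x, A y, Q x, Q y & g x < 0 < g y]) ->
  False.
Proof.
move=> cg oN Np gp gN0 nb.
have [r r0 box] := local_box oN Np; have [Q [oO Op] surj] := local_param_onto r0.
have [x [y [Ax Ay Ox Oy /andP[gx gy]]]] := nb Q oO Op.
have [[x1 x2] [/= hx1 hx2 xE]] := surj x Ax Ox; have [[y1 y2] [/= hy1 hy2 yE]] := surj y Ay Oy.
have [Cp _ _ _] : [/\ chart_cod c (plane_param (0, 0)), A (local_param (0, 0)),
    N (local_param (0, 0)) & {for (0, 0), continuous local_param}].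
  by apply: box; rewrite /= normr0.
have gn z : `|z.1| < r -> `|z.2| < r -> z <> (0, 0) -> g (local_param z) != 0.
  move=> h1 h2 z0; have [Cz Az Nz _] := box z h1 h2; apply: gN0 => //.
  by move=> e; apply: z0; apply: (local_param_inj Cz Cp); rewrite e local_param0.
have seg (a1 a2 b1 b2 : R) : `|a1| < r -> `|a2| < r -> `|b1| < r -> `|b2| < r ->
    a1 * b2 != a2 * b1 -> g (local_param (a1, a2)) < 0 -> g (local_param (b1, b2)) < 0.
  move=> ha1 ha2 hb1 hb2 cr ga; rewrite ltNge; apply/negP => gb.
  pose w t : R * R := ((1 - clamp01 t) * a1 + clamp01 t * b1, (1 - clamp01 t) * a2 + clamp01 t * b2).
  have wr t : `|(w t).1| < r /\ `|(w t).2| < r.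
    have cvx (a b : R) : `|a| < r -> `|b| < r -> `|(1 - clamp01 t) * a + clamp01 t * b| < r.
      move=> ar br; apply: (@le_lt_trans _ _ (Num.max `|a| `|b|)); last by rewrite gt_max ar.
      by apply: convex_norm_le (clamp01_in t); rewrite le_max lexx ?orbT.
    by split; apply: cvx.
  have cw : continuous w.
    by move=> t; exact: (cvg_pair (@clamped_segment_continuous R _ _ t) (@clamped_segment_continuous R _ _ t)).
  have cf : continuous (fun t => g (local_param (w t))).
    move=> t; have [h1 h2] := wr t; have [_ _ _ cl] := box _ h1 h2.
    have cl' : {for t, continuous (local_param \o w)} by apply: continuous_comp; [exact: cw|exact: cl].
    exact: (@continuous_comp _ _ _ _ g t cl' (cg _)).
  have w0 : w 0 = (a1, a2).
    by rewrite /w clamp01_0 subr0 !mul1r !mul0r !addr0.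
  have w1 : w 1 = (b1, b2).
    by rewrite /w clamp01_1 subrr !mul1r !mul0r !add0r.
  have [||t t01 gt] := @IVT R (fun t => g (local_param (w t))) 0 1 0 ler01.
  - by apply: continuous_subspaceT.
  - by rewrite w0 w1 ge_min (ltW ga) /= le_max gb orbT.
  have [h1 h2] := wr t; have := gn _ h1 h2; rewrite gt eqxx => /(_ _)/negP; apply => //.
  move=> [e1 e2]; move: cr; apply/negP; rewrite negbK; apply/eqP.
  have h0' := clamp01_ge0 t; move: e1 e2; set k := clamp01 t => e1 e2.
  have [k1|k1] := eqVneq k 1.
    by move: e1 e2; rewrite k1 subrr !mul0r !mul1r !add0r => -> ->; rewrite !mulr0.
  have k1' : 1 - k != 0 by rewrite subr_eq0 eq_sym.
  apply: (mulfI k1'); apply/eqP; rewrite -subr_eq0.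
  rewrite (_ : _ - _ = ((1 - k) * a1 + k * b1) * b2 - ((1 - k) * a2 + k * b2) * b1); last by ring.
  by rewrite e1 e2 !mul0r subrr.
have y_neq0 : (y1, y2) <> (0, 0).
  by move=> e; move: gy; rewrite -yE e local_param0 gp ltxx.
have x_neq0 : (x1, x2) <> (0, 0).
  by move=> e; move: gx; rewrite -xE e local_param0 gp ltxx.
have gy' : ~ g (local_param (y1, y2)) < 0 by rewrite yE => h; have := lt_trans h gy; rewrite ltxx.
rewrite -xE in gx.
have [cr|cr] := eqVneq (x1 * y2) (x2 * y1); last by apply: gy'; exact: seg gx.
have sq (a b : R) : (a, b) <> (0, 0) -> 0 < a ^+ 2 + b ^+ 2.
  move=> ab; rewrite lt_neqAle addr_ge0 ?sqr_ge0 // andbT eq_sym paddr_eq0 ?sqr_ge0 //.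
  by rewrite !sqrf_eq0; apply/negP => /andP[/eqP a0 /eqP b0]; apply: ab; rewrite a0 b0.
have sx := sq _ _ x_neq0; have sy := sq _ _ y_neq0.
(* For parallel vectors the path makes a detour through [(- x2, x1)], the rotation of the first
   vector by a right angle. The identity used expresses the product of the squared lengths by the
   cross and dot products. *)
apply: gy'; apply: (seg (- x2) x1) => //; rewrite ?normrN //.
  apply/eqP => dot; have : (x1 ^+ 2 + x2 ^+ 2) * (y1 ^+ 2 + y2 ^+ 2) = 0.
    rewrite (_ : _ * _ = (x1 * y2 - x2 * y1) ^+ 2 + (- x2 * y2 - x1 * y1) ^+ 2); last by ring.
    by rewrite cr dot !subrr expr0n addr0.
  by apply/eqP; rewrite gt_eqF // mulr_gt0.
apply: (seg x1 x2) => //; rewrite ?normrN //.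
by rewrite mulrN -subr_eq0 opprK gt_eqF // -!expr2.
Qed.

(* K5 without the edge [01], drawn straight: 0 lies inside the triangle 234 and 1
   outside of it, so that the straight edge [01] would meet the triangle (in 2). *)
Definition wheel_pos (r a : R) (i : nat) : R * R :=
  nth (0, 0) [:: (0, 0); (a, 0); (r, 0); (- r, r); (- r, - r)] i.

Definition wheel_edge (r a : R) (e : nat * nat) (t : R) : R * R :=
  ((1 - t) * (wheel_pos r a e.1).1 + t * (wheel_pos r a e.2).1,
   (1 - t) * (wheel_pos r a e.1).2 + t * (wheel_pos r a e.2).2).

Lemma wheel_edges_disjoint r a ef s t : 0 < r < a -> ef \in K5_disjoint_pairs ->
  ef.1 != (0, 1)%N -> 0 <= s <= 1 -> 0 <= t <= 1 ->
  wheel_edge r a ef.1 s <> wheel_edge r a ef.2 t.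
Proof.
move=> /andP[r0 ra] + + /andP[s0 s1] /andP[t0 t1].
have z (x : R) : r * x = 0 -> x = 0 by move=> /eqP; rewrite mulf_eq0 gt_eqF //= => /eqP.
rewrite /K5_disjoint_pairs /= !inE.
(* Linear arithmetic treats the products of a parameter with [r] or [a] as unknowns; these bounds
   tie them to the ranges of the parameters. *)
have rs : 0 <= r * s by rewrite mulr_ge0 // ltW.
have rt : 0 <= r * t by rewrite mulr_ge0 // ltW.
have rs' : r * s <= r by rewrite ler_piMr // ltW.
have rt' : r * t <= r by rewrite ler_piMr // ltW.
have as0 : 0 <= a * s by rewrite mulr_ge0 //; lra.
have at0 : 0 <= a * t by rewrite mulr_ge0 //; lra.
have as' : a * s <= a by rewrite ler_piMr //; lra.
have at' : a * t <= a by rewrite ler_piMr //; lra.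
have ar : 0 <= (1 - t) * (a - r) by rewrite mulr_ge0 //; lra.
have solve_s : r * s = 0 -> s = 0 by exact: z.
have solve_t : r * t = 0 -> t = 0 by exact: z.
repeat (case/orP); move=> /eqP -> // _; rewrite /wheel_edge /wheel_pos /= => -[e1 e2]; try lra.
all: first [have {}solve_s : s = 0 by apply: solve_s; lra
           |have {}solve_t : t = 0 by apply: solve_t; lra].
all: try (have {}solve_t : t = 0 by apply: solve_t; lra).
all: subst; lra.
Qed.

(** The map [(g1, g2)] sends the part of [A] near [p] injectively into the closed upper half-plane,
    with [p] on the boundary line. It carries along K5 without the edge 01, drawn in the chart; the
    edge 01 is drawn directly in the target plane, and the result is a planar K5. *)
Lemma no_boundary_point (g1 g2 : T -> R) (N : set T) : continuous g1 -> continuous g2 ->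
  open N -> N p -> g1 p = 0 -> g2 p = 0 ->
  (forall x, A x -> N x -> 0 <= g2 x) ->
  (forall x y, A x -> N x -> A y -> N y -> g1 x = g1 y -> g2 x = g2 y -> x = y) -> False.
Proof.
move=> cg1 cg2 oN Np g1p g2p g2_ge0 ginj.
have [r0 r0_gt0 box] := local_box oN Np.
pose H1 z := g1 (local_param z); pose H2 z := g2 (local_param z).
pose inbox (z : R * R) := (`|z.1| < r0) /\ (`|z.2| < r0).
have cH1 z : inbox z -> {for z, continuous H1}.
  by move=> [h1 h2]; have [_ _ _ cl] := box z h1 h2; apply: continuous_comp; [exact: cl|exact: cg1].
have cH2 z : inbox z -> {for z, continuous H2}.
  by move=> [h1 h2]; have [_ _ _ cl] := box z h1 h2; apply: continuous_comp; [exact: cl|exact: cg2].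
have Hinj z z' : inbox z -> inbox z' -> H1 z = H1 z' -> H2 z = H2 z' -> z = z'.
  move=> [h1 h2] [h1' h2']; have [C1 A1 N1 _] := box z h1 h2; have [C2 A2 N2 _] := box z' h1' h2'.
  by move=> e1 e2; apply: local_param_inj => //; exact: ginj.
have H2_ge0 z : inbox z -> 0 <= H2 z.
  by move=> [h1 h2]; have [_ A1 N1 _] := box z h1 h2; exact: g2_ge0.
have H10 : H1 (0, 0) = 0 by rewrite /H1 local_param0.
have H20 : H2 (0, 0) = 0 by rewrite /H2 local_param0.
have in0 : inbox (0, 0) by rewrite /inbox /= normr0.
pose a := r0 / 2; have a0 : 0 < a by rewrite divr_gt0.
have ar0 : a < r0 by rewrite /a; lra.
have ina : inbox (a, 0) by rewrite /inbox /= normr0 gtr0_norm.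
pose G1 := H1 (a, 0); pose G2 := H2 (a, 0).
have G2_ge0 : 0 <= G2 by exact: H2_ge0.
have Gn0 : ~ (G1 = 0 /\ G2 = 0).
  move=> [e1 e2]; have := Hinj _ _ ina in0 (etrans e1 (esym H10)) (etrans e2 (esym H20)).
  by case=> e; move: a0; rewrite e ltxx.
(* This path leaves the image of [p] through the half-plane [y < 0], which the
   image of the chart avoids, and returns far from the image of [p]. *)
pose d : R := if G1 == 0 then 1 else 0.
pose px (t : R) := t * G1 + d * (t * (1 - t)).
(* For [t] at most 1/2 one has [(2 * G2 + 1) * (1 - t) >= G2 + 1/2], which makes [py] negative. The
   term with [d] in [px] serves the case [G1 = 0], where [t * G1] alone would vanish identically. *)
pose py (t : R) := t * G2 - (2 * G2 + 1) * (t * (1 - t)).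
have py_lt0 t : 0 < t <= 2^-1 -> py t < 0.
  move=> /andP[t0 t1]; rewrite /py (_ : _ - _ = t * (G2 - (2 * G2 + 1) * (1 - t))); last by ring.
  by rewrite pmulr_rlt0 //; have : 0 <= G2 * (2^-1 - t) by [rewrite mulr_ge0 //; lra]; lra.
have p_neq0 t : 2^-1 <= t <= 1 -> px t = 0 -> py t = 0 -> False.
  move=> /andP[t0 t1]; rewrite /px /py /d; case: eqP => [G10|/eqP G10].
    rewrite G10 mulr0 add0r mul1r => h h'; apply: Gn0; split => //.
    by move: h'; rewrite h mulr0 subr0 => /eqP; rewrite mulf_eq0 => /orP[]/eqP; lra.
  by rewrite mul0r addr0 => /eqP; rewrite mulf_eq0 (negbTE G10) orbF => /eqP; lra.
have cpoly (u v : R) : continuous (fun t : R => t * u + v * (t * (1 - t))).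
  move=> t; apply: cvgD; apply: cvgM.
  - exact: cvg_id.
  - exact: cvg_cst.
  - exact: cvg_cst.
  - by apply: cvgM; [exact: cvg_id|apply: cvgB; [exact: cvg_cst|exact: cvg_id]].
have cpx : continuous px by exact: cpoly.
have cpy : continuous py.
  rewrite (_ : py = fun t : R => t * G2 + (- (2 * G2 + 1)) * (t * (1 - t))); first exact: cpoly.
  by apply/funext => t; rewrite /py mulNr.
have [eta eta0 heta] : exists2 eta : R, 0 < eta & forall t, 2^-1 <= t <= 1 ->
    eta <= `|px t| + `|py t|.
  have h12 : (2^-1 : R) <= 1 by lra.
  have cn : continuous (fun t => `|px t| + `|py t|).
    by move=> t; apply: cvgD; apply: cvg_norm; [exact: cpx|exact: cpy].
  have [t0 t0I hmin] := EVT_min h12 (continuous_subspaceT cn).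
  exists (`|px t0| + `|py t0|); last by move=> t tI; apply: hmin; rewrite in_itv.
  rewrite lt_neqAle addr_ge0 // andbT eq_sym paddr_eq0 // !normr_eq0.
  by apply/negP => /andP[/eqP h1 /eqP h2]; apply: (p_neq0 t0) => //; move: t0I; rewrite in_itv.
have [r /andP[r_gt0 ra] small] : exists2 r, 0 < r < a & forall z : R * R, `|z.1| <= r ->
    `|z.2| <= r -> `|H1 z| + `|H2 z| < eta.
  have cn : {for (0, 0), continuous (fun z => `|H1 z| + `|H2 z|)}.
    by apply: cvgD; apply: cvg_norm; [exact: cH1|exact: cH2].
  have /cvgrPdist_lt/(_ _ eta0)/nbhs_ballP[r /= r_gt0 hr] := cn.
  exists (Num.min (r / 2) (a / 2)).
    by rewrite lt_min !divr_gt0 //= gt_min; apply/orP; right; lra.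
  move=> z; rewrite !le_min => /andP[h1 h1'] /andP[h2 h2'].
  have /hr : ball ((0, 0) : R * R) r z by split; rewrite /ball /= sub0r normrN; lra.
  by rewrite /= H10 H20 !normr0 addr0 sub0r normrN ger0_norm ?addr_ge0.
pose isP (i j : nat) := (i == 0%N) && (j == 1%N).
pose lin i j t := wheel_edge r a (i, j) (clamp01 t).
pose fx i j t := if isP i j then px (clamp01 t) else H1 (lin i j t).
pose fy i j t := if isP i j then py (clamp01 t) else H2 (lin i j t).
pose qx i := H1 (wheel_pos r a i); pose qy i := H2 (wheel_pos r a i).
have pos_le i : (i < 5)%N -> i != 1%N ->
    (`|(wheel_pos r a i).1| <= r) && (`|(wheel_pos r a i).2| <= r).
  by case: i => [|[|[|[|[|[]]]]]] //= _ _; rewrite ?normrN ?normr0 ?(gtr0_norm r_gt0) ?lexx ?(ltW r_gt0).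
have pos_in i : (i < 5)%N -> inbox (wheel_pos r a i).
  move=> i5; have [->|i1] := eqVneq i 1%N; first exact: ina.
  by have /andP[h1 h2] := pos_le i i5 i1; split; lra.
have lin_in e t : e \in K5_edges -> inbox (lin e.1 e.2 t).
  move=> /K5_edge_lt/andP[e12 e2]; have e1 := ltn_trans e12 e2.
  have le_a i : (i < 5)%N -> (`|(wheel_pos r a i).1| <= a) && (`|(wheel_pos r a i).2| <= a).
    move=> i5; have [->|i1] := eqVneq i 1%N; first by rewrite /= normr0 gtr0_norm // lexx ltW.
    by have /andP[h1 h2] := pos_le i i5 i1; rewrite !(le_trans _ (ltW ra)).
  have /andP[h1 h1'] := le_a _ e1; have /andP[h2 h2'] := le_a _ e2.
  by split; apply: le_lt_trans ar0; apply: convex_norm_le; rewrite ?clamp01_in.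
have clin i j : continuous (lin i j).
  by move=> t; exact: (cvg_pair (@clamped_segment_continuous R _ _ t) (@clamped_segment_continuous R _ _ t)).
have cclamp (k : R -> R) : continuous k -> continuous (k \o @clamp01 R).
  by move=> ck t; apply: continuous_comp; [exact: clamp01_continuous|exact: ck].
have cfx e : e \in K5_edges -> continuous (fx e.1 e.2) /\ continuous (fy e.1 e.2).
  move=> eE; rewrite /fx /fy; case: (isP e.1 e.2); first by split; exact: cclamp.
  split=> t; have i1 := lin_in e t eE.
    exact: (@continuous_comp _ _ _ _ H1 t (clin _ _ t) (cH1 _ i1)).
  exact: (@continuous_comp _ _ _ _ H2 t (clin _ _ t) (cH2 _ i1)).
have lin0 i j : lin i j 0 = wheel_pos r a i.
  by rewrite /lin clamp01_0 /wheel_edge subr0 !mul1r !mul0r !addr0; case: (wheel_pos r a i).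
have lin1 i j : lin i j 1 = wheel_pos r a j.
  by rewrite /lin clamp01_1 /wheel_edge subrr !mul1r !mul0r !add0r; case: (wheel_pos r a j).
have start e : e \in K5_edges -> fx e.1 e.2 0 = qx e.1 /\ fy e.1 e.2 0 = qy e.1.
  move=> eE; rewrite /fx /fy lin0; case: ifP => // /andP[/eqP -> _].
  by rewrite clamp01_0 /px /py /qx /qy /= H10 H20 !mul0r !mulr0 subr0 addr0.
have stop e : e \in K5_edges -> fx e.1 e.2 1 = qx e.2 /\ fy e.1 e.2 1 = qy e.2.
  move=> eE; rewrite /fx /fy lin1; case: ifP => // /andP[_ /eqP ->].
  by rewrite clamp01_1 /px /py /qx /qy /= subrr !mulr0 subr0 addr0 !mul1r.
have tri_absurd s i j t : 0 <= s <= 1 -> 0 <= t <= 1 ->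
    ((0, 1), (i, j))%N \in K5_disjoint_pairs -> px s = H1 (wheel_edge r a (i, j) t) ->
    py s = H2 (wheel_edge r a (i, j) t) -> False.
  move=> s01 t01 ij e1 e2.
  have ij' : [&& (1 < i)%N, (i < 5)%N, (1 < j)%N & (j < 5)%N].
    exact: (allP (isT : all (fun ef => (ef.1 == (0, 1))%N ==> [&& (1 < ef.2.1)%N, (ef.2.1 < 5)%N,
      (1 < ef.2.2)%N & (ef.2.2 < 5)%N]) K5_disjoint_pairs) _ ij).
  have /and4P[i1 i5 j1 j5] := ij'.
  have /andP[pi1 pi2] := pos_le i i5 (negbT (gtn_eqF i1)); have /andP[pj1 pj2] := pos_le j j5 (negbT (gtn_eqF j1)).
  pose z := wheel_edge r a (i, j) t.
  have z1 : `|z.1| <= r by exact: convex_norm_le.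
  have z2 : `|z.2| <= r by exact: convex_norm_le.
  have zin : inbox z by split; [exact: le_lt_trans z1 (lt_trans ra ar0)|exact: le_lt_trans z2 (lt_trans ra ar0)].
  have [s0|s0] := eqVneq s 0.
    move: e1 e2; rewrite s0 /px /py !mul0r !mulr0 subr0 addr0 => e1 e2.
    have z0 := Hinj _ _ in0 zin (etrans H10 e1) (etrans H20 e2).
    (* The vertices 2, 3, 4 add up to 9, so [9 - i - j] is the third vertex of the triangle. The
       point 0 would lie on the side [i j], although the straight edge from 0 to the third vertex
       avoids that side. *)
    have := allP (isT : all (fun ef => (ef.1 == (0, 1))%N ==>
      (((0, 9 - ef.2.1 - ef.2.2), ef.2)%N \in K5_disjoint_pairs) && (9 - ef.2.1 - ef.2.2 != 1)%N)
      K5_disjoint_pairs) _ ij.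
    rewrite /= => /andP[pr k1]; have s00 : (0 : R) <= (0 : R) <= 1 by rewrite lexx ler01.
    have rra : 0 < r < a by rewrite r_gt0.
    apply: (wheel_edges_disjoint rra pr _ s00 t01); first by rewrite xpair_eqE.
    by rewrite /= -/z -z0 /wheel_edge /= subr0 !mul0r mulr0 addr0.
  have [s12|s12] := leP s 2^-1.
    have := py_lt0 s; rewrite e2 lt_neqAle eq_sym s0 s12; case/andP: s01 => -> _ /(_ isT).
    by rewrite ltNge H2_ge0.
  have := heta s; rewrite (ltW s12); case/andP: s01 => _ -> /(_ isT).
  by rewrite e1 e2 leNgt small.
have absurd e f s t : (e, f) \in K5_disjoint_pairs -> 0 <= s <= 1 -> 0 <= t <= 1 ->
    fx e.1 e.2 s = fx f.1 f.2 t -> fy e.1 e.2 s = fy f.1 f.2 t -> False.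
  move=> ef s01 t01; rewrite /fx /fy /lin !clamp01_id ?in_itv //.
  have fP : isP f.1 f.2 = false.
    have := allP (isT : all (fun ef => 0 < ef.2.1)%N K5_disjoint_pairs) _ ef.
    by rewrite /isP; case: (f.1).
  rewrite fP; have [eP|eP] := boolP (isP e.1 e.2).
    case: e ef eP => i j ef /andP[/= /eqP i0 /eqP j1]; subst i j.
    by case: f ef fP => k l ef _; exact: (tri_absurd s k l t).
  have e01 : (e, f).1 != (0, 1)%N.
    by move: eP; rewrite /isP /=; case: (e) => i j /=; rewrite xpair_eqE.
  have eE : e \in K5_edges /\ f \in K5_edges.
    by move: ef; rewrite mem_filter => /andP[_ /allpairsP[[e' f'] /= [? ? [-> ->]]]].
  have := lin_in e s (proj1 eE); have := lin_in f t (proj2 eE).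
  rewrite /lin !clamp01_id ?in_itv // => in2 in1 h1 h2.
  have rra : 0 < r < a by rewrite r_gt0.
  apply: (wheel_edges_disjoint rra ef e01 s01 t01) => /=.
  case: e f {ef fP eP e01 eE} in1 in2 h1 h2 => [i j] [k l]; exact: Hinj.
have [e [f [s [t [eE fE dis /andP[s01 t01] [h0 h1]]]]]] :=
  @K5_nonplanar R qx qy fx fy start stop cfx.
rewrite !in_itv /= in s01 t01.
have := allP (allP (isT : all (fun e => all (fun f => disjoint_edges e f ==>
  ((e, f) \in K5_disjoint_pairs) || ((f, e) \in K5_disjoint_pairs)) K5_edges) K5_edges) _ eE) _ fE.
rewrite dis /= => /orP[ef|fe]; first exact: absurd ef s01 t01 h0 h1.
exact: absurd fe t01 s01 (esym h0) (esym h1).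
Qed.
End LocalPlane.

(** * The graph of a flag triangulation *)

Section Graph.
Context (V : finType) (D : simplicial_complex V).

Definition adj (u v : V) : bool := (u != v) && ([set u; v]%SET \in faces D).

Definition nbrs (v : V) : {set V} := [set w | adj v w]%SET.

Lemma adj_sym u v : adj u v = adj v u.
Proof. by rewrite /adj eq_sym finset.setUC. Qed.

Lemma adj_irr u : adj u u = false.
Proof. by rewrite /adj eqxx. Qed.

Lemma adj_neq u v : adj u v -> u != v.
Proof. by case/andP. Qed.

Lemma face_adj s u v : s \in faces D -> u \in s -> v \in s -> u != v -> adj u v.
Proof.
move=> sF us vs uv; rewrite /adj uv; apply: (faces_sub sF).
by apply/fintype.subsetP => x; rewrite !inE => /orP[/eqP->|/eqP->].
Qed.

Lemma face_vertex s u : s \in faces D -> u \in s -> u \in vertices D.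
Proof. by move=> sF us; rewrite inE; apply: (faces_sub sF); rewrite finset.sub1set. Qed.

Lemma adj_vertex u v : adj u v -> u \in vertices D /\ v \in vertices D.
Proof. by case/andP=> _ h; split; apply: (face_vertex h); rewrite !inE eqxx ?orbT. Qed.

(** By induction all proper subsets of the clique are faces; if the clique were not one, it would be
    a minimal non-face, hence a pair, but its pairs are edges. *)
Lemma clique_face (s : {set V}) : flag D -> s \subset vertices D ->
  {in s &, forall u v, u != v -> adj u v} -> s \in faces D.
Proof.
move=> fl; have [n] := ubnP #|s|; elim: n s => // n IH s sn sV cl.
have sub (t : {set V}) : t \proper s -> t \in faces D.
  move=> ts; have tsub := proper_sub ts; apply: IH.
  - exact: leq_trans (proper_card ts) sn.
  - exact: fintype.subset_trans tsub sV.
  - by move=> x y /(fintype.subsetP tsub) xs /(fintype.subsetP tsub) ys; exact: cl.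
apply/negPn/negP => sF; have /eqP/cards2P[x [y [xy sE]]] := fl s (And3 sV sF sub).
move: sF; rewrite sE; have /andP[_ ->] // : adj x y.
by apply: cl => //; rewrite sE !inE eqxx ?orbT.
Qed.
End Graph.

(** * Links in a flag triangulation of a surface *)

Section SurfaceFacts.
Context (R : realType) (M : topologicalType) (V : finType) (D : simplicial_complex V).
Context (surf : closed_connected_surface R M) (tri : triangulates D R M) (fl : flag D).
Local Notation X := (realization D R).
Local Notation pm := (@point_mass R V).

Lemma surface_chart p : X p -> inhabited (chart R X p).
Proof. by have [[_ _ le] _] := surf; exact: chart_exists tri le. Qed.

Lemma realization_eval_continuous v : continuous (fun x : {ptws V -> R} => x v).
Proof. exact: (@continuous_eval V R v). Qed.

Lemma continuous_sum_eval (s : {set V}) : continuous (fun x : {ptws V -> R} => \sum_(v in s) x v).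
Proof.
apply: continuous_big; first exact: add_continuous.
by move=> v _ x; exact: (@realization_eval_continuous v x).
Qed.

Lemma realizationP (x : {ptws V -> R}) s : s \in faces D -> (forall v, 0 <= x v) ->
  \sum_v x v = 1 -> (forall v, x v != 0 -> v \in s) -> X x.
Proof.
move=> sF x0 x1 xs; split => //; apply: (faces_sub sF).
by apply/fintype.subsetP => v; rewrite inE => /xs.
Qed.

Lemma support_adj x u v : X x -> x u != 0 -> x v != 0 -> u != v -> adj D u v.
Proof. by move=> [_ _ sF] xu xv uv; apply: (face_adj sF) => //; rewrite inE. Qed.

Lemma midpoint_realization u v : adj D u v -> X (@midpoint R V u v).
Proof.
case/andP=> uv uvF; apply: (realizationP uvF).
- by move=> x; rewrite /midpoint /point_mass divr_ge0 ?addr_ge0.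
- by rewrite /midpoint -mulr_suml big_split /= !sum_point_mass; lra.
- move=> x; rewrite /midpoint /point_mass !inE.
  by apply: contra_neqT; rewrite negb_or => /andP[/negbTE-> /negbTE->]; rewrite addr0 mul0r.
Qed.

Lemma vertex_realization v : v \in vertices D -> X (pm v).
Proof.
rewrite inE => vF; apply: (realizationP vF).
- by move=> x; rewrite /point_mass.
- exact: sum_point_mass.
- by move=> x; rewrite /point_mass inE; apply: contra_neqT => /negbTE ->.
Qed.

Lemma triangle_face u v w : adj D u v -> adj D u w -> adj D v w -> [set u; v; w]%SET \in faces D.
Proof.
move=> uv uw vw; have [uV vV] := adj_vertex uv; have [_ wV] := adj_vertex uw.
apply: clique_face => //.
  apply/fintype.subsetP => x xs; have : [|| x == u, x == v | x == w].
    by move: xs; rewrite !inE -orbA.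
  by case/or3P=> /eqP->.
move=> x y; rewrite !inE -!orbA => /or3P[]/eqP-> /or3P[]/eqP->; rewrite ?eqxx // => _ //;
  by rewrite adj_sym.
Qed.

Lemma point_mass_inj : injective pm.
Proof.
move=> u v /(congr1 (fun f : V -> R => f u)); rewrite /point_mass eqxx.
by case: eqP => // _ /eqP; rewrite oner_eq0.
Qed.

(** A 4-clique spans a tetrahedron, which contains a book along [a b] with apexes [c], [d] and the
    midpoint of [c d]. *)
Lemma no_K4 a b c d : adj D a b -> adj D a c -> adj D a d -> adj D b c -> adj D b d ->
  adj D c d -> False.
Proof.
move=> ab ac ad bc bd cd; have [ch] := surface_chart (midpoint_realization ab).
have [an bn] := (adj_neq ab, adj_neq cd).
have [acn adn bcn bdn] := And4 (adj_neq ac) (adj_neq ad) (adj_neq bc) (adj_neq bd).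
have F : [set a; b; c; d]%SET \in faces D.
  apply: clique_face => //.
    apply/fintype.subsetP => x xs; have : [|| x == a, x == b, x == c | x == d].
      by move: xs; rewrite !inE -!orbA.
    have [aV bV] := adj_vertex ab; have [cV dV] := adj_vertex cd.
    by case/or4P=> /eqP->.
  move=> x y; rewrite !inE -!orbA => /or4P[]/eqP-> /or4P[]/eqP->; rewrite ?eqxx // => _ //;
  by rewrite adj_sym.
pose f k : V -> R := if k == 0%N then pm c else if k == 1%N then pm d else
  fun x => (pm c x + pm d x) / 2.
apply: (@no_book R V D a b f) ch => //.
- by move=> k x _; rewrite /f /point_mass; do ?case: ifP => _ //; rewrite divr_ge0 ?addr_ge0.
- move=> k _; rewrite /f; do ?case: ifP => _; rewrite ?sum_point_mass //.
  by rewrite -mulr_suml big_split /= !sum_point_mass; lra.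
- move=> k _; rewrite /f; do ?case: ifP => _; rewrite /point_mass /= ?(negbTE acn) ?(negbTE bcn) ?(negbTE adn) ?(negbTE bdn) //.
  by rewrite addr0 mul0r.
- have fc k : f k c = if k == 0%N then 1 else if k == 1%N then 0 else 2^-1.
    by rewrite /f; do ?case: ifP => _; rewrite /point_mass ?eqxx ?(negbTE bn) //= ?addr0 ?mul1r.
  move=> k l k3 l3 /(congr1 (fun g : V -> R => g c)); rewrite !fc.
  by case: k l k3 l3 => [|[|[]]] // [|[|[]]] // _ _ /= e; exfalso; lra.
- move=> k s _ hs; apply: (faces_sub F); apply/fintype.subsetP => x /hs /or3P[/eqP->|/eqP->|];
    rewrite !inE ?eqxx ?orbT //.
  rewrite /f; case: (k == 0%N); last case: (k == 1%N); rewrite /point_mass.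
  - by case: (x == c); rewrite ?orbT // eqxx.
  - by case: (x == d); rewrite ?orbT // eqxx.
  - by case: (x == c); case: (x == d); rewrite ?orbT // addr0 mul0r eqxx.
Qed.

Definition common (u v : V) : {set V} := (nbrs D u :&: nbrs D v)%SET.

(** Three common neighbours are the apexes of a book along [u v]. *)
Lemma common_le2 u v : adj D u v -> (#|common u v| <= 2)%N.
Proof.
move=> uv; rewrite leqNgt; apply/negP => /card_gt2P[w1 [w2 [w3 [[c1 c2 c3] [n12 n23 n31]]]]].
have [ch] := surface_chart (midpoint_realization uv).
pose w k := nth w3 [:: w1; w2] k.
have wP k : (k < 3)%N -> adj D u (w k) /\ adj D v (w k).
  have h z : z \in common u v -> adj D u z /\ adj D v z by rewrite !inE => /andP[].
  by case: k => [|[|[]]] // _; apply: h.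
apply: (@no_book R V D u v (fun k => pm (w k))) ch.
- exact: adj_neq uv.
- by move=> k x _; rewrite /point_mass.
- by move=> k _; exact: sum_point_mass.
- by move=> k /wP[/adj_neq h1 /adj_neq h2]; rewrite /point_mass (negbTE h1) (negbTE h2).
- move=> k l k3 l3 /point_mass_inj; case: k l k3 l3 => [|[|[]]] // [|[|[]]] // _ _ e; rewrite /w /= in e;
    by move: n12 n23 n31; rewrite e eqxx.
- move=> k s k3 hs; have [uw vw] := wP k k3; apply: (faces_sub (triangle_face uv uw vw)).
  apply/fintype.subsetP => x /hs /or3P[/eqP->|/eqP->|]; rewrite !inE ?eqxx ?orbT //.
  by rewrite /point_mass; case: (x == w k); rewrite ?orbT // eqxx.
Qed.

Lemma open_pos v : open [set x : {ptws V -> R} | 0 < x v].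
Proof.
rewrite -[X in open X]/((fun x : {ptws V -> R} => x v) @^-1` [set t | 0 < t]).
apply: open_comp; last exact: open_gt.
by move=> x _; exact: realization_eval_continuous.
Qed.

(** With at most one common neighbour, a point near the midpoint of [u v] is determined by
    [x u - x v] and by its mass on the common neighbours. The latter is nonnegative and vanishes at
    the midpoint, which would be a boundary point. *)
Lemma common_ge2 u v : adj D u v -> (2 <= #|common u v|)%N.
Proof.
move=> uv; rewrite leqNgt; apply/negP; rewrite ltnS => cm.
have [ch] := surface_chart (midpoint_realization uv); have nuv := adj_neq uv.
have [vu uvE] : (v == u) = false /\ (u == v) = false by rewrite eq_sym (negbTE nuv).
have commonP x w : X x -> 0 < x u -> 0 < x v -> w != u -> w != v -> w \notin common u v -> x w = 0.
  move=> Xx xu xv wu wv; apply: contraNeq => xw; rewrite !inE.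
  have xu' : x u != 0 by rewrite gt_eqF.
  have xv' : x v != 0 by rewrite gt_eqF.
  by apply/andP; split; apply: (support_adj Xx) => //; rewrite eq_sym.
have sumE x : X x -> 0 < x u -> 0 < x v -> x u + x v + \sum_(w in common u v) x w = 1.
  move=> Xx xu xv; have [_ <- _] := Xx.
  rewrite [RHS](bigD1 u) //= [X in _ = _ + X](bigD1 v) 1?eq_sym //= addrA; congr (_ + _).
  rewrite [RHS](bigID (mem (common u v))) /= [X in _ = _ + X]big1 ?addr0.
    apply: eq_bigl => w; rewrite !inE; case: eqP => [->|_]; first by rewrite adj_irr.
    by case: eqP => [->|_]; rewrite ?adj_irr ?andbF.
  by move=> w /andP[/andP[wu wv] wc]; exact: commonP.
apply: (no_boundary_point ch (midpoint_realization uv) (g1 := fun x => x u - x v)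
  (g2 := fun x => \sum_(w in common u v) x w)
  (N := [set x : {ptws V -> R} | 0 < x u] `&` [set x | 0 < x v])).
- move=> x; exact: (@continuousB _ _ _ _ _ x (@realization_eval_continuous u x)
    (@realization_eval_continuous v x)).
- exact: continuous_sum_eval.
- by apply: openI; exact: open_pos.
- by split; rewrite /= /midpoint /point_mass eqxx ?vu ?uvE /=; lra.
- by rewrite /midpoint /point_mass !eqxx vu uvE /= addr0 add0r subrr.
- rewrite big1 // => w; rewrite !inE /midpoint /point_mass => /andP[/adj_neq uw /adj_neq vw].
  by rewrite eq_sym (negbTE uw) eq_sym (negbTE vw) addr0 mul0r.
- by move=> x [x0 _ _] _; apply: sumr_ge0.
- move=> x y Xx [xu xv] Xy [yu yv] e1 e2.
  have := sumE x Xx xu xv; have := sumE y Xy yu yv; rewrite e2 => sy sx.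
  have eu : x u = y u by lra.
  have ev : x v = y v by lra.
  apply/funext => w; have [->//|wu] := eqVneq w u; have [->//|wv] := eqVneq w v.
  have [wc|wc] := boolP (w \in common u v); last by rewrite (commonP x) // (commonP y).
  have cE : common u v = [set w]%SET.
    by apply/esym/eqP; rewrite eqEcard finset.sub1set wc cards1.
  by move: e2; rewrite cE !finset.big_set1.
Qed.

Lemma card_common u v : adj D u v -> #|common u v| = 2%N.
Proof. by move=> uv; apply/eqP; rewrite eqn_leq common_le2 // common_ge2. Qed.

Lemma support_vertex (x : {ptws V -> R}) v : X x -> x v != 0 -> (forall w, adj D v w -> x w = 0) -> x = pm v.
Proof.
move=> Xx xv h; have x0 w : w != v -> x w = 0.
  move=> wv; have [//|xw] := eqVneq (x w) 0.
  by apply: h; apply: (support_adj Xx); rewrite // eq_sym.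
apply/funext => w; rewrite /point_mass; have [->|/x0//] := eqVneq w v.
by have [_ <- _] := Xx; rewrite (bigD1 v) //= big1 ?addr0.
Qed.

(** A vertex without neighbours would be an isolated point of the realization, where constant
    functions already satisfy the hypotheses of [no_boundary_point]. *)
Lemma nbrs_neq0 v : v \in vertices D -> nbrs D v != finset.set0.
Proof.
move=> vV; apply/negP => /eqP N0; have [ch] := surface_chart (vertex_realization vV).
have z (x : {ptws V -> R}) : X x -> 0 < x v -> x = pm v.
  move=> Xx xv; apply: support_vertex => //; first by rewrite gt_eqF.
  by move=> w vw; have := finset.in_set0 w; rewrite -N0 inE vw.
apply: (no_boundary_point ch (vertex_realization vV) (g1 := fun=> 0) (g2 := fun=> 0)
  (N := [set x : {ptws V -> R} | 0 < x v])) => //.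
- exact: cst_continuous.
- exact: cst_continuous.
- exact: open_pos.
- by rewrite /= /point_mass eqxx.
- by move=> x y Xx xv Xy yv _ _; rewrite (z x) // (z y).
Qed.

(* In the star of [v], the mass on [A] minus the mass on [B] vanishes only at [v],
   which would be a local cut point. *)
Lemma link_connected v (A B : {set V}) : v \in vertices D -> nbrs D v = (A :|: B)%SET ->
  A != finset.set0 -> B != finset.set0 ->
  (forall a b, a \in A -> b \in B -> ~~ (adj D a b) && (a != b)) -> False.
Proof.
move=> vV NE /finset.set0Pn[a0 a0A] /finset.set0Pn[b0 b0B] AB.
have [ch] := surface_chart (vertex_realization vV).
have ndA a : a \in A -> adj D v a by move=> aA; have : a \in nbrs D v; [by rewrite NE inE aA|by rewrite inE].
have ndB b : b \in B -> adj D v b by move=> bB; have : b \in nbrs D v; [by rewrite NE inE bB orbT|by rewrite inE].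
pose g (x : {ptws V -> R}) := \sum_(a in A) x a - \sum_(b in B) x b.
have cg : continuous g.
  move=> x; exact: (@continuousB _ _ _ _ _ x (@continuous_sum_eval A x) (@continuous_sum_eval B x)).
have pmA w : w \in A -> g (pm w) = 1.
  move=> wA; rewrite /g (bigD1 w) //= /point_mass eqxx big1; last by move=> i /andP[_ /negbTE ->].
  by rewrite big1 ?subr0 ?addr0 // => b bB; have /andP[_ h] := AB w b wA bB; rewrite eq_sym (negbTE h).
have pmB w : w \in B -> g (pm w) = -1.
  move=> wB; rewrite /g big1; last by move=> a aA; have /andP[_ h] := AB a w aA wB; rewrite /point_mass (negbTE h).
  by rewrite (bigD1 w) //= /point_mass eqxx big1 ?addr0 ?sub0r // => i /andP[_ /negbTE ->].
have gv : g (pm v) = 0.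
  rewrite /g !big1 ?subr0 // => w wW; rewrite /point_mass.
    by have /adj_neq := ndB w wW; rewrite eq_sym => /negbTE ->.
  by have /adj_neq := ndA w wW; rewrite eq_sym => /negbTE ->.
apply: (no_cut_point ch (vertex_realization vV) cg (N := [set x : {ptws V -> R} | 0 < x v])) => //.
- exact: open_pos.
- by rewrite /= /point_mass eqxx.
- move=> x Xx xv xn; have [x0 _ _] := Xx.
  have sgt (S : {set V}) w : w \in S -> x w != 0 -> 0 < \sum_(a in S) x a.
    move=> wS xw; rewrite (bigD1 w) //=; apply: ltr_pwDl; last exact: sumr_ge0.
    by rewrite lt_neqAle eq_sym xw x0.
  have [w /andP[vw xw]] : exists w, adj D v w && (x w != 0).
    apply: contrapT => /forallNP h; apply: xn; apply: support_vertex => //.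
      by rewrite gt_eqF.
    by move=> w vw; apply/eqP/negPn/negP => xw; apply: (h w); rewrite vw.
  have : w \in nbrs D v by rewrite inE.
  rewrite NE inE /g => /orP[wA|wB].
    rewrite [X in _ - X]big1 ?subr0 ?gt_eqF ?(sgt A w) // => b bB.
    have /andP[nadj nab] := AB w b wA bB.
    by apply/eqP; apply: contraNT nadj => xb; exact: (support_adj Xx).
  rewrite big1 ?sub0r ?oppr_eq0 ?gt_eqF ?(sgt B w) // => a aA.
  have /andP[nadj nab] := AB a w aA wB.
  by apply/eqP; apply: contraNT nadj => xa; exact: (support_adj Xx).
- move=> Q oQ Qv.
  have near_v w : adj D v w -> exists2 t, 0 < t <= 1 &
      Q (fun x => (1 - t) * pm v x + t * pm w x) .
    move=> vw; pose k (t : R) : {ptws V -> R} := fun x => (1 - t) * pm v x + t * pm w x.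
    have ck : continuous k.
      apply: continuous_ptws => x t; apply: cvgD; (apply: cvgM; last exact: cst_continuous).
        by apply: cvgB; [exact: cvg_cst|exact: cvg_id].
      exact: cvg_id.
    have k0 : k 0 = pm v by apply/funext => x; rewrite /k subr0 mul1r mul0r addr0.
    have : \forall t \near (0 : R), Q (k t).
      by apply: ck; rewrite k0; exact: open_nbhs_nbhs.
    move=> /nbhs_ballP[r /= r0 hr]; exists (Num.min 1 (r / 2)).
      by rewrite lt_min ltr01 divr_gt0 //= ge_min lexx.
    apply: hr; rewrite /ball /= sub0r normrN ger0_norm; last first.
      by rewrite le_min ler01 divr_ge0 // ltW.
    by rewrite gt_min; apply/orP; right; rewrite ltr_pdivrMr // ltr_pMr // ltr1n.
  have in_real w t : adj D v w -> 0 < t <= 1 -> X (fun x => (1 - t) * pm v x + t * pm w x).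
    move=> /andP[vwn vwF] /andP[t0 t1]; apply: (realizationP vwF).
    - by move=> x; rewrite /point_mass addr_ge0 ?mulr_ge0 ?subr_ge0 // ltW.
    - by rewrite big_split /= -!mulr_sumr !sum_point_mass; lra.
    - move=> x; rewrite !inE /point_mass; apply: contra_neqT.
      by rewrite negb_or => /andP[/negbTE-> /negbTE->]; rewrite !mulr0 addr0.
  have gE w t : g (fun x => (1 - t) * pm v x + t * pm w x) = t * g (pm w).
    rewrite /g !big_split /= -!mulr_sumr.
    by have : g (pm v) = 0 by []; rewrite /g => h; nra.
  have [ta ta01 Qa] := near_v _ (ndA _ a0A); have [tb tb01 Qb] := near_v _ (ndB _ b0B).
  exists (fun x => (1 - tb) * pm v x + tb * pm b0 x), (fun x => (1 - ta) * pm v x + ta * pm a0 x).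
  split=> //; try by apply: in_real => //; [exact: ndB|exact: ndA].
  + by apply: in_real => //; exact: ndB.
  + by apply: in_real => //; exact: ndA.
  + rewrite !gE (pmA _ a0A) (pmB _ b0B) mulr1 mulrN1 oppr_lt0.
    by case/andP: ta01 => -> _; case/andP: tb01 => -> _.
Qed.

(** The support of a point is a clique, hence lies in [A] or in [B]. The mass on [A] is thus a
    continuous function on the surface with values 0 and 1, both attained. *)
Lemma graph_connected (A B : {set V}) : vertices D = (A :|: B)%SET ->
  A != finset.set0 -> B != finset.set0 ->
  (forall a b, a \in A -> b \in B -> ~~ (adj D a b) && (a != b)) -> False.
Proof.
move=> VE /finset.set0Pn[a0 a0A] /finset.set0Pn[b0 b0B] AB.
have [_ [_ con _]] := surf; have [f [h [fh hf cf ch]]] := tri.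
pose g (x : {ptws V -> R}) := \sum_(a in A) x a.
pose G (m : M) : R := g (set_val (h m)).
have cG : continuous G.
  have c1 : continuous (set_val \o h) by exact: continuous_set_val.
  move=> m; exact: (@continuous_comp _ _ _ _ g m (c1 m) (@continuous_sum_eval A _)).
have /connected_intervalP itv : connected (G @` [set: M]).
  by apply: connected_continuous_connected => //; exact: continuous_subspaceT.
have G01 m : G m = 0 \/ G m = 1.
  have Xx : X (set_val (h m)) by exact: set_valP.
  move: Xx; rewrite /G; set x := set_val (h m) => Xx; have [x0 x1 xF] := Xx.
  have [/existsP[a /andP[aA xa]]|nA] := boolP [exists a in A, x a != 0].
    right; rewrite -x1 [RHS](bigID (mem A)) /= [X in _ = _ + X]big1 ?addr0 // => b bA.
    apply/eqP; apply/negPn/negP => xb.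
    have bB : b \in B.
      have : b \in vertices D by apply: (face_vertex xF); rewrite inE.
      by rewrite VE inE (negbTE bA).
    by have /andP[/negP nadj nab] := AB a b aA bB; apply: nadj; exact: (support_adj Xx).
  left; apply: big1 => a aA; apply/eqP/negPn/negP => xa.
  by case/existsP: nA; exists a; rewrite aA.
have val v : v \in vertices D -> exists m, G m = g (pm v).
  move=> /vertex_realization Xv; exists (f (exist _ (pm v : {ptws V -> R}) (mem_set Xv))).
  by rewrite /G fh.
have [|ma ma1] := val a0; first by rewrite VE inE a0A.
have [|mb mb0] := val b0; first by rewrite VE inE b0B orbT.
have g1 : g (pm a0) = 1.
  by rewrite /g (bigD1 a0) //= /point_mass eqxx big1 ?addr0 // => i /andP[_ /negbTE ->].
have g0 : g (pm b0) = 0.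
  by rewrite /g big1 // => a aA; have /andP[_ /negbTE] := AB a b0 aA b0B; rewrite /point_mass => ->.
have [m _ m2] : (G @` [set: M]) 2^-1.
  apply: (itv 0 1); [by exists mb; rewrite // mb0|by exists ma; rewrite // ma1|].
  by apply/andP; split; lra.
have [/eqP|/eqP] := G01 m; rewrite m2 ?invr_eq0 ?invr_eq1 ?pnatr_eq0 //.
by rewrite (eqr_nat R 2 1).
Qed.
End SurfaceFacts.

(** * Contracting an edge by bistellar flips *)

Section Flips.
Context (R : realType) (V : finType).
Implicit Types (A B : {set V}) (T : set {set V}) (x : {ptws V -> R}).

(** A flip describes what happens to facets only, so the realization is expressed through a set of
    facets, without its lower-dimensional faces. *)
Definition facet_realization T : set {ptws V -> R} :=
  [set x | [/\ forall v, 0 <= x v, \sum_v x v = 1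
             & exists2 t, T t & forall v, x v != 0 -> v \in t]].

(** The default value [1] is harmless, since barycentric coordinates do not exceed it. *)
Definition min_on A x : R := \big[Num.min/1]_(a in A) x a.

Lemma min_on_continuous A : continuous (min_on A).
Proof.
apply: continuous_big => [z|a _ x]; last exact: (@continuous_eval V R a x).
exact: (@continuous_min R _ (@fst R R) (@snd R R) z cvg_fst cvg_snd).
Qed.

Lemma min_on_le A x a : a \in A -> min_on A x <= x a.
Proof. by move=> aA; exact: bigmin_le_cond. Qed.

Lemma min_on_eq A x k a : k <= 1 -> (forall b, b \in A -> k <= x b) -> a \in A -> x a = k ->
  min_on A x = k.
Proof.
move=> k1 kx aA xa; apply/le_anti/andP; split; first by rewrite -xa; exact: min_on_le.
exact: le_bigmin.
Qed.

Lemma min_on_attained A x a0 : a0 \in A -> (forall a, x a <= 1) -> exists2 a, a \in A & x a = min_on A x.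
Proof.
move=> aA x1; have [a aP e] := @eq_bigmin _ _ _ (1 : R) a0 (mem A) x aA (fun b _ => x1 b).
by exists a.
Qed.

Lemma realization_le1 x v : (forall v, 0 <= x v) -> \sum_v x v = 1 -> x v <= 1.
Proof. by move=> x0 <-; rewrite (bigD1 v) //= lerDl sumr_ge0. Qed.

(* The homeomorphism of a bistellar flip: the part common to the coordinates on [A]
   is spread over [B]. *)
Definition shift A B x : {ptws V -> R} := fun v =>
  x v - (v \in A)%:R * min_on A x + (v \in B)%:R * (min_on A x * #|A|%:R / #|B|%:R).

Lemma continuous_shift_coord (Z : topologicalType) (f g : Z -> R) (a b c d : R) :
  continuous f -> continuous g -> continuous (fun z => f z - a * g z + b * (g z * c / d)).
Proof.
move=> cf cg z; apply: cvgD.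
  by apply: cvgB; [exact: cf|apply: cvgM; [exact: cvg_cst|exact: cg]].
apply: cvgM; first exact: cvg_cst.
by apply: cvgM; [apply: cvgM; [exact: cg|exact: cvg_cst]|exact: cvg_cst].
Qed.

Lemma shift_continuous A B : continuous (shift A B).
Proof.
apply: continuous_ptws => v; apply: (@continuous_shift_coord _ (fun x => x v) (min_on A)).
  exact: (@continuous_eval V R v).
exact: min_on_continuous.
Qed.

(** The facets containing [A] are meant to be those of the join of [A] with the boundary of [B];
    they give way to the facets of the join of [B] with the boundary of [A]. *)
Definition flip A B T : set {set V} := [set t |
  T t /\ ~~ (A \subset t) \/ exists2 a, a \in A & t = ((A :|: B) :\ a)%SET].

Section Flip.
Context (A B : {set V}) (T : set {set V}) (a0 b0 : V).
Context (a0A : a0 \in A) (b0B : b0 \in B) (dAB : forall v, v \in A -> v \notin B).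
Context (TA : forall t, T t -> A \subset t -> exists2 b, b \in B & t = ((A :|: B) :\ b)%SET)
  (TB : forall t, T t -> ~~ (B \subset t)).

(** On a facet not containing [A] some coordinate on [A] is zero and the shift is the identity. On
    the others it annihilates the coordinate where the minimum over [A] is attained. No facet
    contains [B], so some coordinate on [B] is zero, the new minimum over [B] is exactly the amount
    added, and the reverse shift restores [x]. *)
Lemma shift_realization x : facet_realization T x ->
  facet_realization (flip A B T) (shift A B x) /\ shift B A (shift A B x) = x.
Proof.
move=> [x0 x1 [t Tt xt]]; have xle v : x v <= 1 by exact: realization_le1.
set m := min_on A x; have m0 : 0 <= m.
  have [a _ am] := min_on_attained a0A xle; rewrite /m -am; exact: x0.
have cA : (0 : R) < #|A|%:R by rewrite ltr0n card_gt0; apply/finset.set0Pn; exists a0.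
have cB : (0 : R) < #|B|%:R by rewrite ltr0n card_gt0; apply/finset.set0Pn; exists b0.
set k := m * #|A|%:R / #|B|%:R.
have k0 : 0 <= k by rewrite divr_ge0 ?mulr_ge0 // ltW.
have yA v : v \in A -> shift A B x v = x v - m.
  by move=> vA; rewrite /shift vA (negbTE (dAB vA)) mul1r mul0r addr0.
have yB v : v \in B -> shift A B x v = x v + k.
  move=> vB; have vA : v \notin A by apply/negP => /dAB; rewrite vB.
  by rewrite /shift vB (negbTE vA) mul1r mul0r subr0.
have y_out v : v \notin A -> v \notin B -> shift A B x v = x v.
  by move=> /negbTE vA /negbTE vB; rewrite /shift vA vB !mul0r subr0 addr0.
have y0 v : 0 <= shift A B x v.
  have [vA|vA] := boolP (v \in A); first by rewrite yA // subr_ge0 min_on_le.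
  by have [vB|vB] := boolP (v \in B); [rewrite yB // addr_ge0|rewrite y_out].
have y1 : \sum_v shift A B x v = 1.
  rewrite /shift big_split /= sumrB x1 -!mulr_suml.
  have cardE (S : {set V}) : \sum_v (v \in S)%:R = #|S|%:R :> R.
    rewrite -sum1_card natr_sum [RHS]big_mkcond /=.
    by apply: eq_bigr => v _; case: (v \in S).
  rewrite !cardE -/m; by field; rewrite gt_eqF.
have [b bB xb] : exists2 b, b \in B & x b = 0.
  have /fintype.subsetPn[b bB bt] := TB Tt; exists b => //.
  by apply/eqP; apply: contraNT bt => /xt.
have minB : min_on B (shift A B x) = k.
  apply: (min_on_eq _ _ bB); last by rewrite yB // xb add0r.
    have <- : shift A B x b = k by rewrite yB // xb add0r.
    exact: (@realization_le1 (shift A B x) b y0 y1).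
  by move=> v vB; rewrite yB // lerDr.
split; last first.
  apply/funext => v; rewrite {1}/shift minB.
  have -> : k * #|B|%:R / #|A|%:R = m by rewrite /k; field; rewrite !gt_eqF.
  have [vA|vA] := boolP (v \in A).
    by rewrite (negbTE (dAB vA)) yA // mul0r subr0 mul1r subrK.
  by have [vB|vB] := boolP (v \in B);
    [rewrite yB // mul1r mul0r addr0 addrK|rewrite y_out // !mul0r subr0 addr0].
split => //.
have [sub|nsub] := boolP (A \subset t); last first.
  exists t; first by left.
  have m_eq0 : m = 0.
    have /fintype.subsetPn[a aA a_t] := nsub; apply/le_anti; rewrite m0 andbT.
    have <- : x a = 0 by apply/eqP; apply: contraNT a_t => /xt.
    exact: min_on_le.
  move=> v; rewrite /shift -/m m_eq0 mulr0 !mul0r mulr0 subr0 addr0; exact: xt.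
have [a aA am] := min_on_attained a0A xle.
exists ((A :|: B) :\ a)%SET; first by right; exists a.
have [b' b'B tE] := TA Tt sub.
move=> v; rewrite !inE; apply: contra_neqT; rewrite negb_and negbK negb_or.
move=> /orP[/eqP->|/andP[vA vB]]; first by rewrite yA // am subrr.
rewrite y_out //; apply/eqP; have : v \notin t by rewrite tE !inE (negbTE vA) (negbTE vB) andbF.
by apply: contraNT => /xt.
Qed.
End Flip.

(** The flipped facets satisfy the same hypotheses with [A] and [B] exchanged, and the reverse flip
    leads back into [T]; hence [shift B A] is the inverse. *)
Lemma flip_homeomorphic A B T a0 b0 : a0 \in A -> b0 \in B -> (forall v, v \in A -> v \notin B) ->
  (forall t, T t -> A \subset t -> exists2 b, b \in B & t = ((A :|: B) :\ b)%SET) ->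
  (forall t, T t -> ~~ (B \subset t)) ->
  (forall b, b \in B -> T ((A :|: B) :\ b)%SET) ->
  homeomorphic (facet_realization T) (facet_realization (flip A B T)).
Proof.
move=> a0A b0B dAB TA TB Tb.
have dBA v : v \in B -> v \notin A by move=> vB; apply/negP => /dAB; rewrite vB.
have subD (C : {set V}) c : c \in C -> ~~ (C \subset ((A :|: B) :\ c)%SET).
  by move=> cC; apply/negP => /fintype.subsetP/(_ c cC); rewrite !inE eqxx.
have FA t : flip A B T t -> ~~ (A \subset t).
  by case=> [[]//|[a aA ->]]; exact: subD.
have FB t : flip A B T t -> B \subset t -> exists2 a, a \in A & t = ((B :|: A) :\ a)%SET.
  by case=> [[/TB/negbTE-> //]|[a aA ->] _]; exists a => //; rewrite finset.setUC.
have Fa a : a \in A -> flip A B T ((B :|: A) :\ a)%SET.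
  by move=> aA; right; exists a => //; rewrite finset.setUC.
have back : flip B A (flip A B T) `<=` T.
  move=> t [[[[]//|[a aA tE]] nB]|[b bB ->]]; last by rewrite finset.setUC; exact: Tb.
  case/negP: nB; rewrite tE; apply/fintype.subsetP => v vB; rewrite !inE vB orbT andbT.
  by apply: contraTneq vB => ->; exact: dAB.
apply: (@homeomorphic_sets _ _ _ _ (shift A B) (shift B A)).
- by move=> x /(shift_realization a0A b0B dAB TA TB)[].
- move=> y Yy; have [[y0 y1 [t Ft yt]] _] := shift_realization b0B a0A dBA FB FA Yy.
  by split => //; exists t => //; exact: back.
- by move=> x /(shift_realization a0A b0B dAB TA TB)[].
- by move=> y /(shift_realization b0B a0A dBA FB FA)[].
- by apply: continuous_subspaceT; exact: shift_continuous.
- by apply: continuous_subspaceT; exact: shift_continuous.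
Qed.
End Flips.

(** * Removing a vertex by a sequence of flips *)

Section Contraction.
Context (R : realType) (V : finType).
Implicit Types (T : set {set V}) (w c u : V).
Local Notation fr T := (@facet_realization R V T).

Definition triple (w : V) (p : V * V) : {set V} := [set w; p.1; p.2]%SET.

Lemma triple_swap w u v : triple w (u, v) = triple w (v, u).
Proof. by apply/finset.setP => x; rewrite !inE /= orbAC. Qed.

Lemma quad_minus w c u0 u1 : uniq [:: w; c; u0; u1] ->
  let Q := [set w; c; u0; u1]%SET in
  [/\ (Q :\ w)%SET = triple c (u0, u1), (Q :\ c)%SET = triple w (u0, u1),
      (Q :\ u0)%SET = triple w (c, u1) & (Q :\ u1)%SET = triple w (c, u0)].
Proof.
rewrite /= !inE !negb_or => /and4P[/and3P[wc wu0 wu1] /andP[cu0 cu1] u01 _].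
have ex (x y z : V) : y != z -> ~~ ((x == y) && (x == z)) by apply: contra => /andP[/eqP<- /eqP<-].
by split; apply/finset.setP => x; move: (ex x _ _ wc) (ex x _ _ wu0) (ex x _ _ wu1) (ex x _ _ cu0)
    (ex x _ _ cu1) (ex x _ _ u01); rewrite !inE /=;
  case: (x == w); case: (x == c); case: (x == u0); case: (x == u1).
Qed.

Lemma facet_realization_eq T T' : (forall t, T t <-> T' t) -> fr T = fr T'.
Proof. by move=> TT; congr (facet_realization _); apply/predeqP. Qed.

Lemma segments_cons (x y : V) s : segments x (y :: s) = (x, y) :: segments y s.
Proof. by []. Qed.

(* Induction on the link of [w]: the flip exchanging the edge [w u0] for [c u1]
   removes [u0] from it; once it is a triangle, the flip at [w] removes [w]. *)
Lemma contract_homeomorphic w c u0 u1 r T T' :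
  uniq [:: w, c, u0, u1 & r] ->
  (forall t, T t /\ w \in t <-> exists2 p, p \in segments c (rcons [:: u0, u1 & r] c) & t = triple w p) ->
  (forall t u, T t -> c \in t -> u \in t -> u \in [:: u0, u1 & r] -> u = u0 \/ u = last u1 r) ->
  (forall t, T t -> c \in t -> u0 \in t -> last u1 r \in t -> False) ->
  (forall t, T' t <-> T t /\ w \notin t \/
     exists2 p, p \in segments u0 (u1 :: r) & t = triple c p) ->
  homeomorphic (fr T) (fr T').
Proof.
elim: r u0 u1 T T' => [|u2 r IH] u0 u1 T T' un Tw Tc Tend T'P.
  have [wc wu0 wu1] : [/\ w != c, w != u0 & w != u1].
    by move: un; rewrite /= !inE !negb_or => /andP[/and3P[]].
  have [cu0 cu1 u01] : [/\ c != u0, c != u1 & u0 != u1].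
    by move: un; rewrite /= !inE !negb_or => /and4P[_ /andP[-> ->] -> _].
  have Ttri p : p \in segments c [:: u0; u1; c] -> T (triple w p).
    by move=> pI; apply: (proj1 (proj2 (Tw _) _)); exists p.
  have quad := quad_minus un.
  have AB : [set w; c; u0; u1]%SET = ([set w] :|: [set c; u0; u1])%SET by rewrite !finset.setUA.
  rewrite AB in quad; have [Qw Qc Q0 Q1] := quad.
  (* Here the link of [w] is the triangle on [c], [u0], [u1]: the three facets at [w] are replaced
     by this triangle, which by [Tend] was not contained in any facet. *)
  have flipE t : T' t <-> flip [set w] [set c; u0; u1] T t.
    rewrite T'P /flip /= finset.sub1set; split=> [[[]|[p]]|[[]|[a]]].
    - by left.
    - by rewrite inE => /eqP-> ->; right; exists w; [rewrite inE|rewrite Qw].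
    - by left.
    - by rewrite inE => /eqP-> ->; right; exists (u0, u1); [rewrite inE|rewrite Qw].
  rewrite (facet_realization_eq flipE).
  apply: (@flip_homeomorphic _ _ _ _ _ w c); rewrite ?inE ?eqxx //.
  - by move=> v; rewrite !inE => /eqP->; rewrite !negb_or wc wu0 wu1.
  - move=> t Tt; rewrite finset.sub1set => wt; have [h _] := Tw t.
    have [//|p pI ->] := h; move: pI; rewrite !inE => /or3P[]/eqP->.
    + by exists u1; rewrite ?inE ?eqxx ?orbT // Q1.
    + by exists c; rewrite ?inE ?eqxx // Qc.
    + by exists u0; rewrite ?inE ?eqxx ?orbT // Q0 triple_swap.
  - move=> t Tt; apply/negP => sub; apply: (Tend t Tt) => /=;
      by apply: (fintype.subsetP sub); rewrite !inE eqxx ?orbT.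
  - move=> b; rewrite !inE -orbA => /or3P[]/eqP->; [rewrite Qc|rewrite Q0 triple_swap|rewrite Q1];
      by apply: Ttri; rewrite !inE eqxx ?orbT.
have [wN cN u0N u1N] : [/\ w \notin [:: c, u0, u1, u2 & r], c \notin [:: u0, u1, u2 & r],
    u0 \notin [:: u1, u2 & r] & u1 \notin u2 :: r].
  by move: un; rewrite !cons_uniq => /and5P[-> -> -> -> _].
have un' : uniq [:: w, c, u1, u2 & r].
  apply: subseq_uniq un.
  exact: (cat_subseq (subseq_refl [:: w; c]) (subseq_cons [:: u1, u2 & r] u0)).
have [wc wu0 wu1] : [/\ w != c, w != u0 & w != u1].
  by move: wN; rewrite !inE !negb_or => /and4P[-> -> ->].
have [cu0 cu1] : c != u0 /\ c != u1 by move: cN; rewrite !inE !negb_or => /and3P[-> ->].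
have u01 : u0 != u1 by move: u0N; rewrite inE negb_or => /andP[].
have Ttri p : p \in segments c (rcons [:: u0, u1, u2 & r] c) -> T (triple w p).
  by move=> pI; apply: (proj1 (proj2 (Tw _) _)); exists p.
have lastI : last u2 r \in u2 :: r by exact: mem_last.
(* The vertex [u1] is neither [u0] nor the last one, so by [Tc] no facet contains [c u1] and the
   flip is admissible. It removes [u0] from the link of [w] and creates the first triangle of the
   fan at [c]. *)
pose T1 := flip [set w; u0]%SET [set c; u1]%SET T.
have uq : uniq [:: w; c; u0; u1].
  by rewrite /= !inE !negb_or wc wu0 wu1 cu0 cu1 u01.
have quad := quad_minus uq.
have AB : [set w; c; u0; u1]%SET = ([set w; u0] :|: [set c; u1])%SET.
  by apply/finset.setP => x; rewrite !inE -!orbA; congr (_ || _); rewrite orbCA.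
rewrite AB in quad; have [E1 E3 E2 E4] := quad.
have T1P t : T1 t <-> T t /\ ~~ ([set w; u0]%SET \subset t) \/ t = triple c (u0, u1) \/ t = triple w (c, u1).
  split=> [[h|[a + ->]]|[h|[->|->]]].
  - by left; exact: h.
  - by rewrite !inE => /orP[]/eqP->; right; rewrite ?E1 ?E2; [left|right].
  - by left; exact: h.
  - by right; exists w; rewrite ?inE ?eqxx // E1.
  - by right; exists u0; rewrite ?inE ?eqxx ?orbT // E2.
have rest p : p \in segments u1 (rcons (u2 :: r) c) -> u0 \notin triple w p.
  move=> /mem_segments/andP[p1 p2]; rewrite !inE !negb_or eq_sym wu0 /=.
  have u0n : u0 \notin u1 :: rcons (u2 :: r) c.
    have [_ u0N'] := norP u0N; rewrite in_cons mem_rcons in_cons.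
    by apply/norP; split => //; apply/norP; split => //; rewrite eq_sym.
  have {}p2 : p.2 \in u1 :: rcons (u2 :: r) c by rewrite inE p2 orbT.
  by apply/andP; split; apply: contraNneq u0n => ->.
have sub2 (t : {set V}) : ([set w; u0]%SET \subset t) = (w \in t) && (u0 \in t).
  by rewrite finset.subUset !finset.sub1set.
apply: (@homeomorphic_trans _ (fr T1)).
  apply: (@flip_homeomorphic _ _ _ _ _ w c); rewrite ?inE ?eqxx //.
  - by move=> v; rewrite !inE => /orP[]/eqP->; rewrite negb_or ?wc ?wu1 // eq_sym cu0 u01.
  - move=> t Tt; rewrite sub2 => /andP[wt u0t]; have [h _] := Tw t.
    have [//|p + tE] := h; rewrite !segments_cons !in_cons => /or3P[/eqP pE|/eqP pE|/rest].
    + by exists u1; rewrite ?inE ?eqxx ?orbT // E4 tE pE.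
    + by exists c; rewrite ?inE ?eqxx // E3 tE pE.
    + by rewrite -tE u0t.
  - move=> t Tt; apply/negP; rewrite finset.subUset !finset.sub1set => /andP[ct u1t].
    have [||e] := Tc t u1 Tt ct u1t; first by rewrite !inE eqxx orbT.
      by move=> e; move: u01; rewrite e eqxx.
    by move: u1N; rewrite e /= lastI.
  - move=> b; rewrite !inE => /orP[]/eqP->; rewrite ?E3 ?E4; apply: Ttri;
      by rewrite !segments_cons !in_cons eqxx ?orbT.
apply: (IH u1 u2 T1 T' un').
- move=> t; rewrite T1P; split.
    case=> [[[Tt nsub]|[->|->]] wt].
    + have [h _] := Tw t; have [//|p + tE] := h.
      rewrite !rcons_cons !segments_cons !in_cons => /or3P[/eqP pE|/eqP pE|pI].
      * by move: nsub; rewrite sub2 wt tE pE !inE eqxx orbT.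
      * by move: nsub; rewrite sub2 wt tE pE !inE eqxx orbT.
      * exists p => //.
        exact: (mem_behead (s := (c, u1) :: segments u1 (rcons (u2 :: r) c)) pI).
    + by move: wt; rewrite !inE (negbTE wc) (negbTE wu0) (negbTE wu1).
    + by exists (c, u1) => //; exact: mem_head.
  case=> p pI0 ->; have : p \in (c, u1) :: segments u1 (rcons (u2 :: r) c) by exact: pI0.
  rewrite in_cons => /orP[/eqP->|pI].
    by split; [right; right|rewrite !inE eqxx].
  split; last by rewrite !inE eqxx.
  left; split; last by rewrite sub2 (negbTE (rest p pI)) andbF.
  apply: Ttri.
  apply: (mem_behead (s := (c, u0) :: (u0, u1) :: segments u1 (rcons (u2 :: r) c))).
  exact: (mem_behead (s := (u0, u1) :: segments u1 (rcons (u2 :: r) c)) pI).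
- move=> t u; rewrite T1P => -[[Tt nsub]|[->|->]] ct ut uI.
  + have [|e|->] := Tc t u Tt ct ut; [by rewrite in_cons uI orbT| |by right].
    by move: u0N; rewrite -e uI.
  + move: ut; rewrite !inE /= -orbA => /or3P[]/eqP e; last by left.
      by move: cN; rewrite in_cons -e uI orbT.
    by move: u0N; rewrite -e uI.
  + move: ut; rewrite !inE /= -orbA => /or3P[]/eqP e; last by left.
      by move: wN; rewrite 2!in_cons -e uI !orbT.
    by move: cN; rewrite in_cons -e uI orbT.
- have lw : last u1 (u2 :: r) != w.
    by apply: contraNneq wN => <-; rewrite 3!in_cons /= lastI !orbT.
  have lc : last u1 (u2 :: r) != c.
    by apply: contraNneq cN => <-; rewrite 2!in_cons /= lastI !orbT.
  have lu0 : last u1 (u2 :: r) != u0.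
    by apply: contraNneq u0N => <-; rewrite in_cons /= lastI !orbT.
  have lu1 : last u1 (u2 :: r) != u1 by apply: contraNneq u1N => <-.
  move=> t; rewrite T1P => -[[Tt nsub]|[->|->]] ct u1t lt.
  + have [|e|e] := Tc t u1 Tt ct u1t; first by rewrite !inE eqxx orbT.
      by move: u01; rewrite e eqxx.
    by move: lu1; rewrite -e eqxx.
  + by move: lt; rewrite !inE /= (negbTE lc) (negbTE lu0) (negbTE lu1).
  + by move: lt; rewrite !inE /= (negbTE lw) (negbTE lc) (negbTE lu1).
- move=> t; rewrite T'P T1P segments_cons; split.
    case=> [[Tt wt]|[p]].
      by left; split => //; left; split => //; rewrite sub2 (negbTE wt).
    rewrite in_cons => /orP[/eqP->|pI] ->; last by right; exists p.
    by left; split; [right; left|rewrite !inE (negbTE wc) (negbTE wu0) (negbTE wu1)].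
  case=> [[[[Tt _]|[->|->]] wt]|[p pI ->]].
  + by left.
  + by right; exists (u0, u1) => //; rewrite in_cons eqxx.
  + by move: wt; rewrite !inE eqxx.
  + by right; exists p => //; rewrite in_cons pI orbT.
Qed.
End Contraction.

(** * The octahedron *)

Lemma continuous_ptws_at (Z : topologicalType) (I : Type) (T : topologicalType)
    (k : Z -> {ptws I -> T}) z :
  (forall i, {for z, continuous (fun z => k z i)}) -> {for z, continuous k}.
Proof.
move=> ck; apply/cvg_sup => i U [B [[W oW <-] /= Wk] WU].
have : \forall z' \near z, W (k z' i) by apply: ck; exact: open_nbhs_nbhs.
by apply: filterS => z' ?; exact: WU.
Qed.

Lemma continuous_scaled_max (R : realType) (Z : topologicalType) (f g : Z -> R) (k l : R) :
  continuous f -> continuous g ->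
  continuous (fun z => k * Num.max (f z) 0 + l * Num.max (g z) 0).
Proof.
move=> cf cg z; apply: cvgD; (apply: cvgM; first exact: cvg_cst).
  exact: (@continuous_max R Z f (fun=> 0) z (cf z) (cvg_cst _)).
exact: (@continuous_max R Z g (fun=> 0) z (cg z) (cvg_cst _)).
Qed.

Section Octahedron.
Context (R : realType) (V : finType) (a b : 'I_3 -> V).
Context (a_inj : injective a) (b_inj : injective b) (ab : forall i j, a i != b j).

Definition octahedron : set {ptws V -> R} := [set x |
  [/\ forall v, 0 <= x v, \sum_i (x (a i) + x (b i)) = 1,
      forall i, x (a i) = 0 \/ x (b i) = 0
    & forall v, (forall i, v != a i /\ v != b i) -> x v = 0]].

Definition oct_row (x : {ptws V -> R}) : 'rV[R]_3 := \row_i (x (a i) - x (b i)).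

Definition norm2 (y : 'rV[R]_3) : R := Num.sqrt (\sum_i y 0 i ^+ 2).

Definition norm1 (y : 'rV[R]_3) : R := \sum_i `|y 0 i|.

Definition oct_to_sphere (x : {ptws V -> R}) : 'rV[R]_3 := (norm2 (oct_row x))^-1 *: oct_row x.

Definition sphere_to_oct (y : 'rV[R]_3) : {ptws V -> R} := fun v =>
  (\sum_i ((v == a i)%:R * Num.max (y 0 i) 0 + (v == b i)%:R * Num.max (- y 0 i) 0)) / norm1 y.

Lemma sphere_to_oct_a y i : sphere_to_oct y (a i) = Num.max (y 0 i) 0 / norm1 y.
Proof.
rewrite /sphere_to_oct (bigD1 i) //= eqxx (negbTE (ab i i)) mul1r mul0r addr0 big1 ?addr0 //.
by move=> j ji; rewrite (inj_eq a_inj) eq_sym (negbTE ji) (negbTE (ab i j)) !mul0r addr0.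
Qed.

Lemma sphere_to_oct_b y i : sphere_to_oct y (b i) = Num.max (- y 0 i) 0 / norm1 y.
Proof.
rewrite /sphere_to_oct (bigD1 i) //= eqxx eq_sym (negbTE (ab i i)) mul1r mul0r add0r big1 ?addr0 //.
by move=> j ji; rewrite (inj_eq b_inj) (eq_sym (b i) (a j)) (negbTE (ab j i)) (eq_sym i) (negbTE ji) !mul0r addr0.
Qed.

Lemma sphere_to_oct_out y v : (forall i, v != a i /\ v != b i) -> sphere_to_oct y v = 0.
Proof.
move=> h; rewrite /sphere_to_oct big1 ?mul0r // => i _.
by have [/negbTE-> /negbTE->] := h i; rewrite !mul0r addr0.
Qed.

Lemma octahedron_norm x : octahedron x -> forall i, `|oct_row x 0 i| = x (a i) + x (b i).
Proof.
move=> [x0 _ xab _] i; rewrite mxE; have [->|->] := xab i.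
  by rewrite sub0r normrN add0r ger0_norm.
by rewrite subr0 addr0 ger0_norm.
Qed.

Lemma norm2_gt0 (y : 'rV[R]_3) i : y 0 i != 0 -> 0 < norm2 y.
Proof.
move=> yi; rewrite sqrtr_gt0 (bigD1 i) //=; apply: ltr_pwDl; last first.
  by apply: sumr_ge0 => j _; exact: sqr_ge0.
by rewrite lt_neqAle sqr_ge0 eq_sym sqrf_eq0 yi.
Qed.

Lemma norm2_scale k y : 0 <= k -> norm2 (k *: y) = k * norm2 y.
Proof.
move=> k0; rewrite /norm2; under eq_bigr do rewrite mxE exprMn.
by rewrite -mulr_sumr sqrtrM ?sqr_ge0 // sqrtr_sqr ger0_norm.
Qed.

Lemma norm1_scale k y : 0 <= k -> norm1 (k *: y) = k * norm1 y.
Proof.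
by move=> k0; rewrite /norm1 mulr_sumr; apply: eq_bigr => i _; rewrite mxE normrM ger0_norm.
Qed.

Lemma oct_norm2_gt0 x : octahedron x -> 0 < norm2 (oct_row x).
Proof.
move=> Ox; have [x0 x1 _ _] := Ox.
have [i yi] : exists i, oct_row x 0 i != 0.
  apply: contrapT => /forallNP h; move: x1; rewrite big1 => [/esym/eqP|i _].
    by rewrite oner_eq0.
  by rewrite -octahedron_norm //; apply/eqP; rewrite normr_eq0; apply/negPn/negP; exact: h.
exact: norm2_gt0 yi.
Qed.

Lemma sphere_norm2 y : sphere2 R y -> norm2 y = 1.
Proof. by rewrite /sphere2 /= /norm2 => ->; rewrite sqrtr1. Qed.

Lemma norm1_gt0 y : sphere2 R y -> 0 < norm1 y.
Proof.
move=> Sy; rewrite lt_neqAle sumr_ge0 ?andbT; last by move=> i _; exact: normr_ge0.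
rewrite eq_sym psumr_eq0; last by move=> i _; exact: normr_ge0.
apply/negP => /allP h; move: Sy; rewrite /sphere2 /= big1 => [/esym/eqP|i _].
  by rewrite oner_eq0.
by have := h i (mem_index_enum _); rewrite normr_eq0 => /eqP->; rewrite expr0n.
Qed.

Lemma max_pos (r : R) : Num.max r 0 + Num.max (- r) 0 = `|r|.
Proof.
have [r0|r0] : 0 <= r \/ r <= 0 by apply/orP; exact: le_total.
  by rewrite max_l // max_r ?addr0 ?ger0_norm // oppr_le0.
by rewrite max_r // add0r max_l ?ler0_norm // oppr_ge0.
Qed.

Lemma max_sub (r : R) : Num.max r 0 - Num.max (- r) 0 = r.
Proof.
have [r0|r0] : 0 <= r \/ r <= 0 by apply/orP; exact: le_total.
  by rewrite max_l // max_r ?subr0 // oppr_le0.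
by rewrite max_r // sub0r max_l ?opprK // oppr_ge0.
Qed.

Lemma sphere_to_octP y : sphere2 R y -> octahedron (sphere_to_oct y).
Proof.
move=> Sy; have n0 := norm1_gt0 Sy; split.
- move=> v; rewrite divr_ge0 ?(ltW n0) // sumr_ge0 // => i _.
  by rewrite addr_ge0 // mulr_ge0 // le_max lexx orbT.
- under eq_bigr do rewrite sphere_to_oct_a sphere_to_oct_b -mulrDl max_pos.
  by rewrite -mulr_suml divff // gt_eqF.
- move=> i; rewrite sphere_to_oct_a sphere_to_oct_b; have [y0|y0] : 0 <= y 0 i \/ y 0 i <= 0 by apply/orP; exact: le_total.
    by right; rewrite max_r ?mul0r // oppr_le0.
  by left; rewrite max_r ?mul0r.
- exact: sphere_to_oct_out.
Qed.

Lemma oct_row_sphere_to_oct y : oct_row (sphere_to_oct y) = (norm1 y)^-1 *: y.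
Proof.
apply/rowP => i; rewrite !mxE sphere_to_oct_a sphere_to_oct_b -mulrBl max_sub.
by rewrite mulrC.
Qed.

Lemma octahedron_ext x x' : octahedron x -> octahedron x' ->
  (forall i, x (a i) = x' (a i)) -> (forall i, x (b i) = x' (b i)) -> x = x'.
Proof.
move=> [_ _ _ xo] [_ _ _ xo'] ha hb; apply/funext => v.
have [/existsP[i /orP[/eqP->|/eqP->]]|h] := boolP [exists i, (v == a i) || (v == b i)]; rewrite ?ha ?hb //.
have out i : v != a i /\ v != b i.
  by apply/andP; rewrite -negb_or; apply: contra h => vi; apply/existsP; exists i.
by rewrite xo // xo'.
Qed.

Lemma continuous_sum (Z : topologicalType) (I : finType) (f : I -> Z -> R) :
  (forall i, continuous (f i)) -> continuous (fun z => \sum_i f i z).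
Proof. by move=> cf; apply: continuous_big => //; exact: add_continuous. Qed.

Lemma norm1_continuous : continuous norm1.
Proof.
apply: continuous_sum => i y; have cc := @coord_continuous R 1 3 0 i.
exact: (@continuous_comp _ _ _ _ (@Num.norm R R) y (cc y) (@norm_continuous R R _)).
Qed.

Lemma norm2_continuous : continuous norm2.
Proof.
have c : continuous (fun y : 'rV[R]_3 => \sum_i y 0 i ^+ 2).
  apply: continuous_sum => i.
  rewrite (_ : (fun y : 'rV[R]_3 => y 0 i ^+ 2) = fun y => y 0 i * y 0 i); last first.
    by apply/funext => y; rewrite expr2.
  have cc := @coord_continuous R 1 3 0 i.
  by move=> y; exact: (@continuousM R _ _ _ y (cc y) (cc y)).
by move=> y; exact: (@continuous_comp _ _ _ _ (@Num.sqrt R) y (c y) (@sqrt_continuous R _)).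
Qed.

Lemma normalize_continuous (y : 'rV[R]_3) : 0 < norm2 y ->
  {for y, continuous (fun y => (norm2 y)^-1 *: y)}.
Proof.
move=> n0; have cv : {for y, continuous (fun y => (norm2 y)^-1)}.
  by apply: continuousV; [rewrite gt_eqF|exact: norm2_continuous].
exact: (cvgZ cv cvg_id).
Qed.

(** In the coordinates [x (a i) - x (b i)] the octahedron is the unit sphere of [norm1], and radial
    projection maps it to the unit sphere of [norm2]. *)
Lemma octahedron_homeomorphic_sphere : homeomorphic octahedron (sphere2 R).
Proof.
have toS x : octahedron x -> sphere2 R (oct_to_sphere x).
  move=> Ox; have n0 := oct_norm2_gt0 Ox.
  rewrite /sphere2 /=; under eq_bigr do rewrite mxE exprMn.
  rewrite -mulr_sumr; have sq : norm2 (oct_row x) ^+ 2 = \sum_i oct_row x 0 i ^+ 2.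
    by rewrite sqr_sqrtr // sumr_ge0 // => i _; exact: sqr_ge0.
  by rewrite -sq -exprMn mulVf ?expr1n // gt_eqF.
apply: (@homeomorphic_sets _ _ _ _ oct_to_sphere sphere_to_oct) => //.
- by move=> y; exact: sphere_to_octP.
- move=> x Ox; have n0 := oct_norm2_gt0 Ox; have [x0 x1 xab xout] := Ox.
  have e1 : norm1 (oct_to_sphere x) = (norm2 (oct_row x))^-1.
    rewrite /oct_to_sphere norm1_scale ?invr_ge0 ?ltW // -[RHS]mulr1; congr (_ * _).
    by rewrite -x1; apply: eq_bigr => i _; exact: octahedron_norm.
  have ei i (s : R) : Num.max (s * oct_to_sphere x 0 i) 0 / norm1 (oct_to_sphere x) =
      Num.max (s * oct_row x 0 i) 0.
    have k0 : 0 <= (norm2 (oct_row x))^-1 by rewrite invr_ge0 ltW.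
    rewrite e1 invrK /oct_to_sphere [in LHS]mxE mulrCA -[X in Num.max _ X](mulr0 (norm2 (oct_row x))^-1).
    by rewrite -maxr_pMr // mulrAC mulVf ?mul1r // gt_eqF.
  apply: octahedron_ext => //; first by apply: sphere_to_octP; exact: toS.
    move=> i; rewrite sphere_to_oct_a; have := ei i 1; rewrite !mul1r => ->.
    rewrite mxE; have [->|->] := xab i; rewrite ?sub0r ?subr0.
      by rewrite max_r // oppr_le0.
    by rewrite max_l.
  move=> i; rewrite sphere_to_oct_b; have := ei i (-1); rewrite !mulN1r => ->.
  rewrite mxE opprB; have [->|->] := xab i; rewrite ?sub0r ?subr0.
    by rewrite max_l.
  by rewrite max_r // oppr_le0.
- move=> y Sy; have n0 := norm1_gt0 Sy; rewrite /oct_to_sphere oct_row_sphere_to_oct.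
  rewrite norm2_scale ?invr_ge0 ?ltW // sphere_norm2 // mulr1 invrK scalerA divff ?scale1r //.
  by rewrite gt_eqF.
- apply: continuous_in_subspaceT => x; rewrite inE => Ox.
  have coord i : continuous (fun x : {ptws V -> R} => oct_row x 0 i).
    rewrite (_ : (fun x => _) = fun x : {ptws V -> R} => x (a i) - x (b i)); last first.
      by apply/funext => z; rewrite mxE.
    by move=> z; exact: (@continuousB _ _ _ _ _ z (@continuous_eval V R (a i) z) (@continuous_eval V R (b i) z)).
  have crow : continuous oct_row.
    by apply: continuous_matrix => i j; rewrite ord1; exact: coord.
  apply: (@continuous_comp _ _ _ oct_row (fun y => (norm2 y)^-1 *: y)); first exact: crow.
  apply: normalize_continuous; exact: oct_norm2_gt0.
- apply: continuous_in_subspaceT => y; rewrite inE => Sy.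
  suff : {for y, continuous (sphere_to_oct : 'rV[R]_3 -> {ptws V -> R})} by [].
  apply: continuous_ptws_at => v; apply: cvgM; last first.
    by apply: (@continuousV _ _ norm1); [rewrite gt_eqF // norm1_gt0|exact: norm1_continuous].
  apply: continuous_sum => i; have cc := @coord_continuous R 1 3 0 i.
  have cN : continuous (fun y : 'rV[R]_3 => - y 0 i) by move=> w; exact: (continuousN (cc w)).
  by apply: (@continuous_scaled_max R _ (fun z : 'rV[R]_3 => z 0 i) (fun z => - z 0 i)).
Unshelve. all: exact: (nbhs_filter y).
Qed.
End Octahedron.

(** * Edge contraction in a flag triangulation *)

Lemma next_neq_prev (T : eqType) (s : seq T) y :
  uniq s -> (2 < size s)%N -> y \in s -> next s y != prev s y.
Proof.
move=> us s2 ys; have [i q rE] := rot_to ys.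
rewrite -(next_rot i us) -(prev_rot i us) rE.
have : uniq (y :: q) by rewrite -rE rot_uniq.
have : (2 < size (y :: q))%N by rewrite -rE size_rot.
case: q {rE} => [|a [|b q]] // _; rewrite cons_uniq => /andP[yq /andP[aq _]].
rewrite prev_nth mem_head memNindex //= eqxx (nth_last y (b :: q)) /=.
by apply: contraNneq aq => ->; exact: mem_last.
Qed.

(** * Finite connected 2-regular graphs are cycles *)

Section CycleList.
Context (T : finType) (N : {set T}) (e : rel T).
Context (e_sym : symmetric e) (e_irr : irreflexive e).
Context (deg2 : forall x, x \in N -> #|[set y in N | e x y]| = 2%N).
Context (conn : forall A B : {set T}, N = (A :|: B)%SET -> A != finset.set0 -> B != finset.set0 ->
  (forall a b, a \in A -> b \in B -> ~~ e a b && (a != b)) -> False).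

Let nb x := [set y in N | e x y]%SET.

Let nb_eq x y z : x \in N -> y \in nb x -> z \in nb x -> y != z -> nb x = [set y; z]%SET.
Proof.
move=> xN yx zx yz; apply/esym/eqP; rewrite eqEcard cards2 yz deg2 // leqnn andbT.
by apply/fintype.subsetP => t; rewrite in_set2 => /orP[]/eqP->.
Qed.

Let nb_other x y : x \in N -> exists2 z, z \in nb x & z != y.
Proof.
move=> xN; have /eqP/cards2P[a [b [ab E]]] := deg2 xN.
have [ay|ay] := eqVneq a y; last by exists a; rewrite // /nb E in_set2 eqxx.
by exists b; rewrite ?/nb ?E ?in_set2 ?eqxx ?orbT // -ay eq_sym.
Qed.

(* A longest path closes up to a cycle, which is a component. *)
Lemma cycle_list x0 : x0 \in N -> exists s, [/\ uniq s, s =i N, cycle e s, (2 < size s)%N &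
  forall x y, x \in N -> y \in N -> e x y -> y = next s x \/ y = prev s x].
Proof.
move=> x0N.
pose P n := [exists t : n.-tuple T, if val t is x :: p then [&& uniq (x :: p), path e x p & all (mem N) (x :: p)] else false].
have P1 : P 1 by apply/existsP; exists [tuple x0]; rewrite /= x0N.
have Pb n : P n -> (n <= #|T|)%N.
  move=> /existsP[[s /= /eqP <-]]; case: s => // x p /and3P[u _ _].
  by rewrite -(card_uniqP (u : uniq (x :: p))) max_card.
have [n /existsP[[s /= /eqP sn]]] := ex_maxnP (ex_intro P 1 P1) Pb.
case: s sn => // x p sn /and3P[up pp pN] nmax.
have {}up : uniq (x :: p) by [].
have {}pN : all (mem N) (x :: p) by [].
have ext s : uniq s -> (if s is x :: p then path e x p && all (mem N) (x :: p) else false) ->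
    (size s <= (size p).+1)%N.
  case: s => // y q uq /andP[pq qN]; rewrite -[X in (_ <= X)%N]/(size (x :: p)) sn; apply: nmax; apply/existsP.
  by exists (in_tuple (y :: q)); apply/and3P.
have xN : x \in N by case/andP: pN.
have lN y : y \in x :: p -> y \in N by move: y; apply/allP.
have endN y : y \in nb (last x p) -> y \in x :: p.
  rewrite inE => /andP[yN ey]; apply: contraT => yp.
  have := ext (rcons (x :: p) y); rewrite rcons_uniq yp up /= rcons_path pp ey /=.
  by rewrite all_rcons /= yN -/(all (mem N) (x :: p)) pN size_rcons ltnn => /(_ isT isT).
have nthN i : (i < (size p).+1)%N -> nth x (x :: p) i \in N.
  by move=> ip; apply: lN; rewrite mem_nth.
have inner i : (0 < i < size p)%N ->
    nb (nth x (x :: p) i) = [set nth x (x :: p) i.-1; nth x (x :: p) i.+1]%SET.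
  case: i => // i /andP[_ ip].
  have i1 : (i.+1 < (size p).+1)%N by rewrite ltnS ltnW.
  have ep j : (j < size p)%N -> e (nth x (x :: p) j) (nth x (x :: p) j.+1) by move=> jp; exact: (pathP x pp).
  apply: nb_eq.
  - exact: nthN.
  - by rewrite inE nthN ?ltnS ?(ltnW (ltnW ip)) //= e_sym ep // ltnW.
  - by rewrite inE nthN //; exact: ep.
  - by rewrite nth_uniq //=; lia.
have zN : last x p \in N by apply: lN; exact: mem_last.
pose k := size p; have lastE : last x p = nth x (x :: p) k by rewrite (last_nth x).
(* By maximality the other neighbour of the last vertex is on the path. An inner vertex of the path
   has both its neighbours next to it, so it would have to be the penultimate vertex, which is
   excluded; hence it is the first one. *)
have closed : e (last x p) x.
  have [y yz yk] := nb_other (nth x (x :: p) k.-1) zN.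
  have yp := endN _ yz; pose j := index y (x :: p).
  have yE : y = nth x (x :: p) j by rewrite nth_index.
  have jk : (j < k.+1)%N by rewrite /j index_mem.
  have ez : e (last x p) y by move: yz; rewrite inE => /andP[].
  case: (posnP j) => [j0|j0]; first by move: ez; rewrite yE j0.
  have jk' : (j < k)%N.
    rewrite ltn_neqAle -ltnS jk andbT; apply/negP => /eqP jk0.
    by move: ez; rewrite yE jk0 -lastE e_irr.
  have := inner j; rewrite j0 jk' -yE => /(_ isT) nbE.
  have : last x p \in nb y by rewrite inE zN e_sym ez.
  rewrite nbE in_set2 lastE !nth_uniq ?ltnSn //; last exact: leq_ltn_trans (leq_pred j) jk.
  move=> /orP[]/eqP kE.
    by move: jk'; rewrite kE ltnNge leq_pred.
  by move: yk; rewrite kE /= -yE eqxx.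
have cyc : cycle e (x :: p) by rewrite /= rcons_path pp closed.
have size2 : (2 < size (x :: p))%N.
  have sub : (nb (last x p) \subset [set y in x :: p] :\ last x p)%SET.
    apply/fintype.subsetP => y yz; rewrite !inE -in_cons endN // andbT.
    by apply: contraTneq yz => ->; rewrite inE e_irr andbF.
  have := subset_leq_card sub; rewrite deg2 // => c2.
  have := cardsD1 (last x p) [set y in x :: p]%SET; rewrite inE mem_last add1n => cE.
  have : #|[set y in x :: p]%SET| = size (x :: p) by rewrite cardsE; exact/card_uniqP.
  by rewrite cE => <-; rewrite ltnS.
have nbE y : y \in x :: p -> nb y = [set next (x :: p) y; prev (x :: p) y]%SET.
  move=> yp; apply: nb_eq; first exact: lN.
  - by rewrite inE lN ?mem_next //; exact: next_cycle.
  - by rewrite inE lN ?mem_prev // e_sym; exact: prev_cycle.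
  - exact: next_neq_prev.
have full : x :: p =i N.
  move=> y; apply/idP/idP => [/lN//|yN]; apply: contraT => yp; exfalso.
  have NE : N = ([set z in x :: p] :|: N :\: [set z in x :: p])%SET.
    by apply/finset.setP => z; rewrite finset.in_setU finset.in_setD finset.in_set; case: (boolP (z \in x :: p)) => [/lN->|].
  apply: (conn NE).
  - by apply/finset.set0Pn; exists x; rewrite inE mem_head.
  - by apply/finset.set0Pn; exists y; rewrite !inE yp.
  - move=> a b; rewrite finset.in_setD !finset.in_set => ap /andP[bp bN]; apply/andP; split; last first.
      by apply: contraNneq bp => <-.
    apply/negP => eab; have : b \in nb a by rewrite inE bN.
    by rewrite nbE // in_set2 => /orP[]/eqP bE; move: bp; rewrite bE ?mem_next ?mem_prev ap.
exists (x :: p); split => // a b aN bN eab.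
have : b \in nb a by rewrite inE bN.
by rewrite nbE ?full // in_set2 => /orP[]/eqP->; [left|right].
Qed.

Lemma cycle_list_from x : x \in N -> exists s, [/\ uniq (x :: s), x :: s =i N, (1 < size s)%N &
  forall y z, y \in N -> z \in N -> e y z = (z == next (x :: s) y) || (y == next (x :: s) z)].
Proof.
move=> xN; have [s [us sN cs s2 sE]] := cycle_list xN.
have xs : x \in s by rewrite sN.
have [i q rE] := rot_to xs; exists q; rewrite -rE.
split; first by rewrite rot_uniq.
- by move=> y; rewrite mem_rot.
- by rewrite -ltnS -[(size q).+1]/(size (x :: q)) -rE size_rot.
move=> y z yN zN; rewrite !next_rot //; apply/idP/orP => [/(sE _ _ yN zN)[]->|[]/eqP->].
- by left.
- by right; rewrite next_prev.
- by apply: next_cycle; rewrite ?sN.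
- by rewrite e_sym; apply: next_cycle; rewrite ?sN.
Qed.
End CycleList.

Lemma mem_segments_next (T : eqType) (y : T) p q : uniq (y :: p) ->
  (q \in segments y (rcons p y)) = (q.1 \in y :: p) && (q.2 == next (y :: p) q.1).
Proof.
rewrite /next; move: {3 5}y => y0; elim: p y => [|z p IH] y.
  move=> _; rewrite /segments /= !inE -pair_eqE /pair_eq /=.
  by case: q => a b /=; case: (a == y).
rewrite cons_uniq => /andP[yz uz]; have -> : segments y (rcons (z :: p) y0) = (y, z) :: segments z (rcons p y0) by [].
rewrite [LHS](in_cons (y, z)) (IH z) // [X in _ = X && _]in_cons.
rewrite -pair_eqE /pair_eq /=; have [qy|qy] := eqVneq q.1 y; last by [].
by rewrite qy (negPf yz) /= orbF.
Qed.

(** * Clique complexes and triangles *)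

Definition triangle (V : finType) (e : rel V) : set {set V} :=
  [set t | exists x y z, [/\ e x y, e x z, e y z & t = [set x; y; z]%SET]].

Section CliqueComplex.
Context (V : finType) (U : {set V}) (e : rel V) (e_sym : symmetric e).

Definition cliques : {set {set V}} :=
  [set s : {set V} | (s \subset U) && [forall x in s, forall y in s, (x != y) ==> e x y]]%SET.

Lemma cliquesP (s : {set V}) :
  reflect (s \subset U /\ {in s &, forall x y, x != y -> e x y}) (s \in cliques).
Proof.
rewrite inE; apply: (iffP andP) => -[sU h]; split => //.
  by move=> x y xs ys; move/forall_inP/(_ x xs)/forall_inP/(_ y ys)/implyP: h.
by apply/forall_inP => x xs; apply/forall_inP => y ys; apply/implyP; exact: h.
Qed.

Lemma cliques0 : finset.set0 \in cliques.
Proof. by apply/cliquesP; split=> [|x y]; rewrite ?finset.sub0set // inE. Qed.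

Lemma cliques_sub (s t : {set V}) : s \in cliques -> t \subset s -> t \in cliques.
Proof.
move=> /cliquesP[sU h] ts; apply/cliquesP; split; first exact: fintype.subset_trans sU.
by move=> x y /(fintype.subsetP ts) xs /(fintype.subsetP ts) ys; exact: h.
Qed.

Definition clique_complex : simplicial_complex V := SimplicialComplex cliques0 cliques_sub.

Lemma vertices_clique_complex : vertices clique_complex = U.
Proof.
apply/finset.setP => v; rewrite inE; apply/cliquesP/idP => [[]|vU]; first by rewrite finset.sub1set.
split=> [|x y]; first by rewrite finset.sub1set.
by rewrite !inE => /eqP-> /eqP->; rewrite eqxx.
Qed.

Lemma adj_clique_complex x y : adj clique_complex x y = [&& x != y, x \in U, y \in U & e x y].
Proof.
rewrite /adj; case: (boolP (x == y)) => //= xy; apply/cliquesP/and3P.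
  rewrite finset.subUset !finset.sub1set => -[/andP[xU yU] h]; split => //.
  by apply: h; rewrite ?inE ?eqxx ?orbT.
move=> [xU yU exy]; rewrite finset.subUset !finset.sub1set xU yU; split => // a b.
by rewrite !inE => /orP[]/eqP-> /orP[]/eqP->; rewrite ?eqxx // e_sym.
Qed.

(** A non-face contains a nonadjacent pair, which is itself a non-face; minimality leaves nothing
    else. *)
Lemma flag_clique_complex : flag clique_complex.
Proof.
move=> s [sV sF sP]; rewrite vertices_clique_complex in sV.
have [x xs [y ys [xy nxy]]] : exists2 x, x \in s & exists2 y, y \in s & x != y /\ ~~ e x y.
  move: sF; rewrite inE sV /= => /forall_inPn[x xs /forall_inPn[y ys]].
  by rewrite negb_imply => /andP[xy nxy]; exists x => //; exists y.
have sub : [set x; y]%SET \subset s by rewrite finset.subUset !finset.sub1set xs ys.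
have -> : s = [set x; y]%SET.
  apply/eqP; rewrite eq_sym; apply: contraT => ne.
  have px : [set x; y]%SET \proper s by rewrite finset.properEneq ne sub.
  have /cliquesP[_ h] := sP _ px; case/negP: nxy.
  by apply: h; rewrite // !inE eqxx ?orbT.
by rewrite cards2 xy.
Qed.
End CliqueComplex.

Lemma triangle_adj (V : finType) (e : rel V) (t : {set V}) x y : symmetric e ->
  triangle e t -> x \in t -> y \in t -> x != y -> e x y.
Proof.
move=> es [a [b [c [ab ac bc ->]]]]; rewrite !inE -!orbA.
by move=> /or3P[]/eqP-> /or3P[]/eqP->; rewrite ?eqxx // es.
Qed.

Lemma triangle_at (V : finType) (e : rel V) (t : {set V}) x : symmetric e ->
  triangle e t -> x \in t -> exists y z, [/\ e x y, e x z, e y z & t = [set x; y; z]%SET].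
Proof.
move=> es [a [b [c [ab ac bc ->]]]]; rewrite !inE -!orbA => /or3P[]/eqP->.
- by exists b, c.
- have -> : [set a; b; c]%SET = [set b; a; c]%SET by rewrite [[set a; b]%SET]finset.setUC.
  by exists a, c; rewrite es.
- have -> : [set a; b; c]%SET = [set c; a; b]%SET by rewrite finset.setUC finset.setUA.
  by exists a, b; rewrite es (es c).
Qed.

(** The complex is purely 2-dimensional: a support has at most three vertices, and a smaller one is
    completed to a triangle by a neighbour and a common neighbour. *)
Lemma realization_triangles (R : realType) (V : finType) (D : simplicial_complex V) : flag D ->
  (forall a b c d, adj D a b -> adj D a c -> adj D a d -> adj D b c -> adj D b d -> adj D c d -> False) ->
  (forall u, u \in vertices D -> exists v, adj D u v) ->
  (forall u v, adj D u v -> exists w, adj D u w /\ adj D v w) ->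
  realization D R = facet_realization (triangle (adj D)).
Proof.
move=> fl K4 nb com; apply/predeqP => x; split=> [[x0 x1 sF]|[x0 x1 [t [a [b [c [ab ac bc ->]]]] xt]]].
  split => //; set s := [set v | x v != 0]%SET in sF.
  have sP v : x v != 0 -> v \in s by rewrite inE.
  have [a as_] : exists a, a \in s.
    apply/existsP; apply: contraT; rewrite negb_exists => /forallP none.
    have : \sum_v x v = 0.
      by apply: big1 => v _; have := none v; rewrite inE negbK => /eqP.
    by rewrite x1 => /eqP; rewrite oner_eq0.
  have aV := face_vertex sF as_.
  have sadj u v : u \in s -> v \in s -> u != v -> adj D u v by exact: face_adj.
  have [b [ab sab]] : exists b, adj D a b /\ ((b \in s) \/ s = [set a]%SET).
    case: (pickP (fun b => (b \in s) && (b != a))) => [b /andP[bs ba]|none].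
      by exists b; split; [apply: sadj; rewrite // eq_sym|left].
    have [b ab] := nb _ aV; exists b; split => //; right; apply/finset.setP => v; rewrite finset.in_set1.
    by apply/idP/eqP => [vs|->//]; have := none v; rewrite vs /= => /eqP.
  have [c [ac bc sabc]] : exists c, [/\ adj D a c, adj D b c & forall v, v \in s -> [|| v == a, v == b | v == c]].
    case: (pickP (fun c => [&& c \in s, c != a & c != b])) => [c /and3P[cs ca cb]|none].
      case: sab => [bs|sE]; last by move: ca; rewrite sE finset.in_set1 in cs *; rewrite cs.
      exists c; split; [by apply: sadj; rewrite // eq_sym|by apply: sadj; rewrite // eq_sym|].
      move=> v vs; apply: contraT; rewrite !negb_or => /and3P[va vb vc]; exfalso.
      by apply: (@K4 a b c v) => //; apply: sadj; rewrite // eq_sym.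
    have [c [ac bc]] := com _ _ ab; exists c; split => // v vs.
    by have := none v; rewrite vs /=; case: (v == a); case: (v == b).
  exists [set a; b; c]%SET; first by exists a, b, c.
  by move=> v /sP/sabc; rewrite !inE -orbA.
have F : [set a; b; c]%SET \in faces D.
  have [aV bV] := adj_vertex ab; have [_ cV] := adj_vertex ac.
  apply: clique_face => //; first by rewrite !finset.subUset !finset.sub1set aV bV cV.
  move=> u v; apply: triangle_adj; first exact: adj_sym.
  by exists a, b, c.
split => //; apply: (faces_sub F); apply/fintype.subsetP => v; rewrite inE; exact: xt.
Qed.

(** * The contraction of an edge *)

Section Contract.
Context (R : realType) (M : topologicalType) (V : finType) (D : simplicial_complex V).
Context (surf : closed_connected_surface R M) (tri : triangulates D R M) (fl : flag D).
Context (w c : V) (wc : adj D w c).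
Local Notation e := (adj D).

Let K4 := no_K4 surf tri fl.

Lemma other_neighbour u v x : e u v -> exists y, [/\ y != x, e u y & e v y].
Proof.
move=> /(card_common surf tri fl)/eqP/cards2P[a [b [ab E]]].
have mem y : y \in [set a; b]%SET -> e u y && e v y by rewrite -E !inE.
have /andP[ua va] : e u a && e v a by apply: mem; rewrite !inE eqxx.
have /andP[ub vb] : e u b && e v b by apply: mem; rewrite !inE eqxx orbT.
have [ax|ax] := eqVneq a x; last by exists a.
by exists b; rewrite -ax eq_sym.
Qed.

Lemma has_neighbour u : u \in vertices D -> exists v, e u v.
Proof. by move=> /(nbrs_neq0 surf tri)/finset.set0Pn[v]; rewrite inE; exists v. Qed.

Lemma complex_realization : realization D R = facet_realization (triangle e).
Proof.
apply: realization_triangles => //; first exact: has_neighbour.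
by move=> u v /(other_neighbour u)[x [_ ux vx]]; exists x.
Qed.

Lemma link_list : exists u0 u1 r, [/\ uniq [:: c, u0, u1 & r],
  forall x, (x \in [:: c, u0, u1 & r]) = e w x &
  forall y z, e w y -> e w z ->
    e y z = (z == next [:: c, u0, u1 & r] y) || (y == next [:: c, u0, u1 & r] z)].
Proof.
have [wV cV] := adj_vertex wc.
have deg2 x : x \in nbrs D w -> #|[set y in nbrs D w | e x y]%SET| = 2%N.
  rewrite inE => wx; rewrite -(card_common surf tri fl wx).
  by apply: eq_card => y; rewrite !inE.
have conn (A B : {set V}) : nbrs D w = (A :|: B)%SET -> A != finset.set0 -> B != finset.set0 ->
    (forall a b, a \in A -> b \in B -> ~~ e a b && (a != b)) -> False.
  exact: (link_connected surf tri wV).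
have cN : c \in nbrs D w by rewrite inE.
have [s [us sE s1 eE]] := cycle_list_from (@adj_sym V D) (@adj_irr V D) deg2 conn cN.
case: s us sE s1 eE => [|u0 [|u1 r]] // us sE _ eE; exists u0, u1, r; split=> //.
  by move=> x; rewrite sE inE.
by move=> y z wy wz; rewrite eE ?inE.
Qed.

(** The vertex [c] takes over the neighbours of [w]; [w] itself disappears only through the vertex
    set of [contraction]. *)
Definition contracted_adj : rel V := fun x y =>
  [|| e x y, (x == c) && e w y | (y == c) && e w x].

Definition contraction : simplicial_complex V :=
  clique_complex (vertices D :\ w)%SET contracted_adj.

Local Notation e' := (adj contraction).

Lemma contracted_adj_sym : symmetric contracted_adj.
Proof. by move=> x y; rewrite /contracted_adj adj_sym [X in _ || X]orbC. Qed.

Lemma adj_contraction x y : e' x y = [&& x != w, y != w, x != y & contracted_adj x y].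
Proof.
rewrite (adj_clique_complex _ contracted_adj_sym) !finset.in_setD1.
have [wV cV] := adj_vertex wc.
case: (x != y) => /=; last by rewrite !andbF.
case: (boolP (contracted_adj x y)) => [|_]; last by rewrite !andbF.
case: (x != w); case: (y != w); rewrite ?andbF //= !andbT.
by case/or3P=> [/adj_vertex[-> ->]|/andP[/eqP-> /adj_vertex[_ ->]]|/andP[/eqP-> /adj_vertex[_ ->]]]; rewrite ?cV.
Qed.

Lemma f0_contraction : (f0 contraction < f0 D)%N.
Proof.
rewrite /f0 vertices_clique_complex [X in (_ < X)%N](cardsD1 w).
by have [-> _] := adj_vertex wc.
Qed.

(** Translates the cyclic list of the link of [w] into the form that [contract_homeomorphic]
    expects: the triangles at [w], the fan at [c] replacing them, and the two common neighbours of
    [w] and [c]. *)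
Lemma contracted_link_list u0 u1 r : uniq [:: c, u0, u1 & r] ->
  (forall x, (x \in [:: c, u0, u1 & r]) = e w x) ->
  (forall y z, e w y -> e w z ->
    e y z = (z == next [:: c, u0, u1 & r] y) || (y == next [:: c, u0, u1 & r] z)) ->
  [/\ forall t, (exists2 p, p \in segments c (rcons [:: u0, u1 & r] c) & t = triple w p) <->
       triangle e t /\ w \in t,
     forall t, (exists2 p, p \in segments u0 (u1 :: r) & t = triple c p) <->
       exists x y, [/\ e w x, e w y, e x y, x != c & y != c /\ t = [set c; x; y]%SET]
   & forall u, e w u -> e c u -> u = u0 \/ u = last u1 r].
Proof.
move=> us sE eE.
have segE p : (p \in segments c (rcons [:: u0, u1 & r] c)) = (p.1 \in [:: c, u0, u1 & r]) && (p.2 == next [:: c, u0, u1 & r] p.1).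
  exact: mem_segments_next.
have segD p : (p \in segments c (rcons [:: u0, u1 & r] c)) =
    [|| p == (c, u0), p \in segments u0 (u1 :: r) | p == (last u1 r, c)].
  have -> : segments c (rcons [:: u0, u1 & r] c) = (c, u0) :: segments u0 (rcons (u1 :: r) c) by [].
  by rewrite in_cons segments_rcons mem_rcons in_cons [(p == _) || (p \in _)]orbC.
have seg_e p : p \in segments c (rcons [:: u0, u1 & r] c) -> [/\ e w p.1, e w p.2 & e p.1 p.2].
  rewrite segE => /andP[p1 /eqP p2]; have w1 : e w p.1 by rewrite -sE.
  have w2 : e w p.2 by rewrite p2 -sE mem_next.
  by split => //; rewrite eE // p2 eqxx.
have e_seg x y : e w x -> e w y -> e x y ->
    (x, y) \in segments c (rcons [:: u0, u1 & r] c) \/ (y, x) \in segments c (rcons [:: u0, u1 & r] c).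
  by move=> wx wy; rewrite eE // => /orP[]/eqP E; [left|right];
    rewrite segE; apply/andP; split; by [rewrite sE|apply/eqP].
have cN : c \notin [:: u0, u1 & r] by move: us; rewrite cons_uniq => /andP[].
have inner p : p \in segments u0 (u1 :: r) -> p.1 != c /\ p.2 != c.
  move=> /mem_segments/andP[p1 p2]; split; apply: contraNneq cN => <- //.
  by rewrite in_cons p2 orbT.
split.
- move=> t; split=> [[p /seg_e[w1 w2 p12] ->]|[tT wt]].
    by split; [exists w, p.1, p.2|rewrite !inE eqxx].
  have [y [z [wy wz yz ->]]] := triangle_at (@adj_sym V D) tT wt.
  have [pI|pI] := e_seg _ _ wy wz yz; first by exists (y, z).
  by exists (z, y) => //; apply/finset.setP => x; rewrite !inE /= -!orbA [(x == y) || _]orbC.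
- move=> t; split=> [[p pI ->]|[x [y [wx wy xy xc [yc ->]]]]].
    have [p1 p2] := inner _ pI; have [|w1 w2 p12] := seg_e p; first by rewrite segD pI orbT.
    by exists p.1, p.2.
  have [|] := e_seg _ _ wx wy xy; rewrite segD => /or3P[/eqP[E1 E2]|pI|/eqP[E1 E2]].
  + by rewrite E1 eqxx in xc.
  + by exists (x, y).
  + by rewrite E2 eqxx in yc.
  + by rewrite E1 eqxx in yc.
  + by exists (y, x) => //; apply/finset.setP => z; rewrite !inE /= -!orbA [(z == x) || _]orbC.
  + by rewrite E2 eqxx in xc.
- move=> u wu cu; have [|] := e_seg _ _ wc wu cu; rewrite segD => /or3P[/eqP[]|/inner[]|/eqP[]] //=.
  + by left.
  + by rewrite eqxx.
  + by move=> E _; case/negP: cN; rewrite E in_cons mem_last orbT.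
  + by move=> uc; rewrite -uc adj_irr in cu.
  + by rewrite eqxx.
  + by right.
Qed.

Context (no_square : forall a b, e c a -> e a b -> e b w -> ~~ e a w -> ~~ e b c -> a != w -> b != c -> False).

Let ew x : e x w = e w x. Proof. exact: adj_sym. Qed.

(* Otherwise [c x y w] is an induced square. *)
Let mixed x y : e c x -> e w y -> e x y -> x != w -> y != c -> e w x || e c y.
Proof.
move=> cx wy xy xw yc; apply: contraT; rewrite negb_or => /andP[wx cy].
by exfalso; apply: (no_square cx xy); rewrite // adj_sym.
Qed.

Lemma contraction_off x y : e' x y -> x != c -> y != c -> [/\ e x y, x != w & y != w].
Proof.
rewrite adj_contraction /contracted_adj => /and4P[xw yw _].
by move=> + /negbTE xc /negbTE yc; rewrite xc yc /= orbF.
Qed.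

Lemma contraction_at y : e' c y = [&& y != w, y != c & e c y || e w y].
Proof.
rewrite adj_contraction /contracted_adj eqxx eq_sym (adj_neq wc) (eq_sym c) /=.
by have [->|] := eqVneq y c; rewrite ?andbF //= orbF.
Qed.

(** An edge joining a neighbour of [c] to a neighbour of [w] has, by [mixed], an end adjacent to
    both, so the whole edge lies in one of the two old links. *)
Lemma contraction_link x y : e' c x -> e' c y -> e' x y ->
  e x y /\ (e c x /\ e c y \/ e w x /\ e w y).
Proof.
rewrite !contraction_at => /and3P[xw xc cx] /and3P[yw yc cy] xy.
have [e_xy _ _] := contraction_off xy xc yc; split => //.
have yx : e y x by rewrite adj_sym.
case/orP: cx => hx; case/orP: cy => hy; [by left| | |by right].
- by case/orP: (mixed hx hy e_xy xw yc) => h; [right|left].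
- by case/orP: (mixed hy hx yx yw xc) => h; [right|left].
Qed.

(** In a 4-clique through [c], each edge of the opposite triangle lies in the old link of [c] or of
    [w]. Two of the three edges lie in the same link and cover the triangle, which gives a 4-clique
    before the contraction. *)
Lemma contraction_no_K4 a b x y :
  e' a b -> e' a x -> e' a y -> e' b x -> e' b y -> e' x y -> False.
Proof.
have main p q s : e' c p -> e' c q -> e' c s -> e' p q -> e' p s -> e' q s -> False.
  move=> cp cq cs pq ps qs.
  have [e_pq h1] := contraction_link cp cq pq.
  have [e_ps h2] := contraction_link cp cs ps.
  have [e_qs h3] := contraction_link cq cs qs.
  case: (boolP (e c p && e c q && e c s)) => [/andP[/andP[h4 h5] h6]|nc].
    exact: (K4 h4 h5 h6 e_pq e_ps e_qs).
  case: (boolP (e w p && e w q && e w s)) => [/andP[/andP[h4 h5] h6]|nw].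
    exact: (K4 h4 h5 h6 e_pq e_ps e_qs).
  case: h1 nc nw => -[k1 k2]; case: h2 => -[k3 k4]; case: h3 => -[k5 k6]; rewrite ?k1 ?k2 ?k3 ?k4 ?k5 ?k6 //.
move=> ab ax ay bx by_ xy; have es := @adj_sym V contraction.
have [ac|ac] := eqVneq a c; first by subst a; exact: (main b x y).
have [bc|bc] := eqVneq b c; first by subst b; apply: (main a x y); rewrite // es.
have [xc|xc] := eqVneq x c; first by subst x; apply: (main a b y); rewrite // es.
have [yc|yc] := eqVneq y c; first by subst y; apply: (main a b x); rewrite // es.
have off p q : e' p q -> p != c -> q != c -> e p q by move=> h /(contraction_off h) h' /h'[].
by apply: (@K4 a b x y); apply: off.
Qed.

Lemma contraction_common u v : e' u v -> exists x, e' u x /\ e' v x.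
Proof.
have main y : e' c y -> exists x, e' c x /\ e' y x.
  rewrite contraction_at => /and3P[yw yc /orP[] h].
    have [x [xw cx yx]] := other_neighbour w h; exists x.
    by rewrite contraction_at adj_contraction /contracted_adj xw yw cx yx (adj_neq yx) eq_sym (adj_neq cx).
  have [x [xc wx yx]] := other_neighbour c h; exists x.
  by rewrite contraction_at adj_contraction /contracted_adj yw xc wx yx (adj_neq yx) eq_sym (adj_neq wx) orbT.
move=> uv; have vu : e' v u by rewrite adj_sym.
have [uc|uc] := eqVneq u c; first by subst u; exact: main.
have [vc|vc] := eqVneq v c; first by subst v; have [x []] := main _ vu; exists x.
have [e_uv uw vw] := contraction_off uv uc vc.
have [x [_ ux vx]] := other_neighbour u e_uv.
have [xw|xw] := eqVneq x w; last first.
  by exists x; rewrite !adj_contraction /contracted_adj uw vw xw ux vx (adj_neq ux) (adj_neq vx).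
subst x; exists c; rewrite ![e' _ c]adj_sym !contraction_at uw vw uc vc.
by rewrite -!ew ux vx !orbT.
Qed.

Lemma contraction_neighbour u : u \in vertices contraction -> exists v, e' u v.
Proof.
rewrite vertices_clique_complex finset.in_setD1 => /andP[uw uV].
have [uc|uc] := eqVneq u c.
  have [y [yc wy cy]] := other_neighbour c wc; exists y.
  by rewrite uc contraction_at yc cy eq_sym (adj_neq wy).
have [v uv] := has_neighbour uV; have [vw|vw] := eqVneq v w; last first.
  by exists v; rewrite adj_contraction /contracted_adj uw vw uv (adj_neq uv).
by exists c; rewrite adj_sym contraction_at uw uc -ew -vw uv orbT.
Qed.

Lemma contraction_triangle t : triangle e' t <-> triangle e t /\ w \notin t \/
  exists x y, [/\ e w x, e w y, e x y, x != c & y != c /\ t = [set c; x; y]%SET].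
Proof.
have es' := @adj_sym V contraction; have cw : c != w by rewrite eq_sym (adj_neq wc).
split=> [tT|[[[x [y [z [xy xz yz ->]]]] wt]|[x [y [wx wy xy xc [yc ->]]]]]].
- have wt : w \notin t.
    apply/negP => /(triangle_at es' tT)[y [z [wy _ _ _]]].
    by move: wy; rewrite adj_contraction eqxx.
  case: (boolP (c \in t)) => ct.
    have [x [y [cx cy xy tE]]] := triangle_at es' tT ct.
    have [e_xy [[h1 h2]|[h1 h2]]] := contraction_link cx cy xy.
      by left; split => //; exists c, x, y.
    move: cx cy; rewrite !contraction_at => /and3P[_ xc _] /and3P[_ yc _].
    by right; exists x, y.
  left; split => //; move: tT => [x [y [z [xy xz yz tE]]]].
  move: ct; rewrite tE !inE !negb_or => /andP[/andP[]]; rewrite !(eq_sym c) => cx cy cz.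
  exists x, y, z; have [-> _ _] := contraction_off xy cx cy.
  by have [-> _ _] := contraction_off xz cx cz; have [-> _ _] := contraction_off yz cy cz.
- move: wt; rewrite !inE !negb_or => /andP[/andP[]]; rewrite !(eq_sym w) => xw yw zw.
  exists x, y, z; rewrite !adj_contraction /contracted_adj xw yw zw xy xz yz.
  by rewrite (adj_neq xy) (adj_neq xz) (adj_neq yz).
- have [xw yw] : x != w /\ y != w by rewrite !(eq_sym _ w) (adj_neq wx) (adj_neq wy).
  exists c, x, y; rewrite !contraction_at adj_contraction /contracted_adj xw yw xc yc wx wy xy.
  by rewrite (adj_neq xy) !orbT.
Qed.

Lemma flag_contraction : flag contraction.
Proof. apply: flag_clique_complex; exact: contracted_adj_sym. Qed.

Lemma triangulates_contraction : triangulates contraction R M.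
Proof.
have [u0 [u1 [r [us sE eE]]]] := link_list.
have [segT segC ends] := contracted_link_list us sE eE.
apply: homeomorphic_trans (tri); apply: homeomorphic_sym.
rewrite complex_realization (realization_triangles R flag_contraction contraction_no_K4
  contraction_neighbour contraction_common).
have tadj t x y : triangle e t -> x \in t -> y \in t -> x != y -> e x y.
  exact: triangle_adj (@adj_sym V D).
have c_notin : c \notin [:: u0, u1 & r] by move: us; rewrite cons_uniq => /andP[].
have u0_notin : u0 \notin u1 :: r by move: us; rewrite 2!cons_uniq => /and3P[].
apply: (@contract_homeomorphic R V w c u0 u1 r).
- by rewrite cons_uniq us andbT sE adj_irr.
- by move=> t; rewrite segT.
- move=> t u tT ct ut uI; apply: ends; first by rewrite -sE in_cons uI orbT.
  by apply: tadj tT _ _ _ => //; apply: contraNneq c_notin => ->.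
- move=> t tT ct u0t lt.
  have lI : last u1 r \in u1 :: r by exact: mem_last.
  have lI' : last u1 r \in [:: u0, u1 & r] by rewrite in_cons lI orbT.
  have u0I : u0 \in [:: u0, u1 & r] by exact: mem_head.
  have cu x : x \in [:: u0, u1 & r] -> c != x by move=> xI; apply: contraNneq c_notin => ->.
  have wu x : x \in [:: u0, u1 & r] -> e w x by move=> xI; rewrite -sE in_cons xI orbT.
  have u0l : u0 != last u1 r by apply: contraNneq u0_notin => ->.
  apply: (K4 wc (wu _ u0I) (wu _ lI') _ _ (tadj _ _ _ tT u0t lt u0l)).
  + exact: tadj tT ct u0t (cu _ u0I).
  + exact: tadj tT ct lt (cu _ lI').
- by move=> t; rewrite contraction_triangle segC.
Qed.

End Contract.

(** * Graphs with at most ten vertices all of whose edges lie in induced squares *)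

Lemma uniq_subset_card (T : finType) (A : {set T}) (s : seq T) :
  uniq s -> {subset s <= A} -> (size s <= #|A|)%N.
Proof. by move=> /card_uniqP<- sA; apply/subset_leq_card/fintype.subsetP. Qed.

Lemma uniq_cover (T : finType) (A : {set T}) (s : seq T) x :
  uniq s -> {subset s <= A} -> (#|A| <= size s)%N -> x \in A -> x \in s.
Proof.
move=> us sA As xA; apply: contraLR As => xs; rewrite -ltnNge.
apply: (@uniq_subset_card _ A (x :: s)); first by rewrite /= xs.
by move=> y; rewrite inE => /orP[/eqP->//|/sA].
Qed.

Section Endgame.
Context (V : finType) (U : {set V}) (e : rel V).
Local Notation N v := ([set w | e v w]%SET).
Context (e_sym : symmetric e) (e_irr : irreflexive e).
Context (e_vertex : forall u v, e u v -> v \in U).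
Context (no_clique4 : forall a b c d, e a b -> e a c -> e a d -> e b c -> e b d -> e c d -> False).
Context (card_common2 : forall u v, e u v -> #|N u :&: N v|%SET = 2%N).
Context (has_nbr : forall v, v \in U -> N v != finset.set0).
Context (link_conn : forall v (A B : {set V}), N v = (A :|: B)%SET -> A != finset.set0 ->
  B != finset.set0 -> (forall a b, a \in A -> b \in B -> ~~ e a b && (a != b)) -> False).
Context (graph_conn : forall A B : {set V}, U = (A :|: B)%SET -> A != finset.set0 ->
  B != finset.set0 -> (forall a b, a \in A -> b \in B -> ~~ e a b && (a != b)) -> False).
Context (induced4 : forall c w, e c w -> exists a b,
  [/\ e c a, e a b, e b w & [/\ ~~ e a w, ~~ e b c, a != w & b != c]]).

Let neq u v : e u v -> u != v.
Proof. by apply: contraTneq => ->; rewrite e_irr. Qed.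

Lemma two_common v x : e v x -> exists y z, [/\ y != z, e v y, e x y, e v z & e x z].
Proof.
move=> /card_common2/eqP/cards2P[y [z [yz E]]]; exists y, z.
have : y \in (N v :&: N x)%SET by rewrite E !inE eqxx.
have : z \in (N v :&: N x)%SET by rewrite E !inE eqxx orbT.
by rewrite !inE => /andP[-> ->] /andP[-> ->].
Qed.

Lemma third_common v x y z t : e v x -> e v y -> e x y -> e v z -> e x z -> y != z ->
  e v t -> e x t -> (t == y) || (t == z).
Proof.
move=> vx vy xy vz xz yz vt xt.
have /eqP E : [set y; z]%SET == (N v :&: N x)%SET.
  rewrite eqEcard cards2 yz card_common2 // leqnn andbT.
  by rewrite finset.subUset !finset.sub1set !inE vy xy vz xz.
by rewrite -in_set2 E !inE vt xt.
Qed.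

Lemma other_common v x y : e v x -> e v y -> e x y -> exists2 z, y != z & e v z && e x z.
Proof.
move=> /two_common[a [b [ab va xa vb xb]]] vy xy.
have [ya|ya] := eqVneq y a; last by exists a; rewrite ?va.
by exists b; rewrite ?vb // ya.
Qed.

(** In the link of [v] every vertex has exactly two neighbours, so a 4-cycle in the link is a
    component of it, hence the whole connected link. *)
Lemma link_square v a b c d t : e v a -> e v b -> e v c -> e v d ->
  e a b -> e b c -> e c d -> e d a -> a != c -> b != d -> e v t -> t \in [set a; b; c; d]%SET.
Proof.
move=> va vb vc vd ab bc cd da ac bd vt; apply: contraT => tS; exfalso.
pose A := [set a; b; c; d]%SET.
have AE : N v = (A :|: N v :\: A)%SET.
  apply/finset.setP => x; rewrite finset.in_setU finset.in_setD; case: (boolP (x \in A)) => // xA.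
  by rewrite orTb; move: xA; rewrite !inE => /orP[/orP[/orP[]|]|] /eqP->.
apply: (link_conn AE).
- by apply/finset.set0Pn; exists a; rewrite !inE eqxx.
- by apply/finset.set0Pn; exists t; rewrite finset.in_setD tS inE.
move=> x y xA; rewrite finset.in_setD inE => /andP[yA vy]; apply/andP; split; last first.
  by apply: contraNneq yA => <-.
have close p q r : e v p -> e v q -> e v r -> e q p -> e q r -> p != r -> p \in A -> r \in A -> ~~ e q y.
  move=> vp vq vr qp qr pr pA rA; apply: contraNN yA => qy.
  by have := third_common vq vp qp vr qr pr vy qy; move=> /orP[]/eqP->.
have aA : a \in A by rewrite !inE eqxx.
have bA : b \in A by rewrite !inE eqxx ?orbT.
have cA : c \in A by rewrite !inE eqxx ?orbT.
have dA : d \in A by rewrite !inE eqxx ?orbT.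
move: xA; rewrite !inE => /orP[/orP[/orP[]|]|] /eqP->.
- by apply: (close d a b) => //; rewrite 1?e_sym // eq_sym.
- by apply: (close a b c) => //; rewrite e_sym.
- by apply: (close b c d) => //; rewrite e_sym.
- by apply: (close c d a) => //; rewrite 1?e_sym // eq_sym.
Qed.

(** Connectedness of the link in the form used below: otherwise the two values of [Q] would separate
    it. *)
Lemma link_monochromatic v (Q : pred V) :
  (forall u u', e v u -> e v u' -> e u u' -> Q u = Q u') ->
  forall u u', e v u -> e v u' -> Q u = Q u'.
Proof.
move=> QE u u' vu vu'; apply/eqP; apply: contraT => uu'; exfalso.
have AE : N v = ([set x in N v | Q x] :|: [set x in N v | ~~ Q x])%SET.
  by apply/finset.setP => x; rewrite !inE -andb_orr orbN andbT.
apply: (link_conn AE).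
- apply/finset.set0Pn; case: (boolP (Q u)) => Qu; first by exists u; rewrite !inE vu.
  by exists u'; rewrite !inE vu'; move: uu'; rewrite (negPf Qu); case: (Q u').
- apply/finset.set0Pn; case: (boolP (Q u)) => Qu; last by exists u; rewrite !inE vu.
  by exists u'; rewrite !inE vu'; move: uu'; rewrite Qu; case: (Q u').
move=> a b; rewrite !inE => /andP[va Qa] /andP[vb Qb].
apply/andP; split; last by apply: contraNneq Qb => <-.
by apply: contraNN Qb => ab; rewrite -(QE a).
Qed.

Definition octahedral : Prop := exists a b : 'I_3 -> V,
  [/\ injective a, injective b, forall i j, a i != b j,
     forall x, (x \in U) = [exists i, (x == a i) || (x == b i)] &
     forall i, [/\ ~~ e (a i) (b i) & forall j, i != j -> [/\ e (a i) (a j), e (a i) (b j) & e (b i) (b j)]]].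

(** * Vertices far from a vertex of maximal degree *)

Section MaximalDegree.
Context (v : V) (vU : v \in U) (v_max : forall u, (#|N u| <= #|N v|)%N).

Let W := [set w in U | (w != v) && ~~ e v w]%SET.
Let WN u := [set x in W | e u x]%SET.

Lemma far_card : #|U| = (#|N v| + #|W|).+1%N.
Proof.
have -> : U = (v |: (N v :|: W))%SET.
  apply/finset.setP => x; rewrite !inE; have [->|xv] := eqVneq x v; first by rewrite vU.
  by case: (boolP (e v x)) => [/e_vertex|]; rewrite /= ?andbT.
rewrite cardsU1 !inE eqxx e_irr /= andbF add1n cardsU.
suff -> : (N v :&: W)%SET = finset.set0 by rewrite cards0 subn0.
by apply/finset.setP => x; rewrite !inE; case: (e v x); rewrite ?andbF.
Qed.

Let farP x : x \in W -> [/\ x \in U, x != v & ~~ e v x].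
Proof. by rewrite inE => /and3P. Qed.

Let far_or_near x : x \in U -> x != v -> (x \in W) || e v x.
Proof. by rewrite inE => -> ->; case: (e v x). Qed.

Let e_far x u : x \in W -> e u x -> e v u = (u \notin W).
Proof.
move=> /farP[xU xv vx] ux.
have uv : u != v by apply: contraNneq vx => <-.
by rewrite inE uv (e_vertex (_ : e x u)) 1?e_sym //= negbK.
Qed.

Lemma apex u u' : e v u -> e v u' -> e u u' -> exists x, [/\ x \in W, e u x & e u' x].
Proof.
move=> vu vu' uu'; have [uv u'v] : e u v /\ e u' v by rewrite !(e_sym _ v).
have [x vx /andP[ux u'x]] := other_common uu' uv u'v.
exists x; split => //; rewrite inE (e_vertex ux) eq_sym vx /=; apply/negP => e_vx.
by apply: (no_clique4 vu vu' e_vx uu' ux u'x).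
Qed.

Lemma has_far_nbr u : e v u -> exists x, x \in W /\ e u x.
Proof.
move=> vu; have [y [z [_ vy uy vz uz]]] := two_common vu.
by have [x [xW ux _]] := apex vu vy uy; exists x.
Qed.

(** If [x] is adjacent to no other far neighbour of [u], the two common neighbours of [u] and [x]
    are adjacent to [v]. With [v] and [x] they form a 4-cycle in the link of [u], which is then the
    whole link and contains no far vertex besides [x]. *)
Lemma far_isolated u x : e v u -> x \in W -> e u x -> (forall y, y \in W -> e u y -> ~~ e x y) ->
  forall y, y \in W -> e u y -> y = x.
Proof.
move=> vu xW ux iso y yW uy; have [p [q [pq up xp uq xq]]] := two_common ux.
have near t : e u t -> e x t -> e v t.
  by move=> ut xt; rewrite (e_far xW) 1?e_sym //; apply: contraL xt => /iso; apply.
have vx : ~~ e v x by have [] := farP xW.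
have vp := near _ up xp; have vq := near _ uq xq.
have := link_square (_ : e u v) up ux uq vp (_ : e p x) xq (_ : e q v) (_ : v != x) pq uy.
rewrite e_sym vu e_sym xp e_sym vq; have [_ xv _] := farP xW; rewrite eq_sym xv => /(_ isT isT isT isT).
have [_ yv vy] := farP yW; rewrite !inE (negPf yv) /= => /orP[/orP[]|] /eqP yE //.
- by move: vy; rewrite yE vp.
- by move: vy; rewrite yE vq.
Qed.

Lemma far_nbrs_card u : e v u -> #|N u| = (#|WN u| + 3)%N.
Proof.
move=> vu; have -> : N u = (WN u :|: (v |: (N v :&: N u)))%SET.
  apply/finset.setP => x; rewrite !inE; have [->|xv] := eqVneq x v; first by rewrite e_sym vu orbT.
  case: (boolP (e u x)) => [ux|]; rewrite ?andbF //=.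
  by rewrite (e_vertex ux) /=; case: (e v x).
rewrite cardsU cardsU1 card_common2 // !inE e_irr /=.
suff -> : (WN u :&: (v |: (N v :&: N u)))%SET = finset.set0 by rewrite cards0 subn0.
apply/finset.setP => x; rewrite !inE; have [->|xv] := eqVneq x v; first by rewrite andbF.
by case: (e v x); rewrite ?andbF.
Qed.

(** If [u] saw both values of [P], each far neighbour chosen for a value would, by [far_isolated],
    be adjacent to another one, with the same value; this makes four far neighbours. *)
Lemma far_not_mixed u (P : pred V) x y : (forall x y, x \in W -> y \in W -> e x y -> P x = P y) ->
  e v u -> (#|WN u| <= 3)%N -> x \in W -> y \in W -> e u x -> e u y -> P x = P y.
Proof.
move=> PE vu c3 xW yW ux uy; apply/eqP; apply: contraT => xy; exfalso.
have nbr z t : z \in W -> t \in W -> e u z -> e u t -> z != t -> exists2 z', z' \in WN u & e z z'.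
  move=> zW tW uz ut zt; case: (pickP (fun z' => (z' \in WN u) && e z z')) => [z' /andP[]|none].
    by exists z'.
  have /eqP tz : t == z.
    apply/eqP; apply: (far_isolated vu zW uz _ tW ut) => s sW us.
    by have := none s; rewrite inE sW us /= => ->.
  by move: zt; rewrite tz eqxx.
have xny : x != y by apply: contraNneq xy => ->.
have [x' x'W xx'] := nbr x y xW yW ux uy xny.
have [y' y'W yy'] : exists2 z', z' \in WN u & e y z' by apply: (nbr y x); rewrite // eq_sym.
have Px : P x = P x' by move: x'W; rewrite inE => /andP[? _]; exact: PE.
have Py : P y = P y' by move: y'W; rewrite inE => /andP[? _]; exact: PE.
have dif a b : P a != P b -> a != b by apply: contraNneq => ->.
have := @uniq_subset_card _ (WN u) [:: x; x'; y; y']; rewrite leqNgt ltnS c3 => no4; apply: notF; apply: no4.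
  by rewrite /= !inE !negb_or (neq xx') (neq yy') !dif // -?Px -?Py.
by apply/allP; rewrite /= x'W y'W ![_ \in WN u]finset.in_set xW yW ux uy.
Qed.

(** Connectedness of [W]. By [far_not_mixed] a neighbour of [v] inherits the value of its far
    neighbours; adjacent neighbours share an apex, so this value is constant on the link of [v]. Far
    vertices with the other value would be cut off from the rest of the graph. *)
Lemma far_connected (P : pred V) : (forall u, e v u -> (#|WN u| <= 3)%N) ->
  (forall x y, x \in W -> y \in W -> e x y -> P x = P y) ->
  forall x y, x \in W -> y \in W -> P x = P y.
Proof.
move=> c3 PE; pose Q u := [exists x in W, e u x && P x].
have QE u x : e v u -> x \in W -> e u x -> Q u = P x.
  move=> vu xW ux; apply/existsP/idP => [[y /and3P[yW uy]]|Px]; last by exists x; rewrite xW ux.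
  by rewrite (far_not_mixed PE vu (c3 _ vu) xW yW ux uy).
have Qc : forall u u', e v u -> e v u' -> Q u = Q u'.
  apply: link_monochromatic => u u' vu vu' uu'; have [x [xW ux u'x]] := apex vu vu' uu'.
  by rewrite (QE _ _ vu xW) // (QE _ _ vu' xW).
have /finset.set0Pn[u0] := has_nbr vU; rewrite inE => vu0.
suff all x : x \in W -> P x = Q u0 by move=> x y /all-> /all->.
move=> xW; apply/eqP; apply: contraT => xQ; exfalso.
pose B := [set y in W | P y != Q u0]%SET.
have UE : U = (U :\: B :|: B)%SET.
  apply/finset.setP => y; rewrite finset.in_setU finset.in_setD.
  by case: (boolP (y \in B)); rewrite ?andbT ?orbF //= inE => /andP[/farP[->]].
apply: (graph_conn UE).
- by apply/finset.set0Pn; exists v; rewrite !inE eqxx vU andbF.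
- by apply/finset.set0Pn; exists x; rewrite inE xW.
move=> a b; rewrite finset.in_setD => /andP[aB aU] bB; apply/andP; split; last first.
  by apply: contraNneq aB => ->.
move: (bB); rewrite inE => /andP[bW bP]; apply/negP => ab.
have := e_far bW ab; case: (boolP (a \in W)) => aW /= va.
  by move: aB; rewrite inE aW (PE a b) // bP.
by move: bP; rewrite -(QE a b) // (Qc a u0) // eqxx.
Qed.

Lemma far_has_nbr w : (forall u, e v u -> (#|WN u| <= 3)%N) -> w \in W -> (1 < #|W|)%N ->
  exists2 x, x \in W & e w x.
Proof.
move=> c3 wW W1; case: (pickP (fun x => (x \in W) && e w x)) => [x /andP[]|none]; first by exists x.
have : exists2 y, y \in W & y != w.
  move: W1; rewrite (cardsD1 w) wW ltnS card_gt0 => /finset.set0Pn[y]; rewrite !inE => /andP[yw yW].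
  by exists y; rewrite ?inE.
move=> [y yW /negPf yw].
have := far_connected (P := pred1 w) c3 _ yW wW; rewrite /= yw eqxx => H.
suff: false by []; apply: H => a b aW bW ab.
have [aw|aw] := eqVneq a w; first by have := none b; rewrite bW -aw ab.
by have [bw|//] := eqVneq b w; have := none a; rewrite aW -bw e_sym ab.
Qed.

Lemma center_edge c w : c \in W -> w \in W -> w != c ->
  (forall x, x \in W -> x != c -> e c x) ->
  (forall u x y, e v u -> x \in W -> y \in W -> e u x -> e u y -> x != y -> ~~ e x y -> e u c) ->
  exists x, [/\ x \in W, e x c, e x w & #|N x| = 4%N].
Proof.
move=> cW wW wc center mid; have cw := center _ wW wc.
have [a [b [ca ab bw [aw bc a_w b_c]]]] := induced4 cw.
have bnW : b \notin W by apply: contraNN bc => bW; rewrite e_sym center.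
have vb : e v b by rewrite (e_far wW).
have va : e v a.
  rewrite (e_far cW) 1?e_sym //; apply: contraNN bc => aW.
  by rewrite (mid b a w) // e_sym.
have [x [xW ax bx]] := apex va vb ab.
have xc : x != c by apply: contraNneq bc => <-.
have xw : x != w by apply: contraNneq aw => <-.
have cx := center _ xW xc; have e_xw : e x w by apply: contraNT bc; exact: mid.
exists x; split => //; first by rewrite e_sym.
have NE : N x =i [:: c; a; b; w].
  move=> t; rewrite inE; apply/idP/idP.
    suff : e x t -> t \in [set c; a; b; w]%SET by rewrite !inE -!orbA.
    by apply: link_square => //; rewrite 1?e_sym // 1?eq_sym // e_sym.
  by rewrite !inE => /or4P[]/eqP-> //; rewrite e_sym.
rewrite (eq_card NE); apply/card_uniqP.
by rewrite /= !inE !negb_or (neq ca) (neq ab) (neq bw) (neq cw) a_w eq_sym b_c.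
Qed.

(** If [u] is not adjacent to [c], its far neighbours are just the nonadjacent [x] and [y], against
    [far_isolated]. *)
Lemma few_far_mid c : (#|W| <= 3)%N -> c \in W -> (forall x, x \in W -> x != c -> e c x) ->
  forall u x y, e v u -> x \in W -> y \in W -> e u x -> e u y -> x != y -> ~~ e x y -> e u c.
Proof.
move=> W3 cW center u x y vu xW yW ux uy xy nxy; apply: contraT => nuc; exfalso.
have xc : x != c by apply: contraNneq nuc => <-.
have yc : y != c by apply: contraNneq nuc => <-.
case/eqP: (xy); apply/esym; apply: (far_isolated vu xW ux _ yW uy) => t tW ut.
have : t \in [:: c; x; y].
  apply: (@uniq_cover _ W) => //; last by apply/allP; rewrite /= cW xW yW.
  by rewrite /= !inE !negb_or xy eq_sym xc eq_sym yc.
rewrite !inE => /or3P[]/eqP tE.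
- by move: ut nuc; rewrite tE => ->.
- by rewrite tE e_irr.
- by rewrite tE.
Qed.

(** The link of [x] is the 4-cycle on [y], [z], [q], [p]: the second neighbour of [p] in it cannot
    be [z], since there is no 4-clique, so it is [q]. *)
Lemma triangle_tips x y z p q : e x y -> e x z -> e y z -> e x p -> e y p -> e x q -> e z q ->
  p != z -> q != y -> #|N x| = 4%N -> e p q.
Proof.
move=> xy xz yz xp yp xq zq pz qy N4.
have npz : ~~ e z p by apply/negP => zp; exact: (no_clique4 xy xz xp yz yp zp).
have pq : p != q by apply: contraNneq npz => ->.
have py : e p y by rewrite e_sym.
have [t yt /andP[xt pt]] := other_common xp xy py.
have : t \in [:: y; z; p; q].
  apply: (@uniq_cover _ (N x)); rewrite ?inE ?N4 //; last first.
    by apply/allP; rewrite /= !inE xy xz xp xq.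
  by rewrite /= !inE !negb_or pq (neq yz) (neq yp) (neq zq) eq_sym qy eq_sym pz.
rewrite !inE => /or4P[]/eqP tE.
- by rewrite tE eqxx in yt.
- by move: npz; rewrite e_sym -tE pt.
- by move: pt; rewrite tE e_irr.
- by rewrite -tE.
Qed.

(** Applied to the pairs [c x], [c y] and [x y] in turn, [center_edge] shows that [W] is a triangle
    with all vertices of degree 4. The outer tips over its three sides are near, and by
    [triangle_tips] pairwise adjacent, so together with [v] they form a 4-clique. *)
Lemma few_far_center c : c \in W -> (1 < #|W| <= 3)%N ->
  (forall x, x \in W -> x != c -> e c x) -> False.
Proof.
move=> cW /andP[W1 W3] center.
have tri z x : z \in W -> (forall t, t \in W -> t != z -> e z t) -> x \in W -> x != z ->
    exists y, [/\ y \in W, e y z, e y x & #|N y| = 4%N].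
  by move=> zW zc xW xz; apply: center_edge => //; apply: few_far_mid.
have [x xW xc] : exists2 x, x \in W & x != c.
  move: W1; rewrite (cardsD1 c) cW ltnS card_gt0 => /finset.set0Pn[y].
  by rewrite finset.in_setD1 => /andP[yc yW]; exists y.
have [y [yW yc yx Ny]] := tri c x cW center xW xc.
have [x' [x'W x'c x'y Nx']] := tri c y cW center yW (neq yc).
have WE t : t \in W -> [|| t == c, t == x | t == y].
  move=> tW; rewrite -[t == y]orbF; apply: (@uniq_cover _ W [:: c; x; y]) => //; last by apply/allP; rewrite /= cW xW yW.
  by rewrite /= !inE !negb_or eq_sym xc eq_sym (neq yc) eq_sym (neq yx).
have xx' : x' = x.
  by move: (WE _ x'W) => /or3P[]/eqP// E; [have := neq x'c|have := neq x'y]; rewrite E eqxx.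
subst x'.
have xcenter t : t \in W -> t != x -> e x t.
  by move=> /WE/or3P[]/eqP-> //; rewrite ?eqxx.
have [c' [c'W c'x c'y Nc']] := tri x y xW xcenter yW (neq yx).
have cc' : c' = c.
  by move: (WE _ c'W) => /or3P[]/eqP// E; [have := neq c'x|have := neq c'y]; rewrite E eqxx.
subst c'.
have [p cp /andP[yp xp]] := other_common yx yc x'c.
have [q yq /andP[cq xq]] := other_common c'x c'y x'y.
have [r xr /andP[yr cr]] := other_common yc yx c'x.
have far t s : s \in W -> e s t -> t != x -> t != y -> t != c -> e v t.
  by move=> sW st tx ty tc; rewrite (e_far sW) 1?e_sym //; apply/negP => /WE; rewrite (negPf tx) (negPf ty) (negPf tc).
have vp : e v p by apply: (far p y); rewrite // eq_sym ?(neq yp) ?(neq xp).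
have vq : e v q by apply: (far q c); rewrite // eq_sym ?(neq cq) ?(neq xq).
have vr : e v r by apply: (far r y); rewrite // eq_sym ?(neq yr) ?(neq cr).
have pq : e p q by apply: (triangle_tips (x := x) (y := y) (z := c)); rewrite // 1?e_sym // eq_sym.
have pr : e p r by apply: (triangle_tips (x := y) (y := x) (z := c)); rewrite // 1?e_sym // eq_sym.
have qr : e q r by apply: (triangle_tips (x := c) (y := x) (z := y)); rewrite // 1?e_sym // eq_sym.
exact: (no_clique4 vp vq vr pq pr qr).
Qed.

(** No vertex of [W] is isolated in it, so with at most three vertices one of them is adjacent to
    all the others. *)
Lemma few_far : (1 < #|W| <= 3)%N -> False.
Proof.
move=> W13; have /andP[W1 W3] := W13.
have c3 u : e v u -> (#|WN u| <= 3)%N.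
  by move=> _; apply: leq_trans W3; apply/subset_leq_card/fintype.subsetP => x; rewrite finset.in_set => /andP[].
have /finset.set0Pn[x xW] : W != finset.set0 by rewrite -card_gt0 ltnW.
have [y yW xy] := far_has_nbr c3 xW W1.
case: (pickP (fun z => [&& z \in W, z != x & z != y])) => [z /and3P[zW zx zy]|none]; last first.
  apply: (@few_far_center x) => // t tW tx; have := none t; rewrite tW tx /=.
  by case: eqP => // ->.
have WE t : t \in W -> [|| t == x, t == y | t == z].
  move=> tW; rewrite -[t == z]orbF; apply: (@uniq_cover _ W [:: x; y; z]) => //.
    by rewrite /= !inE !negb_or (neq xy) eq_sym zx eq_sym zy.
  by apply/allP; rewrite /= xW yW zW.
have [t tW zt] := far_has_nbr c3 zW W1.
move: (WE _ tW) => /or3P[]/eqP tE.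
- apply: (@few_far_center x) => // s /WE/or3P[]/eqP-> //; first by rewrite eqxx.
  by rewrite e_sym -tE.
- apply: (@few_far_center y) => // s /WE/or3P[]/eqP-> //; first by rewrite e_sym.
  + by rewrite eqxx.
  + by rewrite e_sym -tE.
- by have := neq zt; rewrite tE eqxx.
Qed.

(** Adjacent neighbours of [v] share their only far neighbour, so all of them have the same one,
    [w]. Maximality of the degree makes [v] and [w] have the same neighbours, and the rest of [W] is
    cut off. *)
Lemma single_far_nbr : (1 < #|W|)%N -> (forall u, e v u -> (#|WN u| <= 1)%N) -> False.
Proof.
move=> W1 c1; have /finset.set0Pn[u0] := has_nbr vU; rewrite inE => vu0.
have [w [wW u0w]] := has_far_nbr vu0.
have uniq_far u x y : e v u -> x \in W -> y \in W -> e u x -> e u y -> x = y.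
  move=> vu xW yW ux uy; apply/eqP; apply: contraT => xy.
  have := @uniq_subset_card _ (WN u) [:: x; y]; rewrite leqNgt ltnS c1 // => no2; apply: no2.
    by rewrite /= inE xy.
  by apply/allP; rewrite /= ![_ \in WN u]finset.in_set xW yW ux uy.
have uw u : e v u -> e u w.
  move=> vu; suff -> : e u w = e u0 w by [].
  apply: (link_monochromatic (v := v) (Q := fun u => e u w)) => //.
  move=> {vu}u u' vu vu' uu'; have [x [xW ux u'x]] := apex vu vu' uu'.
  apply/idP/idP => [/(uniq_far u w x vu wW xW)|/(uniq_far u' w x vu' wW xW)] -> //.
have /eqP NE : N v == N w.
  rewrite eqEcard v_max andbT; apply/fintype.subsetP => u; rewrite !inE e_sym; rewrite [e u v]e_sym.
  by move=> /uw; rewrite e_sym.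
pose B := (W :\ w)%SET.
have UE : U = (U :\: B :|: B)%SET.
  apply/finset.setP => y; rewrite finset.in_setU finset.in_setD.
  by case: (boolP (y \in B)); rewrite ?andbT ?orbF //= finset.in_setD1 => /andP[_ /farP[->]].
apply: (graph_conn UE).
- by apply/finset.set0Pn; exists v; rewrite finset.in_setD vU !inE eqxx !andbF.
- by rewrite -card_gt0; move: W1; rewrite (cardsD1 w) wW.
move=> a b; rewrite finset.in_setD => /andP[aB aU] bB; apply/andP; split; last first.
  by apply: contraNneq aB => ->.
move: (bB); rewrite finset.in_setD1 => /andP[bw bW]; apply/negP => ab.
have := e_far bW ab; case: (boolP (a \in W)) => aW /= va; last first.
  by move: bw; rewrite (uniq_far a b w) ?eqxx ?uw.
have aw : a = w by apply/eqP; apply: contraNT aB => aw; rewrite finset.in_setD1 aw.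
have : b \in N w by rewrite inE -aw.
by rewrite -NE inE => vb; have [_ _] := farP bW; rewrite vb.
Qed.

(** * Degree five and four far vertices *)

Section FourFar.
Context (W4 : #|W| = 4%N) (N5 : #|N v| = 5%N) (c2 : forall u, e v u -> (#|WN u| <= 2)%N).

Lemma far_nbrs_adj u x y : e v u -> x \in W -> y \in W -> e u x -> e u y -> x != y -> e x y.
Proof.
move=> vu xW yW ux uy xy; apply: contraT => nxy; case/eqP: (xy); apply/esym.
apply: (far_isolated vu xW ux _ yW uy) => t tW ut.
have : t \in [:: x; y].
  apply: (@uniq_cover _ (WN u)); [by rewrite /= inE xy| |exact: c2|by rewrite finset.in_set tW].
  by apply/allP; rewrite /= ![_ \in WN u]finset.in_set xW yW ux uy.
by rewrite !inE => /orP[]/eqP->; rewrite ?e_irr.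
Qed.

Lemma far_nbrs_le2 u x y z : e v u -> x \in W -> y \in W -> z \in W ->
  e u x -> e u y -> e u z -> x != y -> x != z -> y != z -> False.
Proof.
move=> vu xW yW zW ux uy uz xy xz yz.
have := @uniq_subset_card _ (WN u) [:: x; y; z]; rewrite leqNgt ltnS c2 // => no3; apply: notF; apply: no3.
  by rewrite /= !inE !negb_or xy xz yz.
by apply/allP; rewrite /= ![_ \in WN u]finset.in_set xW yW zW ux uy uz.
Qed.

Lemma four_far t a b c d : t \in W -> a \in W -> b \in W -> c \in W -> d \in W ->
  uniq [:: a; b; c; d] -> [|| t == a, t == b, t == c | t == d].
Proof.
move=> tW aW bW cW dW u4.
rewrite -[t == d]orbF; apply: (@uniq_cover _ W [:: a; b; c; d]) => //; last by rewrite W4.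
by apply/allP; rewrite /= aW bW cW dW.
Qed.

(** The square is all of [W], so the common neighbours of [c] with [a] and with [w] are near. They
    are four distinct vertices, since a near vertex has at most two far neighbours; with [a] and [w]
    they give [c] degree at least 6. *)
Lemma no_far_square c a b w : c \in W -> a \in W -> b \in W -> w \in W ->
  e c a -> e a b -> e b w -> e c w -> ~~ e a w -> ~~ e b c -> a != w -> b != c -> False.
Proof.
move=> cW aW bW wW ca ab bw cw naw nbc aw bc.
have u4 : uniq [:: c; a; b; w].
  by rewrite /= !inE !negb_or (neq ca) (neq ab) (neq bw) (neq cw) eq_sym bc aw.
have near p z z' : z \in W -> ~~ e z z' -> e c z' -> (z == a) && (z' == w) || (z == w) && (z' == a) ->
    e c p -> e z p -> (p \notin W) && e v p.
  move=> zW zz' cz' zE cp zp; have pW : p \notin W.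
    apply/negP => /(four_far)/(_ cW aW bW wW u4).
    case/or4P => /eqP pE; move: cp zp; rewrite pE.
    - by rewrite e_irr.
    - by case/orP: zE => /andP[/eqP-> _]; rewrite ?e_irr // [e w a]e_sym (negPf naw).
    - by rewrite e_sym (negPf nbc).
    - by case/orP: zE => /andP[/eqP-> _]; rewrite ?e_irr // (negPf naw).
  by rewrite pW (e_far zW) 1?e_sym.
have nearA p : e c p -> e a p -> (p \notin W) && e v p.
  by apply: (near p a w) => //; rewrite !eqxx.
have nearW p : e c p -> e w p -> (p \notin W) && e v p.
  by apply: (near p w a); rewrite ?eqxx ?orbT // e_sym.
have dis p q : e c p -> e a p -> e c q -> e w q -> p != q.
  move=> cp ap cq wq; apply/negP => /eqP pq; have /andP[_ vp] := nearA _ cp ap.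
  by apply: (far_nbrs_le2 vp cW aW wW); rewrite ?(neq ca) ?(neq cw) // e_sym // pq.
have [p [p' [pp' cp ap cp' ap']]] := two_common ca.
have [q [q' [qq' cq wq cq' wq']]] := two_common cw.
have ou z : z \in W -> forall x, (x \notin W) && e v x -> z != x.
  by move=> zW x /andP[xW _]; apply: contraNneq xW => <-.
have c5 : (#|N c| <= 5)%N by rewrite -N5 v_max.
have := @uniq_subset_card _ (N c) [:: a; w; p; p'; q; q'].
rewrite leqNgt ltnS c5 => no6; apply: notF; apply: no6.
  have [pA p'A qA q'A] := And4 (nearA _ cp ap) (nearA _ cp' ap') (nearW _ cq wq) (nearW _ cq' wq').
  by rewrite /= !inE !negb_or aw !(ou a) // !(ou w) // pp' qq' !dis.
by apply/allP; rewrite /= !inE ca cw cp cp' cq cq'.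
Qed.

(** In an induced square [c a b w], both [a] and [b] are near, by [no_far_square] and
    [far_nbrs_adj]. The link of their apex is the square, so [c] and [w] are its only far
    neighbours. *)
Lemma far_tip c w : c \in W -> w \in W -> e c w ->
  exists x, [/\ x \in W, e x c, e x w & forall y, y \in W -> e x y -> y = c \/ y = w].
Proof.
move=> cW wW cw; have [a [b [ca ab bw [naw nbc aw bc]]]] := induced4 cw.
have /orP ba : (a \in W) || e v a by have := e_far cW (_ : e a c); rewrite e_sym => /(_ ca) ->; case: (a \in W).
have /orP bb : (b \in W) || e v b by have := e_far wW bw => ->; case: (b \in W).
case: ba => [aW|va]; case: bb => [bW|vb].
- by exfalso; apply: (@no_far_square c a b w).
- by case/negP: naw; apply: (far_nbrs_adj vb) => //; rewrite e_sym.
- by case/negP: nbc; apply: (far_nbrs_adj va) => //; rewrite e_sym.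
have [x [xW ax bx]] := apex va vb ab.
have xc : x != c by apply: contraNneq nbc => <-.
have xw : x != w by apply: contraNneq naw => <-.
have xc' : e x c by apply: (far_nbrs_adj va); rewrite // e_sym.
have xw' : e x w by apply: (far_nbrs_adj vb).
exists x; split => // y yW xy.
have : y \in [set c; a; b; w]%SET.
  by apply: (@link_square x) => //; rewrite 1?e_sym // 1?eq_sym // e_sym.
have [_ _ nvy] := farP yW.
rewrite !inE => /orP[/orP[/orP[]|]|] /eqP yE; [by left| | |by right].
- by rewrite yE va in nvy.
- by rewrite yE vb in nvy.
Qed.

(** The tip over [x c] can only be [w], so [w] is not adjacent to [z]. Then neither [w] nor [x] can
    be the tip over [c z]. *)
Lemma no_far_tip c w x z : c \in W -> w \in W -> x \in W -> z \in W -> uniq [:: c; w; x; z] ->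
  e c w -> e x c -> e x w -> ~~ e x z -> e z c -> False.
Proof.
move=> cW wW xW zW u4 cw xc xw nxz zc.
have WE t (tW : t \in W) := four_far tW cW wW xW zW u4.
have [y [yW yx yc ytip]] := far_tip xW cW xc.
have yw : y = w.
  move: (WE _ yW) => /or4P[]/eqP// yE; move: yx yc; rewrite yE ?e_irr //.
  by rewrite e_sym (negPf nxz).
subst y.
have nwz : ~~ e w z.
  apply/negP => /ytip-/(_ zW)[] zE; move: u4; rewrite /= zE !inE eqxx ?orbT //= ?andbF //.
have cz : e c z by rewrite e_sym.
have [y [yW' yc' yz _]] := far_tip cW zW cz.
move: (WE _ yW') => /or4P[]/eqP yE; move: yc' yz; rewrite yE ?e_irr //.
- by rewrite (negPf nwz).
- by rewrite (negPf nxz).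
Qed.

Lemma four_far_false : False.
Proof.
have /finset.set0Pn[c cW] : W != finset.set0 by rewrite -card_gt0 W4.
have c3 u : e v u -> (#|WN u| <= 3)%N by move=> /c2/leq_trans->.
have nb t : t \in W -> exists2 s, s \in W & e t s by move=> tW; apply: far_has_nbr; rewrite ?W4.
have [w wW cw] := nb _ cW.
have [x [xW xc xw tip]] := far_tip cW wW cw.
case: (pickP (fun z => [&& z \in W, z != c, z != w & z != x])) => [z /and4P[zW zc zw zx]|none]; last first.
  have : (#|W| <= #|[:: c; w; x]|)%N.
    apply/subset_leq_card/fintype.subsetP => t tW; have := none t.
    by rewrite tW !inE; do 3?[case: eqP].
  by rewrite W4 => /leq_trans/(_ (card_size _)).
have nxz : ~~ e x z by apply/negP => /(tip _ zW)[] zE; [move: zc|move: zw]; rewrite zE eqxx.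
have [t tW zt] := nb _ zW.
have u4 : uniq [:: c; w; x; z].
  by rewrite /= !inE !negb_or (neq cw) eq_sym (neq xc) eq_sym zc eq_sym (neq xw) eq_sym zw eq_sym zx.
have u4' : uniq [:: w; c; x; z].
  by rewrite /= !inE !negb_or eq_sym (neq cw) eq_sym (neq xw) eq_sym zw eq_sym (neq xc) eq_sym zc eq_sym zx.
move: (four_far tW cW wW xW zW u4) => /or4P[]/eqP tE; rewrite tE in zt.
- exact: (@no_far_tip c w x z).
- by apply: (@no_far_tip w c x z) => //; rewrite e_sym.
- by rewrite e_sym zt in nxz.
- by rewrite e_irr in zt.
Qed.

End FourFar.

Lemma many_far : (#|U| <= 10)%N -> (1 < #|W|)%N -> False.
Proof.
move=> U10 W1; case: (leqP #|W| 3) => W3; first by apply: few_far; rewrite W1.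
have cN : (#|N v| + #|W| <= 9)%N by rewrite -ltnS -far_card.
have Nu u : e v u -> (#|WN u| + 3 <= #|N v|)%N by move=> vu; rewrite -far_nbrs_card.
case: (leqP #|N v| 4) => N4.
  apply: single_far_nbr => // u vu; rewrite -(leq_add2r 3); exact: leq_trans (Nu _ vu) N4.
have N5 : #|N v| = 5%N by lia.
apply: four_far_false => //; first by lia.
by move=> u /Nu; rewrite N5; lia.
Qed.

(** Every neighbour of [v] has a far neighbour, hence is adjacent to [w]. An induced square through
    an edge [u u'] of the link avoids [v] and [w], each of its other vertices being nonadjacent to
    [u] or [u']; so it lies in the link. *)
Lemma one_far : (#|W| <= 1)%N -> octahedral.
Proof.
move=> W1; have /finset.set0Pn[u] := has_nbr vU; rewrite inE => vu.
have [w [wW uw]] := has_far_nbr vu.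
have WE x : x \in W -> x = w by move=> xW; apply: (card_le1_eqP W1).
have vw x : e v x -> e w x.
  by move=> /has_far_nbr[y [/WE-> yx]]; rewrite e_sym.
have [u' [_ [_ vu' uu' _ _]]] := two_common vu.
have [a [b [ua ab bu' [nau' nbu au' bu]]]] := induced4 uu'.
have near x y : e v y -> e x y = false -> e x u \/ e x u' -> e v x.
  move=> vy xy xu; have xU : x \in U by case: xu => xu; apply: (e_vertex (_ : e _ x)); rewrite e_sym; exact: xu.
  have xv : x != v by apply: contraFneq xy => ->.
  by have /orP[/WE xw|//] := far_or_near xU xv; move: xy; rewrite xw vw.
have va : e v a by apply: (near a u') => //; [exact/negbTE|left; rewrite e_sym].
have vb : e v b by apply: (near b u) => //; [exact/negbTE|right].
have Nv t : e v t -> t \in [set u; a; b; u']%SET.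
  by apply: link_square; rewrite // 1?e_sym // eq_sym.
have [_ wv nvw] := farP wW.
have nv x : e v x -> (v != x) /\ (w != x).
  by move=> vx; split; [exact: neq|apply: contraNneq nvw => ->].
have un : uniq [:: v; w; u; b; a; u'].
  rewrite /= !inE !negb_or (eq_sym v) wv; have [-> ->] := nv _ vu; have [-> ->] := nv _ vb.
  have [-> ->] := nv _ va; have [-> ->] := nv _ vu'; rewrite (eq_sym u) bu (neq ua) (neq uu').
  by rewrite eq_sym (neq ab) (neq bu') au'.
have [bv [av [uv u'v]]] : e b v /\ e a v /\ e u v /\ e u' v by rewrite !(e_sym _ v).
have [ba [u'b [u'u au]]] : e b a /\ e u' b /\ e u' u /\ e a u by rewrite e_sym ab e_sym bu' e_sym uu' e_sym ua.
have [wa wb wu wu'] := And4 (vw _ va) (vw _ vb) (vw _ vu) (vw _ vu').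
have [bw [aw u'w]] : e b w /\ e a w /\ e u' w by rewrite !(e_sym _ w).
exists (fun i => nth v [:: v; u; a] i), (fun i => nth v [:: w; b; u'] i).
(* Antipodal vertices are interleaved in one duplicate-free list, at positions [2 i] and [2 i + 1],
   so that injectivity and disjointness come from its uniqueness. *)
have Ea (i : 'I_3) : nth v [:: v; u; a] i = nth v [:: v; w; u; b; a; u'] i.*2.
  by case: i => [[|[|[|//]]] ip].
have Eb (i : 'I_3) : nth v [:: w; b; u'] i = nth v [:: v; w; u; b; a; u'] i.*2.+1.
  by case: i => [[|[|[|//]]] ip].
have lt_a (i : 'I_3) : (i.*2 < 6)%N by rewrite -[6%N]/(3.*2)%N ltn_double.
have lt_b (i : 'I_3) : (i.*2.+1 < 6)%N by rewrite -[6%N]/(3.*2)%N ltn_Sdouble.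
split.
- by move=> i j; rewrite !Ea => /eqP; rewrite nth_uniq // => /eqP/double_inj/val_inj.
- by move=> i j; rewrite !Eb => /eqP; rewrite nth_uniq // => /eqP[] /double_inj/val_inj.
- move=> i j; rewrite Ea Eb nth_uniq //; apply/eqP => /(congr1 odd) /=.
  by rewrite !odd_double.
- move=> x; apply/idP/existsP => [xU|[[[|[|[|//]]] ip]] /= /orP[]/eqP->]; last first.
  + exact: (e_vertex vu').
  + exact: (e_vertex va).
  + exact: (e_vertex vb).
  + exact: (e_vertex vu).
  + exact: (e_vertex uw).
  + exact: vU.
  have [->|xv] := eqVneq x v; first by exists (@Ordinal 3 0 isT); rewrite /= eqxx.
  have /orP[/WE->|/Nv] := far_or_near xU xv; first by exists (@Ordinal 3 0 isT); rewrite /= eqxx orbT.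
  rewrite !inE => /orP[/orP[/orP[]|]|] /eqP->.
  + by exists (@Ordinal 3 1 isT); rewrite /= eqxx.
  + by exists (@Ordinal 3 2 isT); rewrite /= eqxx.
  + by exists (@Ordinal 3 1 isT); rewrite /= eqxx orbT.
  + by exists (@Ordinal 3 2 isT); rewrite /= eqxx orbT.
- have nub : ~~ e u b by rewrite e_sym.
  by case=> [[|[|[|//]]] ip]; split => //; case=> [[|[|[|//]]] jp].
Qed.

End MaximalDegree.

Lemma small_graph_octahedral : U != finset.set0 -> (#|U| <= 10)%N -> octahedral.
Proof.
move=> /finset.set0Pn[v0 v0U] U10; case: (arg_maxnP (fun v => #|N v|) (isT : predT v0)) => v _ vmax.
have v_max u : (#|N u| <= #|N v|)%N by exact: vmax.
have vU : v \in U.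
  have := v_max v0; have := has_nbr v0U; rewrite -card_gt0 => /leq_trans H /H.
  by rewrite card_gt0 => /finset.set0Pn[u]; rewrite inE e_sym => /e_vertex.
have [W1|/(many_far vU v_max U10)//] := leqP #|[set w in U | (w != v) && ~~ e v w]%SET| 1.
exact: (one_far vU W1).
Qed.

End Endgame.

(** * The bound *)

Lemma sum_two_images (R : realType) (V I : finType) (a b : I -> V) (x : V -> R) :
  injective a -> injective b -> (forall i j, a i != b j) ->
  (forall v, (forall i, v != a i /\ v != b i) -> x v = 0) ->
  \sum_v x v = \sum_i (x (a i) + x (b i)).
Proof.
move=> a_inj b_inj ab x0; have image (f : I -> V) : injective f ->
    \sum_(v in [set f i | i in I]%SET) x v = \sum_i x (f i).
  by move=> f_inj; rewrite big_imset //= => i j _ _; exact: f_inj.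
rewrite big_split /= -!image // (bigID (mem [set a i | i in I]%SET)) /=; congr (_ + _).
rewrite (bigID (mem [set b i | i in I]%SET)) /= [X in _ + X]big1 ?addr0.
  apply: eq_bigl => v; apply: andb_idl => /imsetP[j _ ->].
  by apply/negP => /imsetP[i _ /eqP]; rewrite eq_sym (negbTE (ab i j)).
move=> v /andP[va vb]; apply: x0 => i; split.
  by apply: contraNneq va => ->; exact: imset_f.
by apply: contraNneq vb => ->; exact: imset_f.
Qed.

(** The cliques are the sets without an antipodal pair, so lying on a face means that one of
    [x (a i)] and [x (b i)] vanishes for every [i]. *)
Lemma octahedral_realization (R : realType) (V : finType) (D : simplicial_complex V)
    (a b : 'I_3 -> V) :
  flag D -> injective a -> injective b -> (forall i j, a i != b j) ->
  (forall x, (x \in vertices D) = [exists i, (x == a i) || (x == b i)]) ->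
  (forall i, ~~ adj D (a i) (b i) /\
     forall j, i != j -> [/\ adj D (a i) (a j), adj D (a i) (b j) & adj D (b i) (b j)]) ->
  realization D R = @octahedron R V a b.
Proof.
move=> fl a_inj b_inj ab UE e_ab; apply/predeqP => x.
have support v : v \in vertices D -> exists i, v = a i \/ v = b i.
  by rewrite UE => /existsP[i /orP[]/eqP->]; exists i; [left|right].
split=> [Xx|[x0 x1 xab xout]].
  have [x0 x1 sF] := Xx; have out v : (forall i, v != a i /\ v != b i) -> x v = 0.
    move=> vab; apply/eqP; apply: contraT => xv.
    have /support[i [vE|vE]] : v \in vertices D by apply: (face_vertex sF); rewrite inE.
      by have [] := vab i; rewrite vE eqxx.
    by have [] := vab i; rewrite vE eqxx.
  split => //; first by rewrite -sum_two_images.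
  move=> i; have [->|xa] := eqVneq (x (a i)) 0; [by left|right; apply/eqP].
  by apply: contraT => xb; have [/negP[]] := e_ab i; apply: (support_adj Xx).
split => //; first by rewrite (@sum_two_images _ _ _ a b).
apply: clique_face => //.
  apply/fintype.subsetP => v; rewrite inE UE; apply: contraNT; rewrite negb_exists => /forallP vab.
  by apply/eqP/xout => i; apply/andP; rewrite -negb_or.
have adjI u v i j : x u != 0 -> x v != 0 -> u != v -> u = a i \/ u = b i -> v = a j \/ v = b j -> adj D u v.
  have [->|ij] := eqVneq i j.
    move=> xu xv uv [uE|uE] [vE|vE]; move: xu xv uv; rewrite uE vE ?eqxx //.
      by have [->|->] := xab j; rewrite eqxx.
    by have [->|->] := xab j; rewrite eqxx.
  have [_ /(_ j ij)[h1 h2 h3]] := e_ab i; have [_ /(_ i)] := e_ab j.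
  by rewrite eq_sym ij => /(_ isT)[h4 h5 h6] _ _ _ [->|->] [->|->] //; rewrite adj_sym.
move=> u v; rewrite !inE => xu xv uv.
have vertex y : x y != 0 -> exists i, y = a i \/ y = b i.
  move=> xy; apply: support; rewrite UE; apply: contraT; rewrite negb_exists => /forallP yab.
  by move: xy; rewrite xout ?eqxx // => i; apply/andP; rewrite -negb_or.
by have [i ui] := vertex _ xu; have [j vj] := vertex _ xv; exact: (adjI u v i j).
Qed.

Lemma vertices_neq0 (R : realType) (M : topologicalType) (V : finType) (D : simplicial_complex V) :
  closed_connected_surface R M -> triangulates D R M -> vertices D != finset.set0.
Proof.
move=> [_ [_ _ [p _]]] [_ [g _]]; have := set_valP (g p); move: (\val (g p)) => x [_ x1 sF].
apply/finset.set0Pn; suff [v xv] : exists v, x v != 0.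
  by exists v; apply: (face_vertex sF); rewrite inE.
apply/existsP; apply: contraT; rewrite negb_exists => /forallP none.
have : \sum_v x v = 0 by apply: big1 => v _; apply/eqP; rewrite -[_ == _]negbK none.
by rewrite x1 => /eqP; rewrite oner_eq0.
Qed.

Lemma minimal_induced_square (R : realType) (M : topologicalType) (V : finType)
    (D : simplicial_complex V) c w :
  closed_connected_surface R M -> minimal_flag_triangulation R M D -> adj D c w ->
  exists a b, [/\ adj D c a, adj D a b, adj D b w &
    [/\ ~~ adj D a w, ~~ adj D b c, a != w & b != c]].
Proof.
move=> surf [fl tri minD] cw; have wc : adj D w c by rewrite adj_sym.
pose sq a b := [&& adj D c a, adj D a b, adj D b w, ~~ adj D a w, ~~ adj D b c, a != w & b != c].
have [/existsP[a /existsP[b]]|] := boolP [exists a, exists b, sq a b].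
  by move=> /and5P[h1 h2 h3 h4 /and3P[h5 h6 h7]]; exists a, b.
rewrite negb_exists => /forallP no.
have no_square a b : adj D c a -> adj D a b -> adj D b w -> ~~ adj D a w -> ~~ adj D b c ->
    a != w -> b != c -> False.
  move=> h1 h2 h3 h4 h5 h6 h7; have := no a; rewrite negb_exists => /forallP/(_ b).
  by rewrite /sq h1 h2 h3 h4 h5 h6 h7.
have := minD V (contraction D w c) (@flag_contraction V D w c)
  (triangulates_contraction surf tri fl wc no_square).
by rewrite leqNgt f0_contraction.
Qed.

Theorem theorem4p4 (R : realType) (M : topologicalType) (V : finType)
    (D : simplicial_complex V) :
  closed_connected_surface R M ->
  ~ homeomorphic M (sphere2 R) ->
  minimal_flag_triangulation R M D ->
  (11 <= f0 D)%N.
Proof.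
move=> surf not_sphere Dmin; have [fl tri _] := Dmin.
rewrite leqNgt; apply/negP => D10; apply: not_sphere.
have [a [b [a_inj b_inj ab UE e_ab]]] : octahedral (vertices D) (adj D).
  apply: small_graph_octahedral D10.
  - exact: adj_sym.
  - exact: adj_irr.
  - by move=> u v /adj_vertex[].
  - exact: no_K4 surf tri fl.
  - exact: card_common surf tri fl.
  - exact: nbrs_neq0 surf tri.
  - move=> v A B NE A0 B0.
    have vV : v \in vertices D.
      move: A0 => /finset.set0Pn[x xA]; have : x \in (A :|: B)%SET by rewrite finset.in_setU xA.
      by rewrite -NE inE => /adj_vertex[].
    exact: (link_connected surf tri vV NE A0 B0).
  - exact: graph_connected surf tri.
  - by move=> c w; exact: minimal_induced_square surf Dmin.
  - exact: vertices_neq0 surf tri.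
apply: (homeomorphic_trans (homeomorphic_sym tri)).
rewrite (octahedral_realization R fl a_inj b_inj ab UE) //.
  exact: octahedron_homeomorphic_sphere.
Qed.
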